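(* Fix a sequence $\{\sigma_k\}_{k\in\mathbb N}$ of positive real numbers tending to infinity as $k\to\infty$. For any $k\in\mathbb N$, let $(u_k,v_k)\in H^1(\Omega)^2$ be a global minimizer of the penalized problem \[ \min_{(u,v)\in H^1(\Omega)^2}\ \tfrac12\|S[u,v]-y_{\mathrm d}\|_{\mathcal D}^2+J(u,v)+\sigma_kF(u,v). \] Then $\{(u_k,v_k)\}_{k\in\mathbb N}$ contains a subsequence converging strongly in $H^1(\Omega)^2$ to a point $(\bar u,\bar v)\in\mathbb C$ such that $(\bar y,\bar u,\bar v)$, where $\bar y\in\mathcal Y$ is the state associated with $(\bar u,\bar v)$ (i.e. $A[\bar y]-B[\bar u]-C[\bar v]=0$), is an optimal solution (global minimizer) of \[ \min_{(y,u,v)\in\mathcal Y\times H^1(\Omega)^2}\ \tfrac12\|D[y]-y_{\mathrm d}\|_{\mathcal D}^2+J(u,v)\quad\text{subject to}\quad A[y]-B[u]-C[v]=0,\ (u,v)\in\mathbb C. \qquad (\ast) \] Moreover, whenever a subsequence of $\{(u_k,v_k)\}_{k\in\mathbb N}$ converges weakly in $H^1(\Omega)^2$ to some $(\bar u,\bar v)$, then $(\bar u,\bar v)\in\mathbb C$ and $(\bar y,\bar u,\bar v)$, with $\bar y$ the state associated with $(\bar u,\bar v)$, is a global minimizer of $(\ast)$.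
   Context: All spaces are real. $\Omega\subset\mathbb R^d$ is a nonempty bounded domain satisfying the cone condition. $H^1(\Omega)$ carries the norm $\|y\|_{H^1(\Omega)}=(\|y\|_{L^2(\Omega)}^2+\sum_{i=1}^d\|\partial_{x_i}y\|_{L^2(\Omega)}^2)^{1/2}$. $\mathcal D$ and $\mathcal Y$ are Hilbert spaces, $y_{\mathrm d}\in\mathcal D$ is fixed. $A:\mathcal Y\to\mathcal Y^\star$ is a bounded linear isomorphism (bounded inverse); $B,C:H^1(\Omega)\to\mathcal Y^\star$ and $D:\mathcal Y\to\mathcal D$ are bounded linear operators. The control-to-observation operator $S:H^1(\Omega)^2\to\mathcal D$ is the bounded linear operator $S[u,v]:=D[y]$, where $y\in\mathcal Y$ is the unique solution of the state equation $A[y]-B[u]-C[v]=0$. For constants $\alpha_1,\alpha_2\ge 0$ and $\varepsilon>0$, \[ J(u,v):=\tfrac{\alpha_1}{2}\|u\|_{L^2(\Omega)}^2+\tfrac{\alpha_2}{2}\|v\|_{L^2(\Omega)}^2+\tfrac{\varepsilon}{2}\big(\|u\|_{H^1(\Omega)}^2+\|v\|_{H^1(\Omega)}^2\big),\qquad u,v\in H^1(\Omega). \] The complementarity set is $\mathbb C:=\{(w,z)\in H^1(\Omega)^2 : w\ge 0,\ z\ge 0,\ wz=0\text{ a.e. on }\Omega\}$. The Fischer--Burmeister function is $\phi(a,b):=\sqrt{a^2+b^2}-a-b$ for $a,b\in\mathbb R$, and the penalty functional is $F(u,v):=\tfrac12\int_\Omega\phi(u(x),v(x))^2\,\mathrm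 dx$ for $u,v\in H^1(\Omega)$. *)

(* Defs.v *)
Set Warnings "-notation-overridden,-ambiguous-paths,-notation-incompatible-prefix,-redundant-canonical-projection".
From HB Require Import structures.
From mathcomp Require Import all_boot all_order all_algebra.
From mathcomp Require Import ring_quotient.
From mathcomp Require Import all_classical all_reals all_analysis.
From mathcomp Require Import measurable_realfun.

Set Implicit Arguments.
Unset Strict Implicit.
Unset Printing Implicit Defensive.

Import Order.TTheory GRing.Theory Num.Theory.
Import numFieldNormedType.Exports.

Local Open Scope classical_set_scope.
Local Open Scope ring_scope.

(* 'rV[R]_n carries the product (= Borel) sigma-algebra, generated by the
   coordinate maps *)
Definition rv_display : measure_display.
Proof. exact: default_measure_display. Qed.

Section measurable_rv.
Context {R : realType} (n : nat).

Let coord : 'I_n -> 'rV[R]_n -> R := fun i v => v ord0 i.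

Let rv_set0 : g_sigma_preimage coord set0.
Proof. exact: sigma_algebra0. Qed.

Let rv_setC A : g_sigma_preimage coord A -> g_sigma_preimage coord (~` A).
Proof. exact: sigma_algebraC. Qed.

Let rv_bigcup (F : (set 'rV[R]_n)^nat) :
  (forall i, g_sigma_preimage coord (F i)) ->
  g_sigma_preimage coord (\bigcup_i (F i)).
Proof. exact: sigma_algebra_bigcup. Qed.

HB.instance Definition _ := @isMeasurable.Build rv_display
  'rV[R]_n (g_sigma_preimage coord) rv_set0 rv_setC rv_bigcup.

Lemma measurable_coord (i : 'I_n) :
  measurable_fun [set: 'rV[R]_n] (fun v : 'rV[R]_n => v ord0 i).
Proof.
move=> _ Y mY; rewrite setTI; apply: sub_sigma_algebra => /=.
rewrite -bigcup_seq/=; exists i => /=; first by rewrite mem_index_enum.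
by exists Y => //; rewrite setTI.
Qed.

Lemma measurable_fun_rV d (T : measurableType d) (f : T -> 'rV[R]_n) :
  (forall i, measurable_fun [set: T] (fun x => f x ord0 i)) ->
  measurable_fun [set: T] f.
Proof.
move=> mf _ Y mY; rewrite setTI.
have : (preimage_set_system setT f (@measurable _ 'rV[R]_n)) (f @^-1` Y).
  by exists Y => //; rewrite setTI.
apply: (_ : _ `<=` _).
rewrite {1}/measurable/= /g_sigma_preimage -g_sigma_preimageE.
apply: smallest_sub; first exact: sigma_algebra_measurable.
move=> _ [C + <-]; rewrite -bigcup_seq/= => -[i _ [A mA <-]].
by rewrite !setTI; have := mf i measurableT _ mA; rewrite setTI.
Qed.

End measurable_rv.

Lemma measurable_open_rV (R : realType) n (U : set 'rV[R]_n) :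
  open U -> measurable U.
Proof.
move=> oU.
pose box (q : 'rV[rat]_n * nat) : set 'rV[R]_n :=
  [set v | forall i, `|v ord0 i - ratr (q.1 ord0 i)| < q.2.+1%:R^-1].
have mbox q : measurable (box q).
  pose strip (i : 'I_n) : set 'rV[R]_n :=
    (fun v => v ord0 i) @^-1` (ball (ratr (q.1 ord0 i) : R) q.2.+1%:R^-1).
  have -> : box q = \bigcap_(i in [set: 'I_n]) strip i.
    apply/seteqP; split => v /= h i; have := h i.
      by move=> + _; rewrite /strip/= /ball/= distrC.
    by move=> /(_ I); rewrite /strip/= /ball/= distrC.
  apply: fin_bigcap_measurable => // i _.
  rewrite -[X in measurable X]setTI; apply: measurable_coord => //.
  exact: measurable_ball.
have -> : U = \bigcup_(q in [set q | box q `<=` U]) box q.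
  apply/seteqP; split; last by move=> v [q] /= /[apply].
  move=> v Uv; have /nbhs_ballP[e /= e0 eU] := open_nbhs_nbhs (conj oU Uv).
  pose k := Num.truncn (2 / e).
  have ke : k.+1%:R^-1 + k.+1%:R^-1 < e.
    have : 2 / e < k.+1%:R by exact: truncnS_gt.
    rewrite ltr_pdivrMr// => h.
    by rewrite -mulr2n -[ltLHS]mulr_natl ltr_pdivrMr ?ltr0n// mulrC.
  have hq i : exists q : rat, `|v ord0 i - ratr q| < k.+1%:R^-1.
    have := @dense_rat R (ball (v ord0 i) k.+1%:R^-1).
    case.
    - by exists (v ord0 i); exact: ballxx.
    - exact: ball_open.
    - by move=> x [bx [q _ qx]]; exists q; rewrite qx; exact: bx.
  have [g gP] := choice hq.
  exists (\row_i g i, k) => /=; last by move=> i; rewrite mxE.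
  move=> w bw; apply: eU; split => // i j.
  rewrite (ord1 i) /ball/=; apply: le_lt_trans ke.
  rewrite -(subrKA (ratr (g j))) (le_trans (ler_normD _ _))// lerD//.
    by rewrite ltW.
  by have := bw j; rewrite !mxE distrC => /ltW.
pose G k := if unpickle k is Some q
  then [set v | box q v /\ box q `<=` U] else set0.
have -> : \bigcup_(q in [set q | box q `<=` U]) box q = \bigcup_k G k.
  apply/seteqP; split => [v [q /= qU qv]|v [k _]]; rewrite /G.
    by exists (pickle q) => //; rewrite pickleK.
  by case: (unpickle k) => // q /= [qv qU]; exists q.
apply: bigcupT_measurable => k; rewrite /G; case: (unpickle k) => // q.
have [qU|qU] := pselect (box q `<=` U).
  by rewrite (_ : [set v | _] = box q)//; apply/seteqP; split => v //= -[].
by rewrite (_ : [set v | _] = set0)//; apply/seteqP; split => v //= -[].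
Qed.

Section prepend.
Context {R : realType} (n : nat).

Definition rv_cons (p : measurableTypeR R * 'rV[R]_n) : 'rV[R]_n.+1 :=
  \row_i oapp (p.2 ord0) p.1 (unlift ord0 i).

Lemma measurable_rv_cons : measurable_fun setT rv_cons.
Proof.
apply: measurable_fun_rV => i.
under eq_fun do rewrite mxE.
case: (unliftP ord0 i) => [j _|_] /=; last exact: measurable_fst.
apply: (@measurableT_comp _ _ _ _ _ _ (fun v : 'rV[R]_n => v ord0 j)) => //.
exact: measurable_coord.
Qed.

Definition rv_push (m : {sigma_finite_measure set 'rV[R]_n -> \bar R}) :
    set 'rV[R]_n.+1 -> \bar R :=
  pushforward (@lebesgue_measure R \x m)%E rv_cons.

Context (m : {sigma_finite_measure set 'rV[R]_n -> \bar R}).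

Let rv_push0 : rv_push m set0 = 0%E.
Proof. by rewrite /rv_push /pushforward preimage_set0 measure0. Qed.

Let rv_push_ge0 A : (0 <= rv_push m A)%E.
Proof. by rewrite /rv_push /pushforward; exact: measure_ge0. Qed.

Let rv_push_sigma_additive : semi_sigma_additive (rv_push m).
Proof.
move=> F mF tF mUF; rewrite /rv_push /pushforward preimage_bigcup.
apply: measure_semi_sigma_additive.
- by move=> k; rewrite -[X in measurable X]setTI; exact: measurable_rv_cons.
- apply/trivIsetP => /= i j _ _ ij; rewrite -preimage_setI.
  by move/trivIsetP : tF => /(_ _ _ _ _ ij) ->//; rewrite preimage_set0.
- rewrite -preimage_bigcup -[X in measurable X]setTI.
  exact: measurable_rv_cons.
Qed.

HB.instance Definition _ := isMeasure.Build _ _ _ (rv_push m)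
  rv_push0 rv_push_ge0 rv_push_sigma_additive.

Let rv_push_sigma_finite : sigma_finite setT (rv_push m).
Proof.
have /sigma_finiteP[F [TF ndF Foo]] := sigma_finiteT (@lebesgue_measure R).
have /sigma_finiteP[G [TG ndG Goo]] := sigma_finiteT m.
pose split (v : 'rV[R]_n.+1) : measurableTypeR R * 'rV[R]_n :=
  (v ord0 ord0, \row_j v ord0 (lift ord0 j)).
have splitK p : split (rv_cons p) = p.
  case: p => x w; rewrite /split; congr pair; first by rewrite mxE unlift_none.
  by apply/rowP => j; rewrite !mxE liftK.
have msplit : measurable_fun setT split.
  apply/measurable_fun_pairP; split; first exact: measurable_coord.
  apply: measurable_fun_rV => i.
  by under eq_fun do rewrite mxE; exact: measurable_coord.
exists (fun k => split @^-1` (F k `*` G k)).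
  apply/seteqP; split => v _ //.
  have [k _ Fk] : (\bigcup_k F k) (split v).1 by rewrite -TF.
  have [l _ Gl] : (\bigcup_k G k) (split v).2 by rewrite -TG.
  exists (maxn k l) => //; split.
  - by move: Fk; exact/subsetPset/ndF/leq_maxl.
  - by move: Gl; exact/subsetPset/ndG/leq_maxr.
move=> k; have [mFk Fk] := Foo k; have [mGk Gk] := Goo k; split.
  rewrite -[X in measurable X]setTI; apply: msplit => //.
  exact: measurableX.
rewrite /rv_push /pushforward -comp_preimage.
rewrite (_ : split \o rv_cons = id) ?funeqE// preimage_id.
by rewrite product_measure1E// lte_mul_pinfty// ge0_fin_numE.
Qed.

HB.instance Definition _ := Measure_isSigmaFinite.Build _ _ _ (rv_push m)
  rv_push_sigma_finite.

End prepend.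

(* Lebesgue measure: lambda^0 is the point mass and lambda^(k+1) is the image
   of lambda \x lambda^k under (t, v) |-> (t, v_1, ..., v_k) *)
Fixpoint lebesgue_rv (R : realType) (n : nat) :
    {sigma_finite_measure set 'rV[R]_n -> \bar R} :=
  match n with
  | 0 => [the {sigma_finite_measure set 'rV[R]_0 -> \bar R} of dirac (0 : 'rV[R]_0)]
  | k.+1 => [the {sigma_finite_measure set 'rV[R]_k.+1 -> \bar R} of
               rv_push (lebesgue_rv R k)]
  end.

Lemma lebesgue_rv_cube (R : realType) n (M : R) :
  let cube := [set v : 'rV[R]_n | forall i, `|v ord0 i| <= M] in
  measurable cube /\ (lebesgue_rv R n cube < +oo)%E.
Proof.
move=> cube; rewrite {}/cube.
have mcube k : measurable [set v : 'rV[R]_k | forall i, `|v ord0 i| <= M].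
  have -> : [set v : 'rV[R]_k | forall i, `|v ord0 i| <= M] =
      \bigcap_(i in [set: 'I_k]) ((fun v : 'rV[R]_k => v ord0 i) @^-1` `[-M, M]).
    by apply/seteqP; split => v /= h i; have := h i; rewrite /= in_itv/= ler_norml//; exact.
  apply: fin_bigcap_measurable => // i _.
  by rewrite -[X in measurable X]setTI; apply: measurable_coord.
split=> //.
elim: n => [|n ih]; first by rewrite /= diracE ltry.
pose I : set (measurableTypeR R) := `[-M, M]%classic.
pose Q : set 'rV[R]_n := [set v | forall i, `|v ord0 i| <= M].
rewrite /= /rv_push /pushforward.
apply: (@le_lt_trans _ _ ((@lebesgue_measure R \x lebesgue_rv R n) (I `*` Q))%E).
  apply: le_measure; rewrite ?inE.
  - rewrite -[X in measurable X]setTI.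
    exact: (measurable_rv_cons measurableT (mcube n.+1)).
  - by apply: measurableX; [exact: measurable_itv|exact: mcube].
  - move=> [x v] /= h; split => /=.
      by have := h ord0; rewrite mxE unlift_none /I/= in_itv/= ler_norml.
    by move=> i; have := h (lift ord0 i); rewrite mxE liftK.
rewrite product_measure1E; [|exact: measurable_itv|exact: mcube].
apply: lte_mul_pinfty => //.
  rewrite ge0_fin_numE//.
  have := @lebesgue_measure_itv R `[-M, M]; rewrite -/I /= => ->.
  by case: ifP => _; rewrite ?ltry// -EFinB ltry.
Qed.

Lemma measurable_continuous_rV (R : realType) n (f : 'rV[R]_n -> R) :
  continuous f -> measurable_fun setT f.
Proof.
move=> cf; apply: (measurability _ (RGenOpens.measurableE R)).
move=> _ [_ [a [b ->] <-]]; rewrite setTI; apply: measurable_open_rV.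
by move/continuousP : cf; apply; exact: interval_open.
Qed.

(* L^2(mu) as a vector space: the square-integrable functions modulo those that
   vanish almost everywhere (LspaceType has no module structure) *)
Section L2space.
Context d (T : measurableType d) (R : realType).
Variable mu : {measure set T -> \bar R}.

Let one_le_two : (1 <= 2%:E :> \bar R)%E.
Proof. by rewrite lee1n. Qed.

Definition L2fun := LfunType mu one_le_two.
HB.instance Definition _ := GRing.Lmodule.on L2fun.

Definition L2null : {pred L2fun} :=
  [pred f : L2fun | `[< {ae mu, forall x, f x = 0} >]].

Let L2null_submod_closed : submod_closed L2null.
Proof.
split; first by apply/asboolP; exact: aeW.
move=> a f g /asboolP f0 /asboolP g0; apply/asboolP.
apply: filterS2 f0 g0 => x fx gx.
by rewrite (_ : _ x = a * f x + g x)// fx gx mulr0 addr0.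
Qed.

HB.instance Definition _ := GRing.isSubmodClosed.Build _ _ L2null
  L2null_submod_closed.

Definition L2space : Type := Quotient.quot (L2null : zmodClosed L2fun).
HB.instance Definition _ := Choice.on L2space.
HB.instance Definition _ := EqQuotient.on L2space.
HB.instance Definition _ := GRing.Zmodule.on L2space.

Definition L2repr (u : L2space) : T -> R := repr u : L2fun.
Coercion L2repr : L2space >-> Funclass.

Local Open Scope quotient_scope.

Definition L2class (f : L2fun) : L2space := \pi f.

Lemma L2_eqP (f g : L2fun) :
  L2class f = L2class g <-> {ae mu, forall x, f x = g x}.
Proof.
split=> [/eqP|fg].
  rewrite -Quotient.idealrBE => /asboolP; apply: filterS => x.
  by rewrite (_ : _ x = f x - g x)// => /eqP; rewrite subr_eq0 => /eqP.
apply/eqP; rewrite -Quotient.idealrBE; apply/asboolP.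
by apply: filterS fg => x fg; rewrite (_ : _ x = f x - g x)// fg subrr.
Qed.

Let rep (u : L2space) : L2fun := repr u.

Let repK u : L2class (rep u) = u.
Proof. exact: reprK. Qed.

Let classD f g : L2class (f + g) = L2class f + L2class g.
Proof. exact: (raddfD (\pi_(Quotient.quot (L2null : zmodClosed L2fun)))). Qed.

Let scale (a : R) (u : L2space) : L2space := L2class (a *: rep u).

Let scale_class a (f : L2fun) : scale a (L2class f) = L2class (a *: f).
Proof.
apply/L2_eqP; have /L2_eqP := repK (L2class f).
by apply: filterS => x fx; rewrite [RHS](_ : _ x = a * f x)// -fx.
Qed.

Let scaleA a b u : scale a (scale b u) = scale (a * b) u.
Proof. by rewrite -[u]repK !scale_class scalerA. Qed.

Let scale1 : left_id 1 scale.
Proof. by move=> u; rewrite -[u]repK scale_class scale1r. Qed.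

Let scaleDr : right_distributive scale +%R.
Proof.
move=> a u v; rewrite -[u]repK -[v]repK.
by rewrite -classD !scale_class -classD scalerDr.
Qed.

Let scaleDl u : {morph scale^~ u : a b / a + b}.
Proof. by move=> a b; rewrite -[u]repK !scale_class -classD scalerDl. Qed.

HB.instance Definition _ := GRing.Zmodule_isLmodule.Build R L2space
  scaleA scale1 scaleDr scaleDl.

Lemma L2_linearE a (u v : L2space) :
  {ae mu, forall x, (a *: u + v : L2space) x = a * u x + v x}.
Proof.
have /L2_eqP : L2class (rep (a *: u + v)) = L2class (a *: rep u + rep v).
  by rewrite classD -scale_class !repK.
by apply: filterS => x h; exact: h.
Qed.

Lemma L2_zeroE : {ae mu, forall x, (0 : L2space) x = 0}.
Proof.
have /L2_eqP : L2class (rep 0) = L2class 0.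
  by rewrite repK; apply: (addrI (L2class 0)); rewrite -classD !addr0.
by apply: filterS => x h; exact: h.
Qed.

Definition L2norm (u : L2space) : R := fine 'N[mu]_2%:E[EFin \o u].

End L2space.

Section sobolev.
Context {R : realType} {d : nat}.
Local Notation E := 'rV[R]_d.

Definition basis_rv (i : 'I_d) : E := delta_mx ord0 i.

Fixpoint of_class_C (k : nat) (phi : E -> R) : Prop :=
  match k with
  | 0 => continuous phi
  | k'.+1 => [/\ continuous phi,
      forall x i, derivable phi x (basis_rv i) &
      forall i, of_class_C k' ('D_(basis_rv i) phi)]
  end.

Definition test_function (Omega : set E) (phi : E -> R) : Prop :=
  [/\ forall k, of_class_C k phi,
      compact (closure [set x | phi x != 0]) &
      closure [set x | phi x != 0] `<=` Omega].

Context (Omega : set E) (oOmega : open Omega).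

(* Integrals and "almost everywhere" over Omega are taken with respect to
   A |-> lambda (A `&` Omega) on the whole of 'rV[R]_d, so that functions on
   Omega are represented by functions on 'rV[R]_d whose values outside Omega
   are irrelevant *)
Definition lebesgue_on : {measure set E -> \bar R} :=
  [the {measure set E -> \bar R} of
    mrestr (lebesgue_rv R d) (measurable_open_rV oOmega)].

Local Notation L2 := (L2space lebesgue_on).

Definition weak_partial (i : 'I_d) (u g : L2) : Prop :=
  forall phi, test_function Omega phi ->
    \int[lebesgue_on]_x (u x * 'D_(basis_rv i) phi x) =
    - \int[lebesgue_on]_x (g x * phi x).

Definition weakly_differentiable : {pred L2} :=
  [pred u : L2 | `[< forall i, exists g, weak_partial i u g >]].

Lemma test_function_partial i phi : test_function Omega phi ->
  test_function Omega ('D_(basis_rv i) phi).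
Proof.
move=> [sphi cphi phiO].
have sub : closure [set x | 'D_(basis_rv i) phi x != 0] `<=`
           closure [set x | phi x != 0].
  rewrite closureE => x; apply; split; first exact: closed_closure.
  move=> y /= /eqP Dy; apply: contrapT => yphi; apply: Dy.
  have : \forall z \near y, phi z = cst 0 z.
    have : open_nbhs y (~` closure [set x | phi x != 0]).
      by split=> //; exact/closed_openC/closed_closure.
    move/open_nbhs_nbhs; apply: filterS => z zphi.
    apply/eqP/negPn/negP => z0; apply: zphi; exact: subset_closure.
  move=> /near_eq_derive ->; exact: derive_cst.
split.
- by move=> k; have [_ _] := sphi k.+1; exact.
- by apply: subclosed_compact cphi sub; exact: closed_closure.
- exact: subset_trans phiO.
Qed.

Lemma test_function_L2 phi : test_function Omega phi ->
  phi \in Lfun lebesgue_on 2%:E.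
Proof.
move=> [sphi cphi _].
have cont : continuous phi by exact: (sphi 0%N).
have mphi : measurable_fun setT phi by exact: measurable_continuous_rV.
pose K := closure [set x | phi x != 0].
have [M [_ MK]] := compact_bounded cphi.
have [N [_ NK]] : bounded_set (phi @` K).
  apply: compact_bounded; apply: continuous_compact => //.
  exact: continuous_subspaceT.
pose m : R := `|M| + 1; pose n : R := `|N| + 1.
have Mm : M < m by rewrite (le_lt_trans (ler_norm _))// ltrDl.
have Nn : N < n by rewrite (le_lt_trans (ler_norm _))// ltrDl.
have n0 : 0 <= n by rewrite addr_ge0.
pose Q := [set v : E | forall i, `|v ord0 i| <= m].
have [mQ Qoo] := lebesgue_rv_cube d m.
have phi_out x : ~ Q x -> phi x = 0.
  move=> Qx; apply/eqP/negPn/negP => phix; apply: Qx => i.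
  have Kx : K x by exact: subset_closure.
  rewrite (le_trans _ (MK _ Mm _ Kx))//.
  rewrite [leRHS](_ : _ = mx_norm x)// mx_normrE.
  exact: (le_bigmax _ (fun ij : 'I_1 * 'I_d => `|x ij.1 ij.2|) (ord0, i)).
have phi_le x : `|phi x| <= n.
  have [/eqP ->|phix] := boolP (phi x == 0); first by rewrite normr0.
  by apply: (NK _ Nn); exists x => //; exact: subset_closure.
rewrite inE; apply/andP; split; first by rewrite inE.
rewrite inE/= /finite_norm unlock poweR_lty//=.
apply: (@le_lt_trans _ _ (\int[lebesgue_on]_x (n `^ 2 * \1_Q x)%:E)%E).
  apply: ge0_le_integral => //=.
  - apply/measurable_EFinP/(@measurableT_comp _ _ _ _ _ _ (fun y : R => y `^ 2)) => //.
    exact/measurableT_comp.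
  - apply/measurable_EFinP/measurable_funM => //.
  - move=> x _; rewrite lee_fin indicE; case: (boolP (x \in Q)) => [_|].
      by rewrite mulr1 ge0_ler_powR.
    by rewrite notin_setE => /phi_out ->; rewrite normr0 powR0// mulr0.
under eq_integral do rewrite EFinM.
rewrite ge0_integralZl_EFin ?powR_ge0//; last first.
  by apply/measurable_EFinP.
rewrite integral_indic// setIT lte_mul_pinfty ?lee_fin ?powR_ge0//.
apply: le_lt_trans Qoo; rewrite /= /mrestr le_measure ?inE//.
by apply: measurableI => //; exact: measurable_open_rV.
Qed.

Let integrable_L2_test (u : L2) phi : test_function Omega phi ->
  lebesgue_on.-integrable setT (EFin \o (fun x => u x * phi x)).
Proof.
move=> /test_function_L2 phi2.
by apply/Lfun1_integrable/(@Lfun2_mul_Lfun1 _ _ _ _ u phi) => //; exact: LfunP.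
Qed.

Let Rintegral_linear a (u v : L2) phi : test_function Omega phi ->
  \int[lebesgue_on]_x ((a *: u + v : L2) x * phi x) =
  a * (\int[lebesgue_on]_x (u x * phi x)) + \int[lebesgue_on]_x (v x * phi x).
Proof.
move=> tphi.
rewrite -RintegralZl//; last exact: integrable_L2_test.
rewrite -RintegralD//; last 2 first.
- rewrite (_ : _ \o _ = (fun x => a%:E * (u x * phi x)%:E)%E).
    by apply: integrableZl => //; exact: integrable_L2_test.
  by apply/funext => x /=; rewrite EFinM.
- exact: integrable_L2_test.
congr fine; apply: ae_eq_integral => //.
- by have /integrableP[] := integrable_L2_test (a *: u + v) tphi.
- apply/measurable_EFinP/measurable_funD; last first.
    by have /integrableP[/measurable_EFinP] := integrable_L2_test v tphi.
  apply: measurable_funM => //.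
  by have /integrableP[/measurable_EFinP] := integrable_L2_test u tphi.
- by apply: filterS (L2_linearE a u v) => x -> _; rewrite mulrDl mulrA.
Qed.

Let Rintegral_zero phi : test_function Omega phi ->
  \int[lebesgue_on]_x ((0 : L2) x * phi x) = 0.
Proof.
move=> /(Rintegral_linear (-1) 0 0).
by rewrite scaler0 addr0 mulN1r addNr.
Qed.

Let weakly_differentiable_submod : submod_closed weakly_differentiable.
Proof.
split=> [|a u v /asboolP du /asboolP dv]; apply/asboolP => i.
  exists 0 => phi tphi; rewrite !Rintegral_zero ?oppr0//.
  exact: test_function_partial.
have [[g ug] [h vh]] := (du i, dv i).
exists (a *: g + h) => phi tphi.
rewrite !Rintegral_linear//; last exact: test_function_partial.
by rewrite ug// vh// opprD mulrN.
Qed.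

HB.instance Definition _ := GRing.isSubmodClosed.Build _ _
  weakly_differentiable weakly_differentiable_submod.

(* H^1(Omega): the classes in L^2(Omega) all of whose weak first partial
   derivatives exist in L^2(Omega) *)
Record H1 := MkH1 { H1val :> L2; H1valP : H1val \in weakly_differentiable }.

HB.instance Definition _ := [isSub for H1val].
HB.instance Definition _ := [Choice of H1 by <:].
HB.instance Definition _ := [SubChoice_isSubLmodule of H1 by <:].

(* weak partial derivatives are unique as elements of L^2(Omega), so the choice
   made by xget is immaterial; by H1valP the default 0 is never used *)
Definition weak_deriv (i : 'I_d) (u : H1) : L2 :=
  xget 0 [set g | weak_partial i u g].

Definition H1norm (u : H1) : R :=
  Num.sqrt (L2norm u ^+ 2 + \sum_(i < d) L2norm (weak_deriv i u) ^+ 2).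

End sobolev.

Section domain.
Context {R : realType} {d : nat}.
Local Notation E := 'rV[R]_d.

Definition dotr (x y : E) : R := \sum_(i < d) x ord0 i * y ord0 i.

(* Euclidean norm; the library norm on 'rV[R]_d is the sup norm *)
Definition enorm (x : E) : R := Num.sqrt (dotr x x).

(* finite cone with vertex 0, axis direction v, height rho and aperture angle
   kappa: |y| <= rho and the angle between y and v is at most kappa / 2 *)
Definition finite_cone (v : E) (rho kappa : R) : set E :=
  [set y | enorm y <= rho /\ enorm y * enorm v * cos (kappa / 2) <= dotr y v].

(* every point of Omega is the vertex of a cone contained in Omega and
   congruent to a fixed finite cone *)
Definition cone_condition (Omega : set E) : Prop :=
  exists rho kappa : R, [/\ 0 < rho, 0 < kappa <= pi &
    forall x, Omega x -> exists2 v, v != 0 &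
      forall y, finite_cone v rho kappa y -> Omega (x + y)].

End domain.

HB.mixin Record CompleteNormedModule_isHilbert (R : realType) V
    of CompleteNormedModule R V := {
  inner : V -> V -> R;
  innerC : forall x y, inner x y = inner y x;
  inner_linearl : forall a x y z,
    inner (a *: x + y) z = a * inner x z + inner y z;
  inner_norm : forall x, inner x x = `|x| ^+ 2
}.

#[short(type="hilbertType")]
HB.structure Definition Hilbert (R : realType) :=
  {V of CompleteNormedModule R V & CompleteNormedModule_isHilbert R V}.

Section topological_dual.
Context {R : realType} (Y : normedModType R).

Definition continuous_functional : {pred Y -> R} :=
  [pred f : Y -> R | `[< linear f /\ continuous f >]].

Let continuous_functional_submod : submod_closed continuous_functional.
Proof.
split; first by apply/asboolP; split; [move=> a x y; rewrite scaler0 addr0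
                                      |exact: cst_continuous].
move=> a f g /asboolP[lf cf] /asboolP[lg cg]; apply/asboolP; split.
  move=> b x y; rewrite (_ : forall z, (a *: f + g) z = a * f z + g z)//.
  rewrite lf lg /= !scalerDr /GRing.scale/= !mulrA (mulrC b a).
  by rewrite mulrDr mulrA addrACA.
move=> x; apply: (@continuousD _ _ _ (a \*: f) g); last exact: cg.
apply: continuousM; [exact: cst_continuous|exact: cf].
Qed.

HB.instance Definition _ := GRing.isSubmodClosed.Build _ _
  continuous_functional continuous_functional_submod.

Record topdual := MkTopdual {
  topdual_fun :> Y -> R;
  topdualP : topdual_fun \in continuous_functional }.

HB.instance Definition _ := [isSub for topdual_fun].
HB.instance Definition _ := [Choice of topdual by <:].
HB.instance Definition _ := [SubChoice_isSubLmodule of topdual by <:].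

Definition topdual_norm (f : topdual) : R :=
  sup [set `|f y| | y in [set y : Y | `|y| <= 1]].

End topological_dual.

(* H1 and topdual come with a norm function rather than a normedModType
   structure, so the norms are explicit arguments here *)
Section normed_notions.
Context {R : realType}.

Definition bounded_op (X Z : Type) (nX : X -> R) (nZ : Z -> R) (T : X -> Z) :=
  exists M : R, forall x, nZ (T x) <= M * nX x.

Definition bounded_isomorphism (X Z : Type) (nX : X -> R) (nZ : Z -> R)
    (T : X -> Z) :=
  bounded_op nX nZ T /\
  exists Tinv : Z -> X, [/\ cancel T Tinv, cancel Tinv T &
                            bounded_op nZ nX Tinv].

Definition strong_cvg (X : lmodType R) (nX : X -> R) (x : nat -> X) (l : X) :=
  nX (x k - l) @[k --> \oo] --> (0 : R).

Definition weak_cvg (X : lmodType R) (nX : X -> R) (x : nat -> X) (l : X) :=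
  forall f : {scalar X}, bounded_op nX (fun r : R => `|r|) f ->
    f (x k) @[k --> \oo] --> (f l : R).

Definition global_minimizer (X : Type) (feasible : set X) (f : X -> R)
    (x : X) :=
  feasible x /\ forall x', feasible x' -> f x <= f x'.

End normed_notions.

Section problem.
Context {R : realType} {d : nat} {Omega : set 'rV[R]_d}.
Variable oOmega : open Omega.
Local Notation H := (H1 oOmega).

Definition H1pair_norm (w : H * H) : R :=
  Num.sqrt (H1norm w.1 ^+ 2 + H1norm w.2 ^+ 2).

Definition control_cost (alpha1 alpha2 eps : R) (w : H * H) : R :=
  alpha1 / 2 * L2norm w.1 ^+ 2 + alpha2 / 2 * L2norm w.2 ^+ 2 +
  eps / 2 * (H1norm w.1 ^+ 2 + H1norm w.2 ^+ 2).

Definition complementarity_set : set (H * H) :=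
  [set w : H * H | {ae lebesgue_on oOmega, forall x,
     [/\ 0 <= w.1 x, 0 <= w.2 x & w.1 x * w.2 x = 0]}].

Definition fischer_burmeister (a b : R) : R :=
  Num.sqrt (a ^+ 2 + b ^+ 2) - a - b.

Definition penalty (w : H * H) : R :=
  2^-1 * \int[lebesgue_on oOmega]_x fischer_burmeister (w.1 x) (w.2 x) ^+ 2.

Context {Y D : hilbertType R}.
Variables (A : Y -> topdual Y) (B C : H -> topdual Y) (Dop : Y -> D) (yd : D).

Definition state_equation (y : Y) (w : H * H) : Prop :=
  A y - B w.1 - C w.2 = 0.

(* the unique solution of the state equation when A is bijective *)
Definition state (w : H * H) : Y := xget 0 [set y | state_equation y w].

Definition control_to_observation (w : H * H) : D := Dop (state w).

Definition penalized_objective (alpha1 alpha2 eps sigma : R) (w : H * H) : R :=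
  2^-1 * `|control_to_observation w - yd| ^+ 2 +
  control_cost alpha1 alpha2 eps w + sigma * penalty w.

Definition mpcc_objective (alpha1 alpha2 eps : R) (p : Y * (H * H)) : R :=
  2^-1 * `|Dop p.1 - yd| ^+ 2 + control_cost alpha1 alpha2 eps p.2.

Definition mpcc_feasible : set (Y * (H * H)) :=
  [set p | state_equation p.1 p.2 /\ complementarity_set p.2].

End problem.

(* Main.v *)
(** Compactness is only used locally, on small boxes, because complementarity is
an almost everywhere condition.

Poincare inequality on small boxes.  Testing the weak derivative against smooth
tensor products gives, for a box B well inside Omega, bisected into B' and B''
along direction i, |int_B' z - int_B'' z| <= side_i(B) int_B |D_i z|.
Iterating over successive bisections, the quantity sum |int z| over the pieces
exceeds |int_B z| by at most 2 sum_i side_i(B) int_B |D_i z|, and it tends to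
int_B |z| because bisected boxes generate the Borel sets.  Thus a sequence that
is bounded in H^1 and whose integrals over all such boxes tend to 0 is null in
L^1(B); as the Fischer-Burmeister function is Lipschitz, a limit of points with
vanishing penalty satisfies the complementarity conditions.

Limits.  Along a filter U on the indices for which all box integrals converge
(an ultrafilter for the first claim, the image of the subsequence for the
second), almost minimizing the strongly convex cost over the midpoint hulls of
{w_k : k in S}, S in U, yields a Cauchy sequence; its limit x has the right box
integrals and cost at most m = sup_S inf_hull(S).  The box integrals show that
x satisfies the complementarity conditions, so minimality gives
cost(w_k) <= cost(x) <= m, and strong convexity forces w_k -> x strongly
along U. *)

Require Import Defs.
From HB Require Import structures.
From mathcomp Require Import all_boot all_order all_algebra.
From mathcomp Require Import all_classical all_reals all_analysis.
From mathcomp Require Import measurable_realfun.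
From mathcomp Require Import ring lra.

Set Implicit Arguments.
Unset Strict Implicit.
Unset Printing Implicit Defensive.

Import Order.TTheory GRing.Theory Num.Theory.
Import numFieldNormedType.Exports.

Local Open Scope classical_set_scope.
Local Open Scope ring_scope.

(** * Positive semidefinite forms *)

(** The obstacle is the penalty: it is not convex, because its zero set is not, so weak convergence
    alone does not pass through it. Strong [L^1] convergence on small boxes does, and nothing
    stronger is needed there. Box integrals are the right test functionals: they are bounded on
    [H^1], they determine a function up to null sets, and they are exactly what the bisection
    estimate consumes. An ultrafilter makes all of them converge at once, without diagonal
    extraction. The factor 2 in the bisection estimate is the geometric sum 1 + 1/2 + 1/4 + ...:
    each cut along a direction halves the side that governs the cost of the next cut along it.
    Midpoint hulls suffice because strong convexity enters only through the midpoint inequality, and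
    a condition [|L - l| <= e] on a linear [L] survives midpoints. Minimality is used only by
    comparison with points of the complementarity set, where the penalty vanishes. The comparison
    with 0 bounds both the [H^1] norms of the minimizers and [sigma k] times their penalty, so the
    penalty tends to 0. *)

Section forms.
Context {R : realType}.

(** Estimates are carried out on squared norms, that is on forms. Without definiteness the class is
    stable under pullback by any linear map, which is how the forms of [H^1] and of the cost arise
    from that of [L^2]. *)
Definition psd_form (X : lmodType R) (b : X -> X -> R) : Prop :=
  [/\ forall x y, b x y = b y x,
      forall a x y z, b (a *: x + y) z = a * b x z + b y z &
      forall x, 0 <= b x x].

Section form_theory.
Context (X : lmodType R) (b : X -> X -> R) (bP : psd_form b).

Let bC : forall x y, b x y = b y x. Proof. by case: bP. Qed.
Let blin : forall a x y z, b (a *: x + y) z = a * b x z + b y z.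
Proof. by case: bP. Qed.
Let b_ge0 : forall x, 0 <= b x x. Proof. by case: bP. Qed.

Lemma form0l x : b 0 x = 0.
Proof.
have := blin 1 0 0 x; rewrite scaler0 addr0 mul1r => h.
by apply: (addrI (b 0 x)); rewrite -h addr0.
Qed.

Lemma formDl x y z : b (x + y) z = b x z + b y z.
Proof. by have := blin 1 x y z; rewrite scale1r mul1r. Qed.

Lemma formZl a x z : b (a *: x) z = a * b x z.
Proof. by have := blin a x 0 z; rewrite !addr0 form0l addr0. Qed.

Lemma formBl x y z : b (x - y) z = b x z - b y z.
Proof. by rewrite formDl -scaleN1r formZl mulN1r. Qed.

Lemma formDr x y z : b z (x + y) = b z x + b z y.
Proof. by rewrite bC formDl !(bC _ z). Qed.

Lemma formZr a x z : b z (a *: x) = a * b z x.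
Proof. by rewrite bC formZl (bC _ z). Qed.

Lemma formBr x y z : b z (x - y) = b z x - b z y.
Proof. by rewrite bC formBl !(bC _ z). Qed.

Lemma form_cauchy_schwarz x y : b x y ^+ 2 <= b x x * b y y.
Proof.
have h t : 0 <= b x x + 2 * t * b x y + t ^+ 2 * b y y.
  have := b_ge0 (x + t *: y).
  by rewrite formDl !formDr !formZr !formZl (bC y x); lra.
have [y0|yn0] := eqVneq (b y y) 0.
  have [->|xy0] := eqVneq (b x y) 0; first by rewrite expr0n/= mulr_ge0.
  (* When [b y y = 0] the expression in [h] is affine in [t]; this [t] makes it equal to -1. *)
  have := h (- (b x x + 1) / (2 * b x y)); rewrite y0 mulr0 addr0.
  have -> : 2 * (- (b x x + 1) / (2 * b x y)) * b x y = - (b x x + 1) by field.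
  lra.
have yp : 0 < b y y by rewrite lt_def yn0 b_ge0.
have := h (- b x y / b y y); rewrite -(ler_pM2r yp) mul0r.
have -> : (b x x + 2 * (- b x y / b y y) * b x y +
   (- b x y / b y y) ^+ 2 * b y y) * b y y = b x x * b y y - b x y ^+ 2.
  by field.
lra.
Qed.

(** Positivity at [e *: x - y], divided by [e], bounds twice the cross term. A small [e] keeps the
    first coefficient close to 1, which lower semicontinuity of the objective requires. *)
Lemma form_triangle2 x y e : 0 < e ->
  b (x + y) (x + y) <= (1 + e) * b x x + (1 + e^-1) * b y y.
Proof.
move=> e0; have := b_ge0 (e *: x - y).
rewrite formBl !formBr !formZl !formZr formDl !formDr (bC y x) => h.
have : 0 <= e^-1 * (e * (e * b x x) - e * b x y - (e * b x y - b y y)).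
  by rewrite mulr_ge0// ?invr_ge0 ?ltW//; move: h; lra.
have -> : e^-1 * (e * (e * b x x) - e * b x y - (e * b x y - b y y)) =
  e * b x x - 2 * b x y + e^-1 * b y y by field; rewrite gt_eqF.
lra.
Qed.

Lemma form_triangle x y : b (x + y) (x + y) <= 2 * b x x + 2 * b y y.
Proof. by have := form_triangle2 x y ltr01; rewrite invr1. Qed.

(** The parallelogram identity; its last term is the source of the strong convexity of the
    objective. *)
Lemma form_midpoint x y : b (2^-1 *: (x + y)) (2^-1 *: (x + y)) =
  2^-1 * b x x + 2^-1 * b y y - 4^-1 * b (x - y) (x - y).
Proof.
rewrite formZl formZr formBl !formBr formDl !formDr (bC y x); lra.
Qed.

Lemma form_subC x y : b (x - y) (x - y) = b (y - x) (y - x).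
Proof. by rewrite !formBl !formBr (bC y x); ring. Qed.

End form_theory.

Lemma psd_form_add (X : lmodType R) (b c : X -> X -> R) :
  psd_form b -> psd_form c -> psd_form (fun x y => b x y + c x y).
Proof.
move=> [bC bl b0] [cC cl c0]; split=> [x y|a x y z|x].
- by rewrite bC cC.
- by rewrite bl cl; ring.
- exact: addr_ge0.
Qed.

Lemma psd_form_scale (X : lmodType R) (b : X -> X -> R) t :
  0 <= t -> psd_form b -> psd_form (fun x y => t * b x y).
Proof.
move=> t0 [bC bl b0]; split=> [x y|a x y z|x].
- by rewrite bC.
- by rewrite bl; ring.
- exact: mulr_ge0.
Qed.

Lemma psd_form_sum (X : lmodType R) (I : finType) (b : I -> X -> X -> R) :
  (forall i, psd_form (b i)) -> psd_form (fun x y => \sum_i b i x y).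
Proof.
move=> bP; split=> [x y|a x y z|x].
- by apply: eq_bigr => i _; case: (bP i).
- rewrite mulr_sumr -big_split/=; apply: eq_bigr => i _.
  by case: (bP i).
- by apply: sumr_ge0 => i _; case: (bP i).
Qed.

Lemma psd_form_comp (X Z : lmodType R) (b : Z -> Z -> R) (f : X -> Z) :
  linear f -> psd_form b -> psd_form (fun x y => b (f x) (f y)).
Proof.
move=> lf [bC bl b0]; split=> [x y|a x y z|x].
- exact: bC.
- by rewrite lf bl.
- exact: b0.
Qed.

End forms.

(** * The space L^2 *)

Section L2_theory.
Context d (T : measurableType d) (R : realType).
Variable mu : {measure set T -> \bar R}.
Local Notation L2 := (L2space mu).

Definition L2dot (u v : L2) : R := \int[mu]_x (u x * v x).

Lemma L2_measurable (u : L2) : measurable_fun setT u.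
Proof. exact: measurable_funPT. Qed.

Lemma integrable_L2_mul (u v : L2) :
  mu.-integrable setT (EFin \o (fun x => u x * v x)).
Proof. by apply/Lfun1_integrable/(@Lfun2_mul_Lfun1 _ _ _ _ u v); exact: LfunP. Qed.

Lemma ae_Rintegral (f g : T -> R) (A : set T) : measurable A ->
  measurable_fun A f -> measurable_fun A g ->
  {ae mu, forall x, f x = g x} -> \int[mu]_(x in A) f x = \int[mu]_(x in A) g x.
Proof.
move=> mA mf mg fg; congr fine; apply: ae_eq_integral => //.
- exact/measurable_EFinP.
- exact/measurable_EFinP.
- by apply: filterS fg => x -> _.
Qed.

Lemma L2_subE (u v : L2) : {ae mu, forall x, (u - v : L2) x = u x - v x}.
Proof.
by have := L2_linearE (-1) v u; rewrite scaleN1r addrC;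
  apply: filterS => x ->; rewrite mulN1r addrC.
Qed.

Lemma L2_ext (u v : L2) : {ae mu, forall x, u x = v x} -> u = v.
Proof.
move=> uv; rewrite -[u]reprK -[v]reprK; exact/L2_eqP.
Qed.

Lemma L2dot_form : psd_form L2dot.
Proof.
split=> [x y|a x y z|x].
- by rewrite /L2dot; under eq_Rintegral do rewrite mulrC.
- rewrite /L2dot -RintegralZl//; last exact: integrable_L2_mul.
  rewrite -RintegralD//; last 2 first.
  + rewrite (_ : _ \o _ = (fun t => a%:E * ((x : L2) t * (z : L2) t)%:E)%E).
      by apply: integrableZl => //; exact: integrable_L2_mul.
    by apply/funext => t /=; rewrite EFinM.
  + exact: integrable_L2_mul.
  have mx := L2_measurable x; have my := L2_measurable y.
  have mz := L2_measurable z.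
  apply: ae_Rintegral => //.
  + by apply: measurable_funM => //; exact: L2_measurable.
  + apply: measurable_funD; last exact: measurable_funM.
    by apply: measurable_funM => //; exact: measurable_funM.
  + by apply: filterS (L2_linearE a x y) => t ->; rewrite mulrDl mulrA.
- by apply: Rintegral_ge0 => t _; rewrite -expr2 sqr_ge0.
Qed.

Lemma L2norm_sqr (u : L2) : L2norm u ^+ 2 = L2dot u u.
Proof.
rewrite /L2norm.
have fN : ('N[mu]_2%:E[EFin \o u] \is a fin_num)%E.
  have /= := LfunP (repr u : L2fun mu).
  rewrite inE => /andP[_]; rewrite inE/= /finite_norm => h.
  by rewrite ge0_fin_numE// Lnorm_ge0.
have e2 := @powR_Lnorm _ _ R mu (EFin \o u) 2 (lt0r_neq0 (ltr0Sn R 1)).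
rewrite -(fineK fN) in e2.
have h : (0 : R) <= fine ('N[mu]_2%:E[EFin \o u])%E by rewrite fine_ge0// Lnorm_ge0.
move: e2; rewrite poweR_EFin.
rewrite powR_mulrn// => e2.
apply: EFin_inj; rewrite e2 /L2dot /Rintegral fineK.
  apply: eq_integral => x _ /=.
  by rewrite powR_mulrn// real_normK// num_real.
by apply: integrable_fin_num => //; exact: integrable_L2_mul.
Qed.

End L2_theory.

Lemma young_le (R : realFieldType) (a t : R) :
  0 <= a -> 0 < t -> a <= t + t^-1 * (a * a).
Proof.
move=> a0 t0; have : 0 <= t^-1 * (a - t) ^+ 2.
  by rewrite mulr_ge0 ?sqr_ge0// invr_ge0 ltW.
have -> : t^-1 * (a - t) ^+ 2 = t^-1 * (a * a) - 2 * a + t.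
  by field; rewrite gt_eqF.
lra.
Qed.

(** * Completeness of L^2 over a finite measure *)

Section L2_complete.
Context d (T : measurableType d) (R : realType).
Variable mu : {measure set T -> \bar R}.
Hypothesis mu_fin : (mu setT < +oo)%E.
Local Notation L2 := (L2space mu).

Lemma integrable_cst_finite (c : R) : mu.-integrable setT (EFin \o cst c).
Proof.
apply/integrableP; split; first exact/measurable_EFinP.
by rewrite /= integral_cst// lte_mul_pinfty.
Qed.

Lemma integrable_of_sqr (f : T -> R) : measurable_fun setT f ->
  mu.-integrable setT (EFin \o (fun x => f x * f x)) ->
  mu.-integrable setT (EFin \o f).
Proof.
move=> mf if2.
have i1 : mu.-integrable setT (EFin \o cst (1 : R)).
  exact: integrable_cst_finite.
apply: (@le_integrable _ _ _ _ _ measurableT _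
  (EFin \o (fun x => f x * f x + 1))) => //=.
- exact/measurable_EFinP.
- move=> x _; rewrite lee_fin; have := sqr_ge0 (`|f x| - 1).
  rewrite sqrrB !expr2 -normrM (ger0_norm (_ : 0 <= f x * f x)); last first.
    by rewrite -expr2 sqr_ge0.
  have h2 : 0 <= f x * f x by rewrite -expr2 sqr_ge0.
  move=> h; rewrite [leRHS]ger0_norm; last by rewrite addr_ge0.
  by have := normr_ge0 (f x); lra.
- rewrite (_ : _ \o _ = (fun x => (f x * f x)%:E + 1%:E)%E) //.
  exact: integrableD.
Qed.

Lemma L2_integrable (u : L2) : mu.-integrable setT (EFin \o u).
Proof.
apply: integrable_of_sqr; first exact: L2_measurable.
exact: integrable_L2_mul.
Qed.

Lemma L2_of_fun (f : T -> R) : measurable_fun setT f ->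
  mu.-integrable setT (EFin \o (fun x => f x * f x)) ->
  exists u : L2, {ae mu, forall x, u x = f x}.
Proof.
move=> mf if2.
have fL : f \in Lfun mu 2%:E.
  rewrite inE; apply/andP; split; first by rewrite inE.
  rewrite inE/= /finite_norm unlock poweR_lty//=.
  have /integrableP[_] := if2; apply: le_lt_trans.
  apply: ge0_le_integral => //=.
  - apply/measurable_EFinP/(@measurableT_comp _ _ _ _ _ _ (fun y : R => y `^ 2)) => //.
    exact/measurableT_comp.
  - apply/measurable_EFinP/measurableT_comp => //.
    exact: measurable_funM.
  - by move=> x _; rewrite lee_fin powR_mulrn// normrM expr2.
pose F : L2fun mu := Sub f fL.
exists (L2class F).
have : L2class (repr (L2class F) : L2fun mu) = L2class F by exact: reprK.
move=> /L2_eqP; apply: filterS => x h; exact: h.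
Qed.

(** Plays the part of the Cauchy-Schwarz bound of the [L^1] norm without a square root; [t] is tuned
    to the accuracy wanted in each use. *)
Lemma L2_young (u : L2) (t : R) : 0 < t ->
  \int[mu]_x `|u x| <= t * fine (mu setT) + t^-1 * L2dot u u.
Proof.
move=> t0.
have iu := L2_integrable u.
have ic : mu.-integrable setT (EFin \o cst (t : R)).
  exact: integrable_cst_finite.
have iq := integrable_L2_mul u u.
have iq' : mu.-integrable setT (EFin \o (fun x => t^-1 * (u x * u x))).
  rewrite (_ : _ \o _ = (fun x => t^-1%:E * (u x * u x)%:E)%E)//.
  exact: integrableZl.
have -> : t * fine (mu setT) + t^-1 * L2dot u u =
    \int[mu]_x (t + t^-1 * (u x * u x)).
  by rewrite RintegralD//= RintegralZl// Rintegral_cst.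
apply: le_Rintegral => //.
- exact: (integrable_norm iu).
- rewrite (_ : _ \o _ = (fun x => t%:E + (t^-1 * (u x * u x))%:E)%E)//.
  exact: integrableD.
- move=> x _; rewrite -[u x * u x]ger0_norm; last by rewrite -expr2 sqr_ge0.
  by rewrite normrM; exact: young_le.
Qed.

(** The integrals of the increments sum to at most [C], so the series of increments is integrable,
    hence finite almost everywhere, and the telescoping series converges absolutely there. *)
Lemma ae_cvg_L1_summable (v : nat -> T -> R) (C : R) :
  (forall k, measurable_fun setT (v k)) -> 0 <= C ->
  (forall k, (\int[mu]_x `|v k.+1 x - v k x|%:E <=
     (C / (2 ^ k.+1)%:R)%:E)%E) ->
  {ae mu, forall x, cvgn (fun k => v k x)}.
Proof.
move=> mv C0 vC.
pose f k x := (`|v k.+1 x - v k x|%:E)%E.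
have mf k : measurable_fun setT (f k).
  by apply/measurable_EFinP/measurableT_comp => //; exact: measurable_funB.
have f0 k x : (0 <= f k x)%E by rewrite lee_fin.
have : mu.-integrable setT (fun x => \sum_(k <oo) f k x)%E.
  apply/integrableP; split.
    by apply: ge0_emeasurable_sum => // k x _ _; exact: f0.
  apply: (@le_lt_trans _ _ C%:E); last exact: ltry.
  rewrite (eq_integral (fun x => \sum_(k <oo) f k x)%E); last first.
    by move=> x _; rewrite gee0_abs// nneseries_ge0.
  rewrite integral_nneseries//.
  apply: le_trans (epsilon_trick0 xpredT C0).
  by apply: lee_nneseries => k *; [exact: integral_ge0|exact: vC].
move/(integrable_ae measurableT); apply: filterS => x /(_ I) fx.
have : cvgn [normed series (telescope (v ^~ x))].
  apply: nondecreasing_is_cvgn.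
    by apply: nondecreasing_series => k _ _; exact: normr_ge0.
  exists (fine (\sum_(k <oo) f k x)%E) => _ [n _ <-].
  rewrite -lee_fin fineK//; apply: le_trans (nneseries_lim_ge n _) => //.
  by rewrite /= /series/= sumEFin.
move/normed_cvg/cvg_ex => [l /= vl]; apply/cvg_ex; exists (v 0%N x + l).
have -> : (fun k => v k x) = (fun k => v 0%N x + series (telescope (v ^~ x)) k).
  by apply/funext => k; exact: (eq_sum_telescope (v ^~ x)).
by apply: cvgD vl; exact: cvg_cst.
Qed.

Lemma L2dot_subE (u v : L2) :
  (\int[mu]_x ((u x - v x) * (u x - v x))%:E)%E = (L2dot (u - v) (u - v))%:E.
Proof.
have mu' := L2_measurable u; have mv := L2_measurable v.
have e : (\int[mu]_x ((u x - v x) * (u x - v x))%:E)%E =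
         (\int[mu]_x ((u - v : L2) x * (u - v : L2) x)%:E)%E.
  apply: ae_eq_integral => //.
  - by apply/measurable_EFinP/measurable_funM; exact: measurable_funB.
  - by apply/measurable_EFinP/measurable_funM; exact: L2_measurable.
  - by apply: filterS (L2_subE u v) => x ->.
rewrite e /L2dot /Rintegral fineK//.
by apply: integrable_fin_num => //; exact: integrable_L2_mul.
Qed.

Definition complete_form (X : lmodType R) (b : X -> X -> R) :=
  forall u : nat -> X,
  (forall e, 0 < e -> exists N, forall m n, (N <= m)%N -> (N <= n)%N ->
     b (u m - u n) (u m - u n) <= e) ->
  exists l, forall e, 0 < e -> exists N, forall n, (N <= n)%N ->
     b (u n - l) (u n - l) <= e.

(** The Riesz-Fischer argument: a fast subsequence converges almost everywhere, and Fatou's lemma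
    turns the Cauchy bounds into bounds on the distance to the pointwise limit. *)
Lemma L2_complete : complete_form (@L2dot _ _ _ mu).
Proof.
move=> u0; pose u : nat -> L2 := u0; rewrite -/u => uC.
(* Squared distances below [c k ^+ 2] make [L2_young] with [t = c k] give an [L^1] increment of at
   most [c k] times [fine (mu setT) + 1], which is summable. *)
pose c k : R := (2 ^ k.+1)%:R^-1.
have c0 k : 0 < c k by rewrite invr_gt0 ltr0n expn_gt0.
have cp k : 0 < c k ^+ 2 by rewrite exprn_gt0.
pose g k := sval (cid (uC _ (cp k))).
have gP k m n : (g k <= m)%N -> (g k <= n)%N ->
    L2dot (u m - u n) (u m - u n) <= c k ^+ 2.
  by move: m n; rewrite /g; case: cid.
(* Adding [k] and all earlier thresholds makes the extraction monotone and above both [k] and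
   [g k]. *)
pose h k := (k + \sum_(j < k.+1) g j)%N.
have hS k : (h k <= h k.+1)%N.
  by rewrite /h leq_add// [X in (_ <= X)%N]big_ord_recr/= leq_addr.
have hg k : (g k <= h k)%N.
  by rewrite /h big_ord_recr/= addnA leq_addl.
have hk k : (k <= h k)%N by exact: leq_addr.
pose v k : L2 := u (h k).
have mv k : measurable_fun setT (v k) by exact: L2_measurable.
have muge0 : 0 <= fine (mu setT) by exact: fine_ge0.
have : {ae mu, forall x, cvgn (fun k => v k x)}.
  apply: (@ae_cvg_L1_summable (fun k => v k) (fine (mu setT) + 1)) => //.
  move=> k.
  have -> : (\int[mu]_x `|v k.+1 x - v k x|%:E)%E =
      (\int[mu]_x `|(v k.+1 - v k : L2) x|%:E)%E.
    apply: ae_eq_integral => //.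
    - by apply/measurable_EFinP/measurableT_comp => //; exact: measurable_funB.
    - by apply/measurable_EFinP/measurableT_comp => //; exact: L2_measurable.
    - by apply: filterS (L2_subE (v k.+1) (v k)) => x ->.
  rewrite -[leLHS]fineK; last first.
    by apply: integrable_fin_num => //; exact: (integrable_norm (L2_integrable _)).
  rewrite lee_fin; apply: le_trans (L2_young _ (c0 k)) _.
  rewrite mulrDl mul1r mulrC lerD2l -[leRHS]mul1r -[X in _ <= X * _](mulVf (lt0r_neq0 (c0 k))).
  rewrite -mulrA -expr2 ler_pM2l ?invr_gt0//.
  by apply: gP => //; exact: leq_trans (hg k) (hS k).
move=> vcvg.
(* An upper limit is measurable everywhere and agrees with the limit where it exists. *)
pose l x := fine (limn_esup (fun k => (v k x)%:E)).
have vl : {ae mu, forall x, v k x @[k --> \oo] --> l x}.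
  apply: filterS vcvg => x /cvg_ex[y vy].
  have vy' : (v k x)%:E @[k --> \oo] --> y%:E.
    by apply: cvg_EFin; first exact: nearW.
  by rewrite /l (cvg_limn_einf_sup vy').2.
have ml : measurable_fun setT l.
  apply: measurableT_comp => //; apply: measurable_fun_limn_esup => k.
  exact/measurable_EFinP.
have fat (w : L2) e : (exists K, forall k, (K <= k)%N ->
      L2dot (w - v k) (w - v k) <= e) ->
    (\int[mu]_x ((w x - l x) * (w x - l x))%:E <= e%:E)%E.
  move=> [K Ke].
  have mw := L2_measurable w.
  pose F k x := (((w x - v k x) * (w x - v k x))%:E)%E.
  have mF k : measurable_fun setT (F k).
    by apply/measurable_EFinP/measurable_funM; exact: measurable_funB.
  have F0 k x : setT x -> (0 <= F k x)%E.
    by move=> _; rewrite lee_fin -expr2 sqr_ge0.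
  have -> : (\int[mu]_x ((w x - l x) * (w x - l x))%:E)%E =
     (\int[mu]_x limn_einf (F ^~ x))%E.
    apply: ae_eq_integral => //.
    - by apply/measurable_EFinP/measurable_funM; exact: measurable_funB.
    - rewrite /limn_einf; apply: measurableT_comp => //.
      by apply: measurable_fun_limn_esup => k; exact: measurableT_comp.
    - apply: filterS vl => x vx _.
      have : F k x @[k --> \oo] --> ((w x - l x) * (w x - l x))%:E.
        apply: cvg_EFin; first exact: nearW.
        by apply: cvgM; apply: cvgB => //; exact: cvg_cst.
      by move/cvg_limn_einf_sup => [].
  apply: le_trans (fatou mu measurableT mF F0) _.
  rewrite limn_einf_lim; apply: lime_le; first exact: is_cvg_einfs.
  apply: nearW => n.
  apply: (@le_trans _ _ (\int[mu]_x F (maxn n K) x)%E).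
    by apply: ereal_inf_lbound; exists (maxn n K) => //=; exact: leq_maxl.
  by rewrite L2dot_subE lee_fin; apply: Ke; exact: leq_maxr.
have fat' e : 0 < e -> exists N, forall n, (N <= n)%N ->
    (\int[mu]_x ((u n x - l x) * (u n x - l x))%:E <= e%:E)%E.
  move=> e0; have [N NP] := uC _ e0; exists N => n Nn.
  apply: fat; exists N => k Nk; apply: NP => //.
  exact: leq_trans (hk k).
have [L Ll] : exists L : L2, {ae mu, forall x, L x = l x}.
  apply: L2_of_fun => //.
  have [N NP] := fat' 1 ltr01.
  have mN := L2_measurable (u N).
  apply: (@le_integrable _ _ _ _ _ measurableT _
     (EFin \o (fun x => 2 * ((u N x - l x) * (u N x - l x)) + 2 * (u N x * u N x)))).
  - by apply/measurable_EFinP/measurable_funM.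
  (* The bound of [l ^+ 2] by the dominating function is positivity of the square of
     [2 * u N x - l x]. *)
  - move=> x _ /=; rewrite lee_fin !ger0_norm.
    + by have := sqr_ge0 (2 * u N x - l x); rewrite expr2; lra.
    + by rewrite -!expr2 addr_ge0// mulr_ge0// sqr_ge0.
    + by rewrite -expr2 sqr_ge0.
  rewrite (_ : _ \o _ = (fun x => 2%:E * ((u N x - l x) * (u N x - l x))%:E +
     2%:E * (u N x * u N x)%:E)%E)//.
  apply: integrableD => //; apply: integrableZl => //; last first.
    exact: integrable_L2_mul.
  apply/integrableP; split.
    by apply/measurable_EFinP/measurable_funM; exact: measurable_funB.
  apply: (@le_lt_trans _ _ 1%:E%E); last exact: ltry.
  apply: le_trans (NP N (leqnn N)); rewrite le_eqVlt; apply/orP; left; apply/eqP.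
  by apply: eq_integral => x _; rewrite /= ger0_norm// -expr2 sqr_ge0.
exists L => e /fat'[N NP]; exists N => n /NP.
rewrite -lee_fin -L2dot_subE; congr (_ <= _)%E.
have mn := L2_measurable (u n); have mL := L2_measurable L.
apply: ae_eq_integral => //.
- by apply/measurable_EFinP/measurable_funM; exact: measurable_funB.
- by apply/measurable_EFinP/measurable_funM; exact: measurable_funB.
- by apply: filterS Ll => x ->.
Qed.

End L2_complete.

(** * Smooth bumps and tents *)

Section smooth.
Context {R : realType}.

Fixpoint smooth (k : nat) (f : R -> R) : Prop :=
  match k with
  | 0 => continuous f
  | k'.+1 => exists2 f' : R -> R, forall x : R, is_derive x (1 : R) f (f' x) & smooth k' f'
  end.

Lemma is_derive_continuous (f f' : R -> R) :
  (forall x : R, is_derive x (1 : R) f (f' x)) -> continuous f.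
Proof.
by move=> df x; apply: differentiable_continuous; apply/derivable1_diffP; case: (df x).
Qed.

Lemma smooth_continuous k f : smooth k f -> continuous f.
Proof. by case: k => // k [f' df _]; exact: is_derive_continuous df. Qed.

Lemma smoothS k f : smooth k.+1 f -> smooth k f.
Proof.
elim: k f => [|k ih] f [f' df sf]; first exact: is_derive_continuous df.
by exists f' => //; exact: ih.
Qed.

Lemma smooth_cst k c : smooth k (fun=> c).
Proof.
elim: k c => [|k ih] c /=; first by move=> x; exact: cst_continuous.
by exists (fun=> 0) => // x; exact: is_derive_cst.
Qed.

Lemma smoothD k f g : smooth k f -> smooth k g -> smooth k (fun x => f x + g x).
Proof.
elim: k f g => [|k ih] f g /=.
  by move=> cf cg x; apply: cvgD; [exact: cf|exact: cg].
move=> [f' df sf] [g' dg sg]; exists (fun x => f' x + g' x); last exact: ih.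
by move=> x; exact: is_deriveD.
Qed.

Lemma smoothM k f g : smooth k f -> smooth k g -> smooth k (fun x => f x * g x).
Proof.
elim: k f g => [|k ih] f g.
  by move=> cf cg x; apply: cvgM; [exact: cf|exact: cg].
move=> fk gk; have [f' df sf] := fk; have [g' dg sg] := gk.
exists (fun x => f x * g' x + g x * f' x); first by move=> x; exact: is_deriveM.
by apply: smoothD; apply: ih => //; exact: smoothS.
Qed.

Lemma smoothZ k c f : smooth k f -> smooth k (fun x => c * f x).
Proof. by move=> sf; apply: smoothM => //; exact: smooth_cst. Qed.

Lemma is_derive_affine (f f' : R -> R) (c e : R) :
  (forall x : R, is_derive x (1 : R) f (f' x)) ->
  forall x, is_derive x (1 : R) (fun y => f (c * y + e)) (c * f' (c * x + e)).
Proof.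
move=> df x.
have h : is_derive x (1 : R) (fun y : R => c * y + e) c.
  have d1 := @is_deriveZ R R R id c x 1 _ (is_derive_id x 1).
  apply: is_derive_eq (is_deriveD d1 (is_derive_cst (e : R) x (1 : R))) _.
  by rewrite addr0 /GRing.scale/= mulr1.
have := @is_derive1_comp _ f (fun y => c * y + e) x _ _ (df _) h.
by rewrite mulrC.
Qed.

Lemma smooth_affine k f c e : smooth k f -> smooth k (fun x => f (c * x + e)).
Proof.
elim: k f => [|k ih] f.
  move=> cf x; apply: continuous_comp; last exact: cf.
  by apply: cvgD; [apply: cvgM; [exact: cvg_cst|exact: cvg_id]|exact: cvg_cst].
move=> [f' df sf]; exists (fun x => c * f' (c * x + e)).
  exact: is_derive_affine.
by apply: smoothZ; exact: ih.
Qed.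

(** The powers of [t^-1] are included because differentiating [exp (- 1 / t)] creates them: the
    family is closed under derivation up to linear combinations, so smoothness follows by induction
    on the order alone. *)
Definition flat (n : nat) (t : R) : R :=
  if 0 < t then t^-1 ^+ n * expR (- t^-1) else 0.

(** One term of the exponential series at [t^-1], that of degree [n.+2], beats the power. A
    quadratic bound is what [is_derive_flat0] needs for a zero derivative at the origin. *)
Lemma flat_le_sqr n t : `|flat n t| <= (n.+2)`!%:R * t ^+ 2.
Proof.
rewrite /flat; case: ifPn => [t0|_]; last first.
  by rewrite normr0 mulr_ge0// ?ler0n// sqr_ge0.
have ti : 0 < t^-1 by rewrite invr_gt0.
rewrite ger0_norm; last by rewrite mulr_ge0 ?expR_ge0// exprn_ge0// ltW.
have h : t^-1 ^+ n.+2 / n.+2`!%:R <= expR t^-1.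
  by apply: le_trans (expR_ge1Dxn n.+1 (ltW ti)); rewrite lerDr.
rewrite expRN ler_pdivrMr ?expR_gt0//.
have -> : t^-1 ^+ n = n.+2`!%:R * t ^+ 2 * (t^-1 ^+ n.+2 / n.+2`!%:R).
  rewrite -addn2 exprD; have := gt_eqF t0.
  by move=> /negbT t1; field; rewrite t1 pnatr_eq0 -lt0n fact_gt0.
by rewrite ler_pM2l// mulr_gt0 ?ltr0n ?fact_gt0// exprn_gt0.
Qed.

Lemma is_derive_flat0 (f : R -> R) (C : R) : (forall t, `|f t| <= C * t ^+ 2) ->
  is_derive (0 : R) (1 : R) f 0.
Proof.
move=> fC.
have f0 : f 0 = 0.
  by apply/eqP; rewrite -normr_le0 (le_trans (fC 0))// expr0n/= mulr0.
have C0 : 0 <= C by have := fC 1; rewrite expr1n mulr1; apply: le_trans.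
have h : h^-1 *: (f (h *: 1 + 0) - f 0) @[h --> 0^'] --> (0 : R).
  apply/cvgrPdist_le => e e0.
  have : \forall h \near (0 : R)^', `|h| < e / (C + 1).
    apply: (@dnbhs0_lt _ R); by rewrite divr_gt0// ltr_pwDr.
  apply: filterS2 (nbhs_dnbhs_neq 0) => h hn0.
  rewrite ltr_pdivlMr ?ltr_pwDr// => he.
  rewrite f0 subr0 addr0 sub0r normrN /GRing.scale/= mulr1 normrM normfV.
  rewrite ler_pdivrMl ?normr_gt0// (le_trans (fC h))//.
  rewrite -real_normK ?num_real// expr2 mulrCA ler_pM2l ?normr_gt0//.
  by move: (normr_ge0 h) he; lra.
apply: DeriveDef.
  by apply/cvg_ex; exists 0; exact: h.
by apply/cvg_lim => //; exact: h.
Qed.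

Lemma is_derive_flat n t :
  is_derive t (1 : R) (flat n) (flat n.+2 t - n%:R * flat n.+1 t).
Proof.
have [t0|t0|->] := ltgtP t 0.
- apply: (@near_eq_is_derive _ _ _ (cst 0)).
    near=> s; rewrite /flat ltNge ltW//=.
    by near: s; exact: lt_nbhsl.
  by rewrite /flat !ltNge !ltW//= mulr0 subr0; exact: is_derive_cst.
- apply: (@near_eq_is_derive _ _ _ (fun s : R => s^-1 ^+ n * expR (- s^-1))).
    near=> s; rewrite /flat ifT//.
    by near: s; exact: lt_nbhsr.
  have tn0 : t != 0 by rewrite gt_eqF.
  have dV : is_derive t (1 : R) (fun s : R => s^-1) (- t ^- 2).
    apply: is_derive_eq (is_deriveV tn0 (is_derive_id t (1 : R))) _.
    by rewrite /GRing.scale/= mulr1.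
  have dE : is_derive t (1 : R) (fun s : R => expR (- s^-1)) (expR (- t^-1) * t ^- 2).
    apply: (@is_derive1_comp _ expR (fun s : R => - s^-1)).
    by rewrite -[X in is_derive _ _ _ X]opprK; exact: is_deriveN.
  have dX : is_derive t (1 : R) (fun s : R => s^-1 ^+ n)
      ((n%:R * t^-1 ^+ n.-1) *: (- t ^- 2)).
    have -> : (fun s : R => s^-1 ^+ n) = (fun s : R => s^-1) ^+ n.
      by rewrite exprfctE.
    exact: is_deriveX.
  apply: is_derive_eq (is_deriveM dX dE) _.
  rewrite /flat t0 /= /GRing.scale/=.
  case: n dX => [_|n _]; rewrite ?expr0 ?mul0r; first by field.
  by rewrite !exprSr ![_.-1]/=; field.
- have -> : flat n.+2 0 - n%:R * flat n.+1 0 = 0.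
    by rewrite /flat ltxx mulr0 subr0.
  exact: is_derive_flat0 (@flat_le_sqr n).
Unshelve. all: by end_near.
Qed.

Lemma smooth_flat k n : smooth k (flat n).
Proof.
elim: k n => [|k ih] n.
  apply: (@is_derive_continuous _ (fun t => flat n.+2 t - n%:R * flat n.+1 t)).
  by move=> x; exact: is_derive_flat.
exists (fun t => flat n.+2 t + - n%:R * flat n.+1 t).
  by move=> x; rewrite mulNr; exact: is_derive_flat.
by apply: smoothD => //; exact: smoothZ.
Qed.

Lemma flat_itv t : 0 <= flat 0 t <= 1.
Proof.
rewrite /flat; case: ifPn => [t0|_]; last by rewrite lexx ler01.
rewrite expr0 mul1r expR_ge0/=.
by rewrite expR_le1 oppr_le0 invr_ge0 ltW.
Qed.

Lemma cvg_flat (u : nat -> R) : u n @[n --> \oo] --> +oo ->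
  flat 0 (u n) @[n --> \oo] --> (1 : R).
Proof.
move=> uoo.
have : expR (- (u n)^-1) @[n --> \oo] --> (1 : R).
  rewrite -[X in _ --> X]expR0 -oppr0.
  apply: continuous_cvg; first exact: continuous_expR.
  apply: cvgN; apply/gtr0_cvgV0 => //.
  by move/cvgryPgt : uoo; apply.
move=> h; apply: cvg_trans h; apply: near_eq_cvg.
have := uoo; move=> /cvgryPgt /(_ 0).
by apply: filterS => n un; rewrite /flat un expr0 mul1r.
Qed.

(* Shifting the arguments by [n.+1] makes the limit the indicator of the
   half-open interval, so that bisected boxes partition each other exactly. *)
Definition bump (a b : R) (n : nat) (t : R) : R :=
  flat 0 (n.+1%:R ^+ 2 * t + (n.+1%:R - n.+1%:R ^+ 2 * a)) *
  flat 0 (- n.+1%:R ^+ 2 * t + (n.+1%:R ^+ 2 * b - n.+1%:R)).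

Lemma smooth_bump k a b n : smooth k (bump a b n).
Proof. by apply: smoothM; apply: smooth_affine; exact: smooth_flat. Qed.

Lemma bump_itv a b n t : 0 <= bump a b n t <= 1.
Proof.
rewrite /bump; set x := flat _ _; set y := flat _ _.
have /andP[x0 x1] : 0 <= x <= 1 by exact: flat_itv.
have /andP[y0 y1] : 0 <= y <= 1 by exact: flat_itv.
by rewrite mulr_ge0//= mulr_ile1.
Qed.

Lemma bump_support a b n t : bump a b n t != 0 ->
  a - n.+1%:R^-1 <= t <= b - n.+1%:R^-1.
Proof.
have p0 : (0 : R) < n.+1%:R by rewrite ltr0n.
have flat_gt0 (s : R) : flat 0 s != 0 -> 0 < s.
  by rewrite /flat; case: ifPn => //; rewrite eqxx.
rewrite /bump mulf_eq0 negb_or => /andP[/flat_gt0 h1 /flat_gt0 h2].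
move: h1 h2; set p := (n.+1%:R : R) in p0 *; move=> h1 h2.
have pp : 0 < p ^+ 2 by rewrite exprn_gt0.
apply/andP; split; rewrite -(ler_pM2l pp) mulrBr.
  have -> : p ^+ 2 * p^-1 = p by field; rewrite gt_eqF.
  by move: h1; lra.
have -> : p ^+ 2 * p^-1 = p by field; rewrite gt_eqF.
by move: h2; lra.
Qed.

(** At [t = a] the first argument of [flat] is [n.+1], at [t = b] the second is [- n.+1]: the left
    endpoint is kept, the right one dropped. Elsewhere the quadratic terms decide. *)
Lemma cvg_bump a b t :
  bump a b n t @[n --> \oo] --> ((a <= t < b)%R%:R : R).
Proof.
have sqoo (c : R) : 0 <= c ->
    (n.+1%:R ^+ 2 * c + n.+1%:R : R) @[n --> \oo] --> +oo.
  move=> c0; apply: (@ger_cvgy _ _ _ _ (fun n => n%:R)); last exact: cvgr_idn.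
  apply: nearW => n; rewrite (@le_trans _ _ n.+1%:R)// ?ler_nat//.
  by rewrite lerDr mulr_ge0// sqr_ge0.
have sqoo' (c : R) : 0 < c ->
    (n.+1%:R ^+ 2 * c - n.+1%:R : R) @[n --> \oo] --> +oo.
  move=> c0.
  apply: (@ger_cvgy _ _ _ _ (fun n => n%:R)); last exact: cvgr_idn.
  near=> n.
  have : 2 / c <= n%:R by near: n; exact: nbhs_infty_ger.
  rewrite ler_pdivrMr// => h.
  have n1 : n.+1%:R = n%:R + 1 :> R by rewrite -natr1.
  have n0 : 0 <= n%:R :> R by exact: ler0n.
  rewrite n1; nra.
have sqlt (c : R) : 0 < c -> \forall n \near \oo, 0 < n.+1%:R ^+ 2 * c - n.+1%:R.
  by move=> /sqoo' /cvgryPgt; exact.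
have [at_|ta] := leP a t; have [tb|bt] := ltP t b => /=.
- rewrite -[X in _ --> X](mulr1 1); apply: cvgM.
    apply: cvg_flat; have := sqoo (t - a); rewrite subr_ge0 => /(_ at_).
    by apply: cvg_trans; apply: near_eq_cvg; apply: nearW => n; ring.
  apply: cvg_flat; have := sqoo' (b - t); rewrite subr_gt0 => /(_ tb).
  by apply: cvg_trans; apply: near_eq_cvg; apply: nearW => n; ring.
- apply: cvg_near_cst; apply: nearW => n; rewrite /bump [X in _ * X]/flat ifF ?mulr0//.
  apply/negbTE; rewrite -leNgt.
  have h : 0 <= (t - b) * n.+1%:R ^+ 2 by rewrite mulr_ge0 ?subr_ge0// sqr_ge0.
  have : 0 <= n.+1%:R :> R by [].
  by move: h; lra.
- have := sqlt (a - t); rewrite subr_gt0 => /(_ ta) h.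
  apply: cvg_near_cst; apply: filterS h => n h.
  rewrite /bump [X in X * _]/flat ifF ?mul0r//.
  by apply/negbTE; rewrite -leNgt; move: h; lra.
- have := sqlt (a - t); rewrite subr_gt0 => /(_ ta) h.
  apply: cvg_near_cst; apply: filterS h => n h.
  rewrite /bump [X in X * _]/flat ifF ?mul0r//.
  by apply/negbTE; rewrite -leNgt; move: h; lra.
Unshelve. all: by end_near.
Qed.

(** Boundedness and bounded support make [f] integrable on the line, so one antiderivative,
    integrated from minus infinity, serves every [x]. *)
Lemma exists_antiderivative (f : R -> R) (a b : R) : continuous f ->
  (forall t, 0 <= f t <= 1) -> (forall t, f t != 0 -> a <= t <= b) ->
  exists F : R -> R, forall x, is_derive x (1 : R) F (f x).
Proof.
move=> cf f01 fab.
have fi : (@lebesgue_measure R).-integrable setT (EFin \o f).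
  apply: (@le_integrable _ _ _ _ _ measurableT _ (EFin \o
    (\1_(`[a, b]%classic : set (measurableTypeR R)) : measurableTypeR R -> R))) => //.
  - by apply/measurable_EFinP; exact: continuous_measurable_fun.
  - move=> x _ /=; rewrite lee_fin indicE mem_setE/= in_itv/=.
    have /andP[f0 f1] := f01 x.
    have [->|/fab ->] := eqVneq (f x) 0; first by rewrite normr0.
    by rewrite normr1 ger0_norm.
  - apply: integrable_indic_itv.
exists (fun x => \int[@lebesgue_measure R]_(t in `]-oo, x]) f t) => x.
have [] := @continuous_FTC1 _ f -oo%O x (x + 1) _ _ _ (cf x).
- by rewrite ltrDl.
- exact: integrableS fi.
- by rewrite ltNyr.
- by move=> df; rewrite derive1E => <-; exact: DeriveDef.
Qed.

(* The difference of two translates of [f] integrates to a tent of compact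
   support, which is what makes it a derivative of a test function. *)
Lemma exists_tent (f : R -> R) (a h : R) : 0 < h ->
  (forall k, smooth k f) -> (forall t, 0 <= f t <= 1) ->
  (forall t, f t != 0 -> a <= t <= a + h) ->
  exists G : R -> R, [/\ forall k, smooth k G,
    forall x, is_derive x (1 : R) G (f x - f (x - h)),
    forall t, G t != 0 -> a <= t <= a + h + h & forall t, `|G t| <= h].
Proof.
move=> h0 sf f01 fab.
have [F dF] := exists_antiderivative (sf 0%N) f01 fab.
have cF : continuous F by exact: is_derive_continuous dF.
have dG x : is_derive x (1 : R) (fun x => F x - F (1 * x - h)) (f x - f (x - h)).
  apply: is_deriveB; have := @is_derive_affine F f 1 (- h) dF x.
  by rewrite !mul1r.
(* By the mean value theorem the value of the tent is [h] times a value of [f] between [x - h] and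
   [x]; both the support and the bound are read off from this. *)
have mvt x : exists2 c, x - h < c < x & F x - F (1 * x - h) = f c * h.
  have xh : 1 * x - h < x by rewrite mul1r ltrBlDr ltrDl.
  have [c cI e] := MVT xh (fun y _ => dF y) (continuous_subspaceT cF).
  move: cI; rewrite in_itv/= mul1r => cx; exists c => //.
  by move: e; rewrite !mul1r => ->; rewrite opprB addrCA subrr addr0.
exists (fun x => F x - F (1 * x - h)); split => //.
- case=> [|k]; first exact: is_derive_continuous dG.
  exists (fun x => f x + -1 * f (1 * x - h)).
    by move=> x; rewrite mulN1r mul1r; exact: dG.
  exact: (smoothD (sf k) (smoothZ (-1) (smooth_affine 1 (- h) (sf k)))).
- move=> t; have [c /andP[c1 c2] ->] := mvt t.
  rewrite mulf_eq0 negb_or => /andP[/fab /andP[ac ca] _].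
  by apply/andP; split; lra.
- move=> t; have [c _ ->] := mvt t; have /andP[f0 f1] := f01 c.
  by rewrite normrM (gtr0_norm h0) (ger0_norm f0) ler_piMl // ltW.
Qed.

End smooth.

(** * Tensor products of smooth functions *)

Section tensor.
Context {R : realType} {d : nat}.
Local Notation E := 'rV[R]_d.

Definition tens (f : 'I_d -> R -> R) (x : E) : R := \prod_i f i (x ord0 i).

Definition upd (T : Type) (f : 'I_d -> T) (i : 'I_d) (g : T) : 'I_d -> T :=
  fun j => if j == i then g else f j.

Definition cbox (a b : 'I_d -> R) : set E :=
  [set x | forall i, a i <= x ord0 i <= b i].

Lemma continuous_tens f : (forall i, continuous (f i)) -> continuous (tens f).
Proof.
move=> cf; apply: continuous_big => [|i _ x]; first exact: mul_continuous.
apply: (@continuous_comp _ _ _ (fun y : E => y ord0 i) (f i)); last exact: cf.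
exact: coord_continuous.
Qed.

(** A step along the basis vector [i] moves only the argument of factor [i]; the other factors form
    the constant [P]. The derivative is again a tensor product, which drives the induction in
    [of_class_C_tens]. *)
Lemma is_derive_tens f i f' : (forall t : R, is_derive t (1 : R) (f i) (f' t)) ->
  forall x, is_derive x (basis_rv i) (tens f) (tens (upd f i f') x).
Proof.
move=> df x.
pose P := \prod_(j | j != i) f j (x ord0 j).
have tE g h : tens (upd f i g) (h *: basis_rv i + x) = g (h *: 1 + x ord0 i) * P.
  rewrite /tens (bigD1 i)//= /upd eqxx !mxE !eqxx; congr (_ * _).
  apply: eq_bigr => j ji; rewrite (negbTE ji) !mxE eqxx/= (negbTE ji).
  by rewrite mulr0 add0r.
have tE0 g : tens (upd f i g) x = g (x ord0 i) * P.
  by have := tE g 0; rewrite !scale0r !add0r.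
have uf : tens f = tens (upd f i (f i)).
  apply/funext => y; apply: eq_bigr => j _; rewrite /upd.
  by case: eqP => // ->.
have [dfx dfE] := df (x ord0 i).
have h : h^-1 *: (tens f (h *: basis_rv i + x) - tens f x) @[h --> 0^'] -->
    tens (upd f i f') x.
  rewrite tE0 uf.
  under eq_fun do rewrite tE tE0 -mulrBl /GRing.scale/= mulrA.
  apply: cvgM; last exact: cvg_cst.
  by rewrite -dfE; exact: dfx.
apply: DeriveDef.
  by apply/cvg_ex; exists (tens (upd f i f') x); exact: h.
by apply/cvg_lim => //; exact: h.
Qed.

Lemma of_class_C_tens k f : (forall i, smooth k (f i)) -> of_class_C k (tens f).
Proof.
elim: k f => [|k ih] f sf /=; first exact: continuous_tens.
split.
- by apply: continuous_tens => i; exact: smooth_continuous (sf i).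
- move=> x i; have [f' df _] := sf i.
  by have [] := is_derive_tens df x.
- move=> i; have [f' df sf'] := sf i.
  have -> : 'D_(basis_rv i) (tens f) = tens (upd f i f').
    by apply/funext => x; have [] := is_derive_tens df x.
  apply: ih => j; rewrite /upd; case: ifP => // _.
  exact: smoothS.
Qed.

Lemma closed_cbox a b : closed (cbox a b).
Proof.
have -> : cbox a b = \bigcap_i ((fun x : E => x ord0 i) @^-1` `[a i, b i]%classic).
  apply/seteqP; split => x h i; first by move=> _; rewrite /= in_itv/=; exact: h.
  by have := h i I; rewrite /= in_itv.
apply: closed_bigI => i _.
apply: closed_comp; last exact: itv_closed.
by move=> x _; exact: coord_continuous.
Qed.

Lemma tens_neq0 f x : tens f x != 0 -> forall i, f i (x ord0 i) != 0.
Proof. by move=> /prodf_neq0 h i; exact: h. Qed.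

Lemma test_function_tens (Omega : set E) f a b :
  (forall k i, smooth k (f i)) ->
  (forall i t, f i t != 0 -> a i <= t <= b i) -> cbox a b `<=` Omega ->
  test_function Omega (tens f).
Proof.
move=> sf fab abO.
have sub : closure [set x | tens f x != 0] `<=` cbox a b.
  rewrite [X in _ `<=` X](closure_id _).1; last exact: closed_cbox.
  by apply: closure_subset => x /= /tens_neq0 h i; exact: fab.
split.
- by move=> k; exact: of_class_C_tens.
- apply: subclosed_compact sub; first exact: closed_closure.
  rewrite (_ : cbox a b = [set v : E | forall i, `[a i, b i]%classic (v ord0 i)]).
    apply: (@rV_compact _ _ (fun i => `[a i, b i]%classic)) => i.
    exact: segment_compact.
  by apply/seteqP; split => x h i; have := h i; rewrite /= in_itv.
- exact: subset_trans sub abO.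
Qed.

End tensor.

Lemma near_inv_lt (R : realType) (e : R) : 0 < e ->
  \forall n \near \oo, n.+1%:R^-1 < e.
Proof. by move=> e0; exact: (near_infty_natSinv_lt (PosNum e0)). Qed.

(** * Integrals against bounded factors *)

Section bounded_convergence.
Context d (T : measurableType d) (R : realType).
Variable mu : {measure set T -> \bar R}.

Lemma Rintegral_indicM (A : set T) (z : T -> R) : measurable A ->
  \int[mu]_x (z x * \1_A x) = \int[mu]_(x in A) z x.
Proof.
move=> mA; rewrite [RHS]Rintegral_mkcond; apply: eq_Rintegral => x _.
by rewrite /patch indicE; case: (x \in A); rewrite ?mulr1 ?mulr0.
Qed.

Lemma integrable_mul_bounded (z f : T -> R) (K : R) :
  mu.-integrable setT (EFin \o z) -> measurable_fun setT f ->
  (forall x, `|f x| <= K) ->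
  mu.-integrable setT (EFin \o (fun x => z x * f x)).
Proof.
move=> iz mf fK; have /integrableP[/measurable_EFinP mz _] := iz.
have iK : mu.-integrable setT (EFin \o (fun x => K * `|z x|)).
  rewrite (_ : _ \o _ = (fun x => K%:E * (`|z x|)%:E)%E)//.
  by apply: integrableZl => //; exact: (integrable_norm iz).
apply: le_integrable iK => //.
  by apply/measurable_EFinP/measurable_funM.
move=> x _ /=; rewrite lee_fin [leRHS]ger0_norm.
  by rewrite normrM mulrC ler_wpM2r.
by rewrite mulr_ge0// (le_trans _ (fK x)).
Qed.

Lemma bounded_cvg_Rintegral (z f : T -> R) (u : nat -> T -> R) (K : R) :
  mu.-integrable setT (EFin \o z) ->
  (forall n, measurable_fun setT (u n)) -> (forall n x, `|u n x| <= K) ->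
  (forall x, u n x @[n --> \oo] --> f x) ->
  \int[mu]_x (z x * u n x) @[n --> \oo] --> \int[mu]_x (z x * f x).
Proof.
move=> iz mu_ uK uf; have /integrableP[/measurable_EFinP mz _] := iz.
have mf : measurable_fun setT f.
  by apply: (@measurable_fun_cvg _ _ _ _ u) => // x _; exact: uf.
have iK : mu.-integrable setT (EFin \o (fun x => K * `|z x|)).
  rewrite (_ : _ \o _ = (fun x => K%:E * (`|z x|)%:E)%E)//.
  by apply: integrableZl => //; exact: (integrable_norm iz).
have [||||| iF _] := @dominated_convergence _ _ R mu setT measurableT
  (fun n x => (z x * u n x)%:E) (fun x => (z x * f x)%:E)
  (EFin \o (fun x => K * `|z x|)).
- by move=> n; apply/measurable_EFinP/measurable_funM.
- by apply/measurable_EFinP/measurable_funM.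
- apply: aeW => x _; apply: cvg_EFin; first exact: nearW.
  by apply: cvgM; [exact: cvg_cst|exact: uf].
- exact: iK.
- apply: aeW => x n _; rewrite /= lee_fin normrM mulrC ler_wpM2r//.
move=> h; apply: fine_cvg; rewrite fineK//.
by apply: integrable_fin_num => //; exact: iF.
Qed.

End bounded_convergence.

(** * Half-open boxes *)

Section boxes.
Context {R : realType} {d : nat}.
Local Notation E := 'rV[R]_d.

Definition box (a b : 'I_d -> R) : set E :=
  [set x | forall i, a i <= x ord0 i < b i].

Lemma measurable_coord_itv (i : 'I_d) (I : interval R) :
  measurable [set x : E | x ord0 i \in I].
Proof.
rewrite (_ : [set x : E | _] = (fun x : E => x ord0 i) @^-1` [set` I])//.
by rewrite -[X in measurable X]setTI; apply: measurable_coord.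
Qed.

Lemma measurable_box a b : measurable (box a b).
Proof.
have -> : box a b = \bigcap_(i in [set: 'I_d]) [set x : E | x ord0 i \in `[a i, b i[].
  apply/seteqP; split => x h i; first by move=> _; rewrite /= in_itv/=; exact: h.
  by have := h i I; rewrite /= in_itv.
apply: fin_bigcap_measurable => // i _; exact: measurable_coord_itv.
Qed.

Lemma measurable_cbox (a b : 'I_d -> R) : measurable (cbox a b).
Proof.
have -> : cbox a b = \bigcap_(i in [set: 'I_d]) [set x : E | x ord0 i \in `[a i, b i]].
  apply/seteqP; split => x h i; first by move=> _; rewrite /= in_itv/=; exact: h.
  by have := h i I; rewrite /= in_itv.
apply: fin_bigcap_measurable => // i _; exact: measurable_coord_itv.
Qed.

Lemma measurable_tens (f : 'I_d -> R -> R) : (forall i, continuous (f i)) ->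
  measurable_fun setT (tens f).
Proof.
by move=> cf; apply: measurable_continuous_rV; exact: continuous_tens.
Qed.

Definition bumps (a b : 'I_d -> R) (n : nat) (i : 'I_d) : R -> R :=
  bump (a i) (b i) n.

Lemma tens_bumps_le1 a b n x : `|tens (bumps a b n) x| <= 1.
Proof.
rewrite /tens normr_prod; apply: prodr_ile1 => i _.
have /andP[h0 h1] := bump_itv (a i) (b i) n (x ord0 i).
by rewrite normr_ge0/= ger0_norm.
Qed.

Lemma cvg_tens_bumps a b x :
  tens (bumps a b n) x @[n --> \oo] --> (\1_(box a b) x : R).
Proof.
have -> : \1_(box a b) x = \prod_i ((a i <= x ord0 i < b i)%R%:R : R).
  rewrite indicE; have [xb|xb] := boolP (x \in box a b).
    by rewrite big1// => i _; move: xb; rewrite inE => ->.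
  move: xb; rewrite notin_setE => /existsNP[i /negP xi].
  by rewrite (bigD1 i)//= (negbTE xi) mul0r.
apply: cvg_big; first exact: mul_continuous.
by move=> i _; exact: cvg_bump.
Qed.

(** These closed boxes contain the supports of the bumps of index [n]. Both ends move to the left,
    so in the limit the lower faces stay and the upper faces disappear. *)
Lemma cvg_indic_cbox a b x :
  \1_(cbox (fun i => a i - n.+1%:R^-1) (fun i => b i - n.+1%:R^-1)) x
    @[n --> \oo] --> (\1_(box a b) x : R).
Proof.
have itv1 (s t u : R) : \forall n \near \oo,
    (s - n.+1%:R^-1 <= u <= t - n.+1%:R^-1) = (s <= u < t).
  have [su|us] := leP s u; have [ut|tu] := ltP u t => /=.
  - have : \forall n \near \oo, n.+1%:R^-1 < t - u.
      by apply: near_inv_lt; rewrite subr_gt0.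
    apply: filterS => n; have : 0 <= n.+1%:R^-1 :> R by [].
    by move: n.+1%:R^-1 => r r0 rt; apply/andP; split; lra.
  - apply: nearW => n; apply/negbTE; rewrite negb_and -!ltNge; apply/orP; right.
    have : 0 < n.+1%:R^-1 :> R by [].
    by move: n.+1%:R^-1 => r r0; lra.
  - have : \forall n \near \oo, n.+1%:R^-1 < s - u.
      by apply: near_inv_lt; rewrite subr_gt0.
    apply: filterS => n; move: n.+1%:R^-1 => r h.
    by apply/negbTE; rewrite negb_and -!ltNge; apply/orP; left; lra.
  - have : \forall n \near \oo, n.+1%:R^-1 < s - u.
      by apply: near_inv_lt; rewrite subr_gt0.
    apply: filterS => n; move: n.+1%:R^-1 => r h.
    by apply/negbTE; rewrite negb_and -!ltNge; apply/orP; left; lra.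
have : \forall n \near \oo, forall i : 'I_d,
    (a i - n.+1%:R^-1 <= x ord0 i <= b i - n.+1%:R^-1) = (a i <= x ord0 i < b i).
  by apply: filter_forall => i; exact: itv1.
move=> h; apply: cvg_near_cst; apply: filterS h => n h.
rewrite !indicE; congr (_%:R); congr nat_of_bool.
by apply/idP/idP; rewrite !inE => xb i; have := xb i; rewrite h.
Qed.

End boxes.

(** * Weak derivatives tested on boxes *)

Section weak_derivatives_on_boxes.
Context {R : realType} {d : nat} {Omega : set 'rV[R]_d} (oOmega : open Omega).
Hypothesis Omega_bounded : bounded_set Omega.
Local Notation mu := (lebesgue_on oOmega).
Local Notation L2 := (L2space mu).

Lemma lebesgue_on_finite : (mu setT < +oo)%E.
Proof.
have [M [_ MO]] := Omega_bounded.
have [mQ Qoo] := lebesgue_rv_cube d (M + 1).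
apply: le_lt_trans Qoo; rewrite /= /mrestr le_measure ?inE//.
  by apply: measurableI => //; exact: measurable_open_rV.
move=> x [_ /(MO (M + 1))]; rewrite ltrDl ltr01 => /(_ isT) /= xM i.
apply: le_trans xM; rewrite [leRHS](_ : _ = mx_norm x)// mx_normrE.
exact: (le_bigmax _ (fun ij : 'I_1 * 'I_d => `|x ij.1 ij.2|) (ord0, i)).
Qed.

Local Notation mu_fin := lebesgue_on_finite.

(* The margin [delta] leaves room for the smooth bumps approximating the
   indicator of the half-open box. *)
Definition good_box (U : set 'rV[R]_d) (a b : 'I_d -> R) : Prop :=
  exists2 delta, 0 < delta & cbox (fun i => a i - delta) b `<=` U.

Lemma good_box_sub U a b a' b' : (forall i, a i <= a' i) ->
  (forall i, b' i <= b i) -> good_box U a b -> good_box U a' b'.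
Proof.
move=> aa bb [delta d0 ab]; exists delta => // x xab; apply: ab => i.
have /andP[h1 h2] := xab i; have := aa i; have := bb i => h3 h4.
by apply/andP; split; lra.
Qed.

Lemma good_box_near a b : good_box Omega a b -> \forall n \near \oo,
  cbox (fun i => a i - n.+1%:R^-1) (fun i => b i - n.+1%:R^-1) `<=` Omega.
Proof.
move=> [delta d0 ab]; apply: filterS (near_inv_lt d0) => n.
have : 0 <= n.+1%:R^-1 :> R by [].
move: n.+1%:R^-1 => r r0 rd x xab; apply: ab => i.
by have /andP[h1 h2] := xab i; apply/andP; split; lra.
Qed.

(** For large [n] the tensor bumps are test functions, and they converge boundedly to the indicator
    of the box. *)
Lemma Rintegral_box0 (z : L2) a b :
  (forall phi, test_function Omega phi -> \int[mu]_x (z x * phi x) = 0) ->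
  good_box Omega a b -> \int[mu]_(x in box a b) z x = 0.
Proof.
move=> z0 /good_box_near gab.
rewrite -Rintegral_indicM; last exact: measurable_box.
have h := bounded_cvg_Rintegral (L2_integrable mu_fin z)
  (fun n => measurable_tens (fun i => smooth_continuous (smooth_bump 0 (a i) (b i) n)))
  (fun n => tens_bumps_le1 a b n) (fun x => @cvg_tens_bumps _ _ a b x).
apply: cvg_unique h _ => //.
apply: cvg_near_cst; apply: filterS gab => n gab; apply: z0.
apply: test_function_tens gab => [k i|i t]; first exact: smooth_bump.
exact: bump_support.
Qed.

Definition mid (a b : 'I_d -> R) (i : 'I_d) : R := (a i + b i) / 2.

(** The test function is a tent in direction [i] times bumps in the others. Its derivative along [i]
    is the bump of the lower half minus that of the upper half, while its size is at most the height
    of the tent. *)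
Lemma weak_partial_box (i : 'I_d) (w g : L2) a b : weak_partial i w g ->
  good_box Omega a b -> a i < b i ->
  `|\int[mu]_(x in box a (upd b i (mid a b i))) w x -
    \int[mu]_(x in box (upd a i (mid a b i)) b) w x| <=
  (b i - a i) * \int[mu]_(x in box a b) `|g x|.
Proof.
move=> wg gab abi.
set m := mid a b i; pose h := (b i - a i) / 2.
have h0 : 0 < h by rewrite divr_gt0// subr_gt0.
have hle : h <= b i - a i by rewrite /h; move: abi; clear; lra.
have mE : m = a i + h by rewrite /m /h /mid; lra.
have bE : b i = m + h by rewrite /m /h /mid; lra.
pose e n i' := bump (a i) m n i'.
(* The lower bump and its translate by [h], half the side, live on the two halves, so the tent
   between them is supported over the whole side. *)
have tent n : exists G : R -> R, [/\ forall k, smooth k G,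
    forall x : R, is_derive x (1 : R) G (e n x - e n (x - h)),
    forall t, G t != 0 -> a i - n.+1%:R^-1 <= t <= b i - n.+1%:R^-1 &
    forall t, `|G t| <= h].
  have [|k|t|t|G [G1 G2 G3 G4]] := @exists_tent _ (e n) (a i - n.+1%:R^-1) h => //.
  - exact: smooth_bump.
  - exact: bump_itv.
  - move=> /bump_support; rewrite mE; move: n.+1%:R^-1 => r /andP[h1 h2].
    by apply/andP; split; lra.
  - exists G; split => // t /G3; rewrite bE mE.
    by move: n.+1%:R^-1 => r /andP[h1 h2]; apply/andP; split; lra.
have [G GP] := choice tent.
pose f n := upd (bumps a b n) i (G n).
have sf n k j : smooth k (f n j).
  rewrite /f /upd; case: ifP => _; last exact: smooth_bump.
  by case: (GP n).
have fsupp n j t : f n j t != 0 -> a j - n.+1%:R^-1 <= t <= b j - n.+1%:R^-1.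
  rewrite /f /upd; case: ifP => [/eqP -> |_]; last exact: bump_support.
  by case: (GP n) => _ _ + _; apply.
have Df n : 'D_(basis_rv i) (tens (f n)) = (fun x =>
    tens (bumps a (upd b i m) n) x - tens (bumps (upd a i m) b n) x).
  apply/funext => x.
  have dG t : is_derive t (1 : R) (f n i) (e n t - e n (t - h)).
    by rewrite /f /upd eqxx; case: (GP n).
  have [_ ->] := is_derive_tens dG x.
  rewrite /tens (bigD1 i)//= [in X in _ = X - _](bigD1 i)//=.
  rewrite [in X in _ = _ - X](bigD1 i)//=.
  have eq1 : \prod_(j < d | j != i) upd (f n) i (fun t => e n t - e n (t - h)) j (x ord0 j)
      = \prod_(j < d | j != i) bumps a (upd b i m) n j (x ord0 j).
    by apply: eq_bigr => j ji; rewrite /bumps /f /upd (negbTE ji).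
  have eq2 : \prod_(j < d | j != i) bumps (upd a i m) b n j (x ord0 j)
      = \prod_(j < d | j != i) bumps a (upd b i m) n j (x ord0 j).
    by apply: eq_bigr => j ji; rewrite /bumps /upd (negbTE ji).
  rewrite eq1 eq2 -mulrBl; congr (_ * _).
  rewrite /bumps /upd eqxx /e; congr (_ - _).
  (* Both halves have length [h], hence the bump of the upper half is the translate of the bump of
     the lower one. *)
  by rewrite {2}mE bE /bump; congr (flat 0 _ * flat 0 _); ring.
have iw := L2_integrable mu_fin w; have ig := L2_integrable mu_fin g.
have mt (a' b' : 'I_d -> R) n : measurable_fun setT (tens (bumps a' b' n)).
  apply: measurable_tens => j; exact: smooth_continuous (smooth_bump 0 _ _ n).
have lhs : \int[mu]_x (w x * 'D_(basis_rv i) (tens (f n)) x) @[n --> \oo] -->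
    \int[mu]_(x in box a (upd b i m)) w x - \int[mu]_(x in box (upd a i m) b) w x.
  have c (a' b' : 'I_d -> R) : \int[mu]_x (w x * tens (bumps a' b' n) x) @[n --> \oo] -->
      \int[mu]_(x in box a' b') w x.
    have := bounded_cvg_Rintegral iw (mt a' b') (fun n => tens_bumps_le1 a' b' n)
      (fun x => @cvg_tens_bumps _ _ a' b' x).
    by rewrite Rintegral_indicM//; exact: measurable_box.
  have -> : (fun n => \int[mu]_x (w x * 'D_(basis_rv i) (tens (f n)) x)) =
      (fun n => \int[mu]_x (w x * tens (bumps a (upd b i m) n) x) -
                \int[mu]_x (w x * tens (bumps (upd a i m) b n) x)).
    apply/funext => n; rewrite -RintegralB//; last 2 first.
    - by apply: (integrable_mul_bounded (K := 1)) => // x; exact: tens_bumps_le1.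
    - by apply: (integrable_mul_bounded (K := 1)) => // x; exact: tens_bumps_le1.
    apply: eq_Rintegral => x _; rewrite -mulrBr; congr (_ * _).
    exact: (congr1 (fun p => p x) (Df n)).
  exact: cvgB.
pose K n : set 'rV[R]_d := cbox (fun i => a i - n.+1%:R^-1) (fun i => b i - n.+1%:R^-1).
have mK n : measurable (K n) by exact: measurable_cbox.
have rhs : (b i - a i) * \int[mu]_x (`|g x| * \1_(K n) x) @[n --> \oo] -->
   (b i - a i) * \int[mu]_(x in box a b) `|g x|.
  apply: cvgM; first exact: cvg_cst.
  rewrite -(Rintegral_indicM mu (fun x => `|g x|) (measurable_box a b)).
  apply: (@bounded_cvg_Rintegral _ _ _ _ (fun x => `|g x|) _ _ 1) => //.
  - exact: (integrable_norm ig).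
  - by move=> n; exact: measurable_indic.
  - by move=> n x; rewrite indicE; case: (_ \in _); rewrite ?normr1 ?normr0.
  - by move=> x; exact: cvg_indic_cbox.
(* The inequality is proved for every large [n] with smooth test functions, and then passes to the
   limit on both sides. *)
apply: (ler_cvg_to (cvg_norm lhs) rhs).
apply: filterS (good_box_near gab) => n gn.
have tf := test_function_tens (sf n) (fsupp n) gn.
rewrite (wg _ tf) normrN.
have mtf : measurable_fun setT (tens (f n)).
  by apply: measurable_tens => j; exact: (smooth_continuous (sf n 0%N j)).
(* The tent is bounded by [h]; it is weakened to the full side [b i - a i], which is the constant in
   the conclusion. *)
have ftle x : `|tens (f n) x| <= (b i - a i) * \1_(K n) x.
  have [xK|xK] := pselect (K n x); last first.
    rewrite indicE memNset// mulr0 normr_le0.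
    apply/negPn/negP => /tens_neq0 fx; apply: xK => j; exact: fsupp.
  rewrite indicE mem_set// mulr1 /tens (bigD1 i)//= normrM.
  have le1 : `|\prod_(j < d | j != i) f n j (x ord0 j)| <= 1.
    rewrite normr_prod; apply: prodr_ile1 => j ji.
    have /andP[p0 p1] := bump_itv (a j) (b j) n (x ord0 j).
    by rewrite normr_ge0/= /f /upd (negbTE ji) ger0_norm.
  have leh : `|f n i (x ord0 i)| <= h by rewrite /f /upd eqxx; case: (GP n).
  apply: (@le_trans _ _ (h * 1)).
    by rewrite ler_pM.
  by rewrite mulr1.
have ftle1 x : `|tens (f n) x| <= b i - a i.
  apply: le_trans (ftle x) _; rewrite ler_piMr ?subr_ge0 ?(ltW abi)//.
have igf : mu.-integrable setT (EFin \o (fun x => g x * tens (f n) x)).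
  exact: (integrable_mul_bounded ig mtf ftle1).
apply: le_trans (le_normr_Rintegral measurableT igf) _.
have iK : mu.-integrable setT (EFin \o (fun x => `|g x| * \1_(K n) x)).
  apply: (@integrable_mul_bounded _ _ _ _ (fun x => `|g x|) _ 1) => //.
  - exact: (integrable_norm ig).
  - by move=> x; rewrite indicE; case: (_ \in _); rewrite ?normr1 ?normr0.
rewrite -RintegralZl//; apply: le_Rintegral => //.
- exact: (integrable_norm igf).
- rewrite (_ : _ \o _ = (fun x => (b i - a i)%:E * (`|g x| * \1_(K n) x)%:E)%E)//.
  exact: integrableZl.
- by move=> x _; rewrite normrM mulrCA ler_wpM2l.
Qed.

End weak_derivatives_on_boxes.

(** * Bisection of boxes *)

Section bisection.
Context {R : realType} {d : nat}.
Implicit Types (a b : 'I_d -> R) (l : seq 'I_d).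

Definition lt_box a b := forall i, a i < b i.

(* Sum of a box functional over the boxes obtained by bisecting successively
   along the directions in [l]. *)
Fixpoint leaves (phi : ('I_d -> R) -> ('I_d -> R) -> R) l a b : R :=
  match l with
  | [::] => phi a b
  | i :: l' => leaves phi l' a (upd b i (mid a b i)) +
               leaves phi l' (upd a i (mid a b i)) b
  end.

Lemma mid_itv a b i : a i < b i -> a i < mid a b i < b i.
Proof. by rewrite /mid => ab; apply/andP; split; lra. Qed.

Lemma lt_box_lo a b i : lt_box a b -> lt_box a (upd b i (mid a b i)).
Proof.
move=> ab j; rewrite /upd; case: eqP => [->|_ //].
by have /andP[] := mid_itv (ab i).
Qed.

Lemma lt_box_hi a b i : lt_box a b -> lt_box (upd a i (mid a b i)) b.
Proof.
move=> ab j; rewrite /upd; case: eqP => [->|_ //].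
by have /andP[] := mid_itv (ab i).
Qed.

Lemma box_split a b i : lt_box a b ->
  box a b = box a (upd b i (mid a b i)) `|` box (upd a i (mid a b i)) b.
Proof.
move=> ab; have /andP[am mb] := mid_itv (ab i).
apply/seteqP; split => [x xab|x [] xab j].
- have [xm|mx] := ltP (x ord0 i) (mid a b i); [left|right] => j; rewrite /upd.
    have /andP[h1 h2] := xab j.
    by case: eqP => [ji|_]; rewrite h1//= ji.
  have /andP[h1 h2] := xab j.
  by case: eqP => [ji|_]; rewrite h2 ?h1 ?andbT//= ji.
- have := xab j; rewrite /upd; case: eqP => [->|//] /andP[-> /=].
  by move=> h; exact: lt_trans mb.
- have := xab j; rewrite /upd; case: eqP => [->|//] /andP[h ->].
  by rewrite andbT ltW// (lt_le_trans am).
Qed.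

Lemma box_split_disj a b i :
  box a (upd b i (mid a b i)) `&` box (upd a i (mid a b i)) b = set0.
Proof.
apply/seteqP; split => // x [/(_ i) + /(_ i)]; rewrite /upd eqxx.
by move=> /andP[_ h] /andP[h' _]; have := lt_le_trans h h'; rewrite ltxx.
Qed.

Lemma le_leaves phi psi l a b : lt_box a b ->
  (forall a b, lt_box a b -> phi a b <= psi a b) ->
  leaves phi l a b <= leaves psi l a b.
Proof.
move=> + pp; elim: l a b => [|i l ih] a b ab /=; first exact: pp.
by rewrite lerD// ih//; [exact: lt_box_lo|exact: lt_box_hi].
Qed.

Lemma leavesD phi psi l a b : leaves (fun a b => phi a b + psi a b) l a b =
  leaves phi l a b + leaves psi l a b.
Proof. by elim: l a b => //= i l ih a b; rewrite !ih addrACA. Qed.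

Lemma leaves_cat phi l l' a b :
  leaves phi (l ++ l') a b = leaves (leaves phi l') l a b.
Proof. by elim: l a b => //= i l ih a b; rewrite !ih. Qed.

Lemma leaves_le_superadditive phi l a b : lt_box a b ->
  (forall a b i, lt_box a b -> phi a (upd b i (mid a b i)) +
     phi (upd a i (mid a b i)) b <= phi a b) ->
  leaves phi l a b <= phi a b.
Proof.
move=> + sup; elim: l a b => [//|i l ih] a b ab /=.
apply: le_trans (sup _ _ i ab); apply: lerD; apply: ih.
  exact: lt_box_lo.
exact: lt_box_hi.
Qed.

Lemma leaves_additive phi l a b : lt_box a b ->
  (forall a b i, lt_box a b -> phi a (upd b i (mid a b i)) +
     phi (upd a i (mid a b i)) b = phi a b) ->
  leaves phi l a b = phi a b.
Proof.
move=> + sup; elim: l a b => [//|i l ih] a b ab /=.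
by rewrite -(sup _ _ i ab) !ih//; [exact: lt_box_hi|exact: lt_box_lo].
Qed.

Lemma cvg_leaves (I : Type) (F : set_system I) (FF : Filter F)
  (P : ('I_d -> R) -> ('I_d -> R) -> Prop) phi_ phi l a b :
  (forall a b i, P a b -> P a (upd b i (mid a b i)) /\ P (upd a i (mid a b i)) b) ->
  (forall a b, P a b -> phi_ k a b @[k --> F] --> (phi a b : R)) -> P a b ->
  leaves (phi_ k) l a b @[k --> F] --> leaves phi l a b.
Proof.
move=> Ps cphi; elim: l a b => [|i l ih] a b Pab /=; first exact: cphi.
by have [P1 P2] := Ps _ _ i Pab; apply: cvgD; exact: ih.
Qed.

(** Each round cuts once along every direction, so [n] rounds divide all sides by [2 ^+ n]. *)
Definition rounds (n : nat) : seq 'I_d := flatten (nseq n (enum 'I_d)).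

Lemma count_rounds i n : count_mem i (rounds n) = n.
Proof.
rewrite /rounds count_flatten map_nseq sumn_nseq count_uniq_mem ?enum_uniq//.
by rewrite mem_enum mul1n.
Qed.

Lemma roundsD m n : rounds (m + n) = rounds m ++ rounds n.
Proof. by rewrite /rounds nseqD flatten_cat. Qed.

End bisection.

(** * Bisected boxes resolve every measurable set *)

Section bisection_density.
Context {R : realType} {d : nat}.
Local Notation E := 'rV[R]_d.
Variable mu : {measure set E -> \bar R}.
Variable z : E -> R.
Hypothesis iz : mu.-integrable setT (EFin \o z).
Implicit Types (a b : 'I_d -> R) (l : seq 'I_d).

Let mz : measurable_fun setT z.
Proof. by have /integrableP[/measurable_EFinP] := iz. Qed.

Let izA A : measurable A -> mu.-integrable A (EFin \o z).
Proof. by move=> mA; exact: integrableS iz. Qed.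

Let inz A : measurable A -> mu.-integrable A (EFin \o (fun x => `|z x|)).
Proof. by move=> mA; apply: (integrable_norm (izA mA)). Qed.

Let nu A : R := \int[mu]_(x in A) `|z x|.

Let nu_ge0 A : 0 <= nu A.
Proof. exact: Rintegral_ge0. Qed.

Let nuU A B : measurable A -> measurable B -> A `&` B = set0 ->
  nu (A `|` B) = nu A + nu B.
Proof.
move=> mA mB AB; rewrite /nu Rintegral_setU//.
- by apply: inz; exact: measurableU.
- by apply/disj_setPS; rewrite AB.
Qed.

Let le_nu A B : measurable A -> measurable B -> A `<=` B -> nu A <= nu B.
Proof.
move=> mA mB AB; rewrite -(setDUK AB) nuU ?lerDl//; first exact: measurableD.
by rewrite setDE setICA setICr setI0.
Qed.

Let nu0 : nu set0 = 0. Proof. exact: Rintegral_set0. Qed.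

Let nu_cvg0 (F : nat -> set E) : (forall n, measurable (F n)) ->
  (forall x, \forall n \near \oo, ~ F n x) -> nu (F n) @[n --> \oo] --> 0.
Proof.
move=> mF F0.
have := @bounded_cvg_Rintegral _ _ _ mu (fun x => `|z x|) (cst 0)
  (fun n => \1_(F n)) 1 (inz measurableT).
have -> : \int[mu]_x (`|z x| * cst 0 x) = 0.
  under eq_Rintegral do rewrite mulr0.
  by rewrite Rintegral_cst// mul0r.
have -> : (fun n => \int[mu]_x (`|z x| * \1_(F n) x)) = (fun n => nu (F n)).
  by apply/funext => n; rewrite Rintegral_indicM.
apply => [n|n x|x].
- exact: measurable_indic.
- by rewrite indicE; case: (_ \in _); rewrite ?normr1 ?normr0.
- apply: cvg_near_cst; apply: filterS (F0 x) => n Fx.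
  by rewrite indicE memNset.
Qed.

Let nu_split C a b i : measurable C -> lt_box a b ->
  nu (box a (upd b i (mid a b i)) `&` C) + nu (box (upd a i (mid a b i)) b `&` C)
    = nu (box a b `&` C).
Proof.
move=> mC ab; rewrite (box_split i ab) setIUl nuU//.
- by apply: measurableI => //; exact: measurable_box.
- by apply: measurableI => //; exact: measurable_box.
- by rewrite setIACA box_split_disj set0I.
Qed.

(** Measures how far the box is from lying on one side of [A], in the mass [nu]. Masses add under
    bisection and a minimum of sums dominates the sum of minima, so the total over the leaves only
    decreases under refinement. *)
Definition impurity (A : set E) a b : R :=
  Num.min (nu (box a b `&` A)) (nu (box a b `&` ~` A)).

Let impurity_super A a b i : measurable A -> lt_box a b ->
  impurity A a (upd b i (mid a b i)) + impurity A (upd a i (mid a b i)) b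
    <= impurity A a b.
Proof.
move=> mA ab; rewrite /impurity le_min -!(nu_split i _ ab)//; last exact: measurableC.
by apply/andP; split; apply: lerD; rewrite ge_min lexx ?orbT.
Qed.

Let leaves_rounds_le A a b m n : measurable A -> lt_box a b -> (m <= n)%N ->
  leaves (impurity A) (rounds n) a b <= leaves (impurity A) (rounds m) a b.
Proof.
move=> mA ab /subnKC <-; rewrite roundsD leaves_cat; apply: le_leaves => //.
move=> a' b' ab'; apply: leaves_le_superadditive => // *.
exact: impurity_super.
Qed.

(** These sets turn out to form a sigma-algebra containing the half-spaces, which gives all
    measurable sets. *)
Let pure a b (A : set E) : Prop := measurable A /\
  forall e, 0 < e -> exists n, leaves (impurity A) (rounds n) a b <= e.

Let pureC a b A : pure a b A -> pure a b (~` A).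
Proof.
move=> [mA pA]; split; first exact: measurableC.
suff -> : impurity (~` A) = impurity A by [].
by apply/funext => a'; apply/funext => b'; rewrite /impurity setCK minC.
Qed.

Let pure0 a b : lt_box a b -> pure a b set0.
Proof.
move=> ab; split=> // e e0; exists 0%N; rewrite (le_trans _ (ltW e0))//=.
by rewrite /impurity setI0 nu0 ge_min lexx.
Qed.

(** On each box the impurity of the union is at most the sum of the two impurities: either both
    minima are inner masses, which are subadditive, or one is an outer mass, which dominates the
    outer mass of the union. Refining up to [maxn m n] serves both sets. *)
Let pureU a b A B : lt_box a b -> pure a b A -> pure a b B -> pure a b (A `|` B).
Proof.
move=> ab [mA pA] [mB pB]; split; first exact: measurableU.
move=> e e0; have e20 : 0 < e / 2 by rewrite divr_gt0.
have [[m mP] [n nP]] := (pA _ e20, pB _ e20).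
exists (maxn m n).
have -> : e = e / 2 + e / 2 by rewrite -splitr.
apply: (@le_trans _ _ (leaves (impurity A) (rounds (maxn m n)) a b +
  leaves (impurity B) (rounds (maxn m n)) a b)); last first.
  apply: lerD; [apply: le_trans mP|apply: le_trans nP];
    apply: leaves_rounds_le => //; [exact: leq_maxl|exact: leq_maxr].
rewrite -leavesD; apply: le_leaves => // a' b' ab'.
have mb := measurable_box a' b'.
have mI C : measurable C -> measurable (box a' b' `&` C) by exact: measurableI.
have UC : nu (box a' b' `&` ~` (A `|` B)) <= nu (box a' b' `&` ~` A) /\
    nu (box a' b' `&` ~` (A `|` B)) <= nu (box a' b' `&` ~` B).
  split; apply: le_nu; try by apply: mI; apply: measurableC => //; exact: measurableU.
  - by move=> x [bx /not_orP[]].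
  - by move=> x [bx /not_orP[]].
have UI : nu (box a' b' `&` (A `|` B)) <= nu (box a' b' `&` A) + nu (box a' b' `&` B).
  have -> : box a' b' `&` (A `|` B) = (box a' b' `&` A) `|` (box a' b' `&` (B `\` A)).
    by rewrite -setIUr setUDr setDv setD0.
  have mBA : measurable (B `\` A) by exact: measurableD.
  rewrite nuU ?lerD2l; [|exact: mI|exact: mI|].
    by apply: le_nu; [exact: mI|exact: mI|apply: setIS; exact: subDsetl].
  by apply/seteqP; split => // x [[_ Ax] [_ []]].
rewrite /impurity.
move: UC UI (nu_ge0 (box a' b' `&` A)) (nu_ge0 (box a' b' `&` B))
  (nu_ge0 (box a' b' `&` ~` A)) (nu_ge0 (box a' b' `&` ~` B)) => [[]].
move: (nu _) (nu _) (nu _) (nu _) (nu _) (nu _) => u1 u2 u3 u4 u5 u6.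
rewrite /Num.min; do !case: ifP => ?; lra.
Qed.

(** A finite union [G N] misses a remainder [C N] of small mass. On each box, passing from [G N] to
    the full union raises the impurity by at most the mass of [C N] there, and these masses add up
    over the leaves. *)
Let pure_bigcup a b (F : nat -> set E) : lt_box a b ->
  (forall n, pure a b (F n)) -> pure a b (\bigcup_n F n).
Proof.
move=> ab pF.
have mF n : measurable (F n) by have [] := pF n.
have mUF : measurable (\bigcup_n F n) by exact: bigcupT_measurable.
split=> // e e0; have e20 : 0 < e / 2 by rewrite divr_gt0.
pose G n := \big[setU/set0]_(k < n) F k.
have pG n : pure a b (G n).
  rewrite /G; elim: n => [|n ih]; first by rewrite big_ord0; exact: pure0.
  by rewrite big_ord_recr/=; exact: pureU.
have mG n : measurable (G n) by have [] := pG n.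
pose C n := (\bigcup_n F n) `\` G n.
have mC n : measurable (C n) by exact: measurableD.
have Coo x : \forall n \near \oo, ~ C n x.
  have [[k _ Fk]|nF] := pselect ((\bigcup_n F n) x).
    exists k.+1 => // n /= kn [_]; apply; rewrite /G -bigcup_mkord.
    by exists k.
  by apply: nearW => n [].
have [N _ NC] := cvgr_le 0 (nu_cvg0 mC Coo) _ e20.
have [_ /(_ _ e20)[n nP]] := pG N.
exists n; have -> : e = e / 2 + e / 2 by rewrite -splitr.
apply: le_trans (lerD nP (NC N (leqnn N))).
have -> : leaves (impurity (G N)) (rounds n) a b + nu (C N) =
  leaves (impurity (G N)) (rounds n) a b + nu (box a b `&` C N) +
  (nu (C N) - nu (box a b `&` C N)) by ring.
apply: (@le_trans _ _ (leaves (impurity (G N)) (rounds n) a b + nu (box a b `&` C N))); last first.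
  rewrite lerDl subr_ge0; apply: le_nu => //.
  by apply: measurableI => //; exact: measurable_box.
rewrite -[nu (box a b `&` C N)](@leaves_additive _ _
  (fun a b => nu (box a b `&` C N)) (rounds n))//; last first.
  by move=> *; exact: nu_split.
rewrite -leavesD; apply: le_leaves => // a' b' ab'.
have mb := measurable_box a' b'.
have mI D : measurable D -> measurable (box a' b' `&` D) by exact: measurableI.
have GF : G N `<=` \bigcup_n F n.
  by rewrite /G -bigcup_mkord; apply: bigcup_sub => k _; exact: bigcup_sup.
have h1 : nu (box a' b' `&` \bigcup_n F n) = nu (box a' b' `&` G N) + nu (box a' b' `&` C N).
  rewrite -nuU; [|exact: mI (mG N)|exact: mI (mC N)|].
    by rewrite -setIUr /C setDUK.
  by apply/seteqP; split => // x [[_ Gx] [_ []]].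
have h2 : nu (box a' b' `&` ~` \bigcup_n F n) <= nu (box a' b' `&` ~` G N).
  apply: le_nu; [exact: mI (measurableC mUF)|exact: mI (measurableC (mG N))|].
  by apply: setIS; apply: subsetC.
rewrite /impurity h1; move: h2 (nu_ge0 (box a' b' `&` C N)).
move: (nu _) (nu _) (nu _) (nu _) => u1 u2 u3 u4.
by rewrite /Num.min; do !case: ifP => ?; lra.
Qed.

(** Half-open, so that strips of vanishing width shrink to the empty set even if the measure charges
    the hyperplane at [c]. *)
Let strip (i : 'I_d) (c w : R) : set E := [set x | x ord0 i \in `[c - w, c[].

Let measurable_strip i c w : measurable (strip i c w).
Proof. exact: measurable_coord_itv. Qed.

(** A leaf that meets the half-space has its outer part within one side length below [c]. The sides
    along [i] have all been divided by the same power of 2, so these parts lie in one common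
    strip. *)
Let impurity_half i c l a b : lt_box a b ->
  leaves (impurity [set x : E | x ord0 i \in `[c, +oo[]) l a b <=
  nu (box a b `&` strip i c ((b i - a i) / 2 ^+ count_mem i l)).
Proof.
set H := [set x : E | _].
have mH : measurable H by exact: measurable_coord_itv.
elim: l a b => [|j l ih] a b ab /=.
  rewrite expr0 divr1 /impurity.
  have mb := measurable_box a b.
  have [[x [bx Hx]]|nx] := pselect (exists x, (box a b `&` H) x); last first.
    have -> : box a b `&` H = set0.
      by apply/seteqP; split => // x Hx; apply: nx; exists x.
    by rewrite nu0 ge_min nu_ge0.
  rewrite ge_min; apply/orP; right; apply: le_nu.
  - by apply: measurableI => //; exact: measurableC.
  - exact: measurableI.
  - move=> y [by_ Hy]; split => //; move: Hx Hy; rewrite /H /strip /= !in_itv/= !andbT.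
    move=> cx /negP; rewrite -ltNge => yc; rewrite yc andbT.
    have /andP[_ h1] := bx i; have /andP[h2 _] := by_ i.
    by move: cx h1 h2; lra.
have w0 : (b i - a i) / 2 ^+ ((j == i) + count_mem i l) =
    (upd b j (mid a b j) i - a i) / 2 ^+ count_mem i l /\
    (b i - a i) / 2 ^+ ((j == i) + count_mem i l) =
    (b i - upd a j (mid a b j) i) / 2 ^+ count_mem i l.
  rewrite /upd eq_sym; case: eqP => [<-|_]; last by rewrite add0n.
  rewrite add1n exprS invfM /mid; split; rewrite mulrA; congr (_ * _); lra.
apply: le_trans (lerD (ih _ _ (lt_box_lo j ab)) (ih _ _ (lt_box_hi j ab))) _.
by rewrite -w0.1 -w0.2 nu_split.
Qed.

Let pure_half a b i c : lt_box a b ->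
  pure a b [set x : E | x ord0 i \in `[c, +oo[].
Proof.
move=> ab; split=> [|e e0]; first exact: measurable_coord_itv.
have s0 x : \forall n \near \oo, ~ strip i c ((b i - a i) / 2 ^+ n) x.
  have [cx|xc] := leP c (x ord0 i).
    by apply: nearW => n; rewrite /strip /= in_itv/= ltNge cx andbF.
  have : \forall n \near \oo, (b i - a i) / 2 ^+ n < c - x ord0 i.
    have : (b i - a i) / 2 ^+ n @[n --> \oo] --> (0 : R).
      rewrite -[X in _ --> X](mulr0 (b i - a i)); apply: cvgM; first exact: cvg_cst.
      under eq_fun do rewrite -exprVn.
      by apply: cvg_expr; rewrite gtr0_norm// invf_lt1// ltr1n.
    by move/(cvgr_lt 0); apply; rewrite subr_gt0.
  apply: filterS => n h; rewrite /strip /= in_itv/= => /andP[h1 h2].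
  by move: h h1; move: (_ / _) => r; lra.
have [n _ nP] := cvgr_le 0 (nu_cvg0 (fun n => measurable_strip i c _) s0) _ e0.
exists n; apply: le_trans (impurity_half i c (rounds n) ab) _.
rewrite count_rounds; apply: le_trans (nP n (leqnn n)).
apply: le_nu => //.
by apply: measurableI => //; exact: measurable_box.
Qed.

Let pure_measurable a b A : lt_box a b -> measurable A -> pure a b A.
Proof.
move=> ab; move: A.
have sa : sigma_algebra setT (pure a b).
  split; first exact: pure0.
  - by move=> A pA; rewrite setTD; exact: pureC.
  - by move=> F pF; exact: pure_bigcup.
apply: (_ : _ `<=` _).
rewrite {1}/measurable/= /g_sigma_preimage.
apply: smallest_sub => // C; rewrite -bigcup_seq/= => -[i _ [A mA <-]].
rewrite !setTI.
have : <<s @RGenCInfty.G R >> A 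
  by have : (@ocitv R).-sigma.-measurable A := mA; rewrite RGenCInfty.measurableE.
apply: (_ : _ `<=` [set A | pure a b ((fun v : E => v ord0 i) @^-1` A)]).
apply: smallest_sub.
  split; first by rewrite /= preimage_set0; exact: pure0.
  - by move=> B pB; rewrite setTD /= preimage_setC; exact: pureC.
  - by move=> F pF; rewrite /= preimage_bigcup; exact: pure_bigcup.
by move=> _ [c ->]; exact: pure_half.
Qed.

(** With [A] the set where [z] is positive, and [p], [q] the masses of a box inside and outside [A],
    the gap between [p + q] and [|p - q|] is twice the minimum of [p] and [q], that is twice the
    impurity. *)
Lemma bisection_dense a b : lt_box a b -> forall e, 0 < e -> exists n,
  \int[mu]_(x in box a b) `|z x| <=
  leaves (fun a b => `|\int[mu]_(x in box a b) z x|) (rounds n) a b + e.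
Proof.
move=> ab e e0; have e20 : 0 < e / 2 by rewrite divr_gt0.
pose A : set E := [set x | 0 < z x].
have mA : measurable A.
  rewrite (_ : A = z @^-1` `]0, +oo[); last first.
    by apply/seteqP; split => x /=; rewrite in_itv/= andbT.
  by rewrite -[X in measurable X]setTI; apply: mz.
have [_ /(_ _ e20)[n nP]] := pure_measurable ab mA.
exists n.
have -> : \int[mu]_(x in box a b) `|z x| =
    leaves (fun a b => nu (box a b `&` setT)) (rounds n) a b.
  rewrite leaves_additive//; first by rewrite setIT.
  by move=> *; exact: nu_split.
apply: (@le_trans _ _ (leaves (fun a b => `|\int[mu]_(x in box a b) z x|) (rounds n) a b
  + (leaves (impurity A) (rounds n) a b + leaves (impurity A) (rounds n) a b))); last first.
  by rewrite lerD2l [leRHS]splitr lerD.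
rewrite -!leavesD; apply: le_leaves => // a' b' ab'.
have mb := measurable_box a' b'.
have mI D : measurable D -> measurable (box a' b' `&` D) by exact: measurableI.
have mAC := measurableC mA.
have e1 : box a' b' = (box a' b' `&` A) `|` (box a' b' `&` ~` A).
  by rewrite -setIUr setUv setIT.
have disj : (box a' b' `&` A) `&` (box a' b' `&` ~` A) = set0.
  by rewrite setIACA setICr setI0.
have zE : \int[mu]_(x in box a' b') z x =
    nu (box a' b' `&` A) - nu (box a' b' `&` ~` A).
  rewrite {1}e1 (Rintegral_setU (mI _ mA) (mI _ mAC)); last 2 first.
  - by rewrite -e1; exact: izA.
  - by apply/disj_setPS; rewrite disj.
  congr (_ + _).
    by apply: eq_Rintegral => x; rewrite inE => -[_ Ax]; rewrite gtr0_norm.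
  rewrite -[RHS]mulN1r /nu -RintegralZl//; [|exact: (mI _ mAC)|exact: (inz (mI _ mAC))].
  apply: eq_Rintegral => x; rewrite inE => -[_ /negP]; rewrite -leNgt => Ax.
  by rewrite ler0_norm// mulN1r opprK.
have nuE : nu (box a' b' `&` setT) = nu (box a' b' `&` A) + nu (box a' b' `&` ~` A).
  by rewrite setIT {1}e1 (nuU (mI _ mA) (mI _ mAC)).
rewrite nuE zE /impurity; move: (nu_ge0 (box a' b' `&` A)) (nu_ge0 (box a' b' `&` ~` A)).
move: (nu _) (nu _) => u1 u2 h1 h2; rewrite /Num.min; case: ltP => h.
  by rewrite ltr0_norm ?subr_lt0//; lra.
by rewrite ger0_norm ?subr_ge0//; lra.
Qed.

End bisection_density.

(** * Poincare inequality on boxes *)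

Section poincare.
Context {R : realType} {d : nat}.
Local Notation E := 'rV[R]_d.
Variable mu : {measure set E -> \bar R}.
Variables (z : E -> R) (g : 'I_d -> E -> R).
Hypothesis iz : mu.-integrable setT (EFin \o z).
Hypothesis ig : forall i, mu.-integrable setT (EFin \o g i).
Variable P : ('I_d -> R) -> ('I_d -> R) -> Prop.
Hypothesis P_lt : forall a b, P a b -> lt_box a b.
Hypothesis P_half : forall a b i, P a b ->
  P a (upd b i (mid a b i)) /\ P (upd a i (mid a b i)) b.
Hypothesis z_split : forall a b i, P a b ->
  `|\int[mu]_(x in box a (upd b i (mid a b i))) z x -
    \int[mu]_(x in box (upd a i (mid a b i)) b) z x| <=
  (b i - a i) * \int[mu]_(x in box a b) `|g i x|.
Implicit Types (a b : 'I_d -> R).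

Lemma Rintegral_box_split (f : E -> R) a b i :
  mu.-integrable setT (EFin \o f) -> lt_box a b ->
  \int[mu]_(x in box a b) f x = \int[mu]_(x in box a (upd b i (mid a b i))) f x +
    \int[mu]_(x in box (upd a i (mid a b i)) b) f x.
Proof.
move=> if_ ab; rewrite {1}(box_split i ab) Rintegral_setU//.
- exact: measurable_box.
- exact: measurable_box.
- by apply: integrableS if_ => //; apply: measurableU; exact: measurable_box.
- by apply/disj_setPS; rewrite box_split_disj.
Qed.

(** Acts as a potential: by [var_split], one cut along [i] turns [var [::]] into [var [:: i]], and
    the drop is exactly the cost of that cut allowed by [z_split]. The factor 2 makes this balance
    hold. *)
Let var l a b := \sum_i 2 * ((b i - a i) / 2 ^+ count_mem i l) *
  \int[mu]_(x in box a b) `|g i x|.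

Let side_lo l a b i j :
  (upd b i (mid a b i) j - a j) / 2 ^+ count_mem j l =
  (b j - a j) / 2 ^+ count_mem j (i :: l).
Proof.
rewrite /upd /= [in RHS]eq_sym; case: eqP => [->|_]; last by rewrite add0n.
by rewrite add1n exprS invfM /mid mulrA; congr (_ * _); lra.
Qed.

Let side_hi l a b i j :
  (b j - upd a i (mid a b i) j) / 2 ^+ count_mem j l =
  (b j - a j) / 2 ^+ count_mem j (i :: l).
Proof.
rewrite /upd /= [in RHS]eq_sym; case: eqP => [->|_]; last by rewrite add0n.
by rewrite add1n exprS invfM /mid mulrA; congr (_ * _); lra.
Qed.

Let var_split l a b i : lt_box a b ->
  var l a (upd b i (mid a b i)) + var l (upd a i (mid a b i)) b = var (i :: l) a b.
Proof.
move=> ab; rewrite /var -big_split/=; apply: eq_bigr => j _.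
rewrite side_lo side_hi -mulrDr -Rintegral_box_split//.
exact: (integrable_norm (ig j)).
Qed.

Let leaves_le l a b : P a b ->
  leaves (fun a b => `|\int[mu]_(x in box a b) z x|) l a b <=
  `|\int[mu]_(x in box a b) z x| + var [::] a b.
Proof.
have var0 a' b' : P a' b' -> 0 <= var [::] a' b'.
  move=> /P_lt ab; apply: sumr_ge0 => i _.
  rewrite mulr_ge0 ?Rintegral_ge0// mulr_ge0// divr_ge0// ?exprn_ge0//.
  by rewrite subr_ge0 ltW.
elim: l a b => [|i l ih] a b ab; first by rewrite lerDl var0.
have [P1 P2] := P_half i ab; have lab := P_lt ab.
apply: le_trans (lerD (ih _ _ P1) (ih _ _ P2)) _.
rewrite addrACA (var_split [::] i lab).
have := z_split i ab; rewrite (Rintegral_box_split i iz lab).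
set I1 := \int[mu]_(x in _) z x; set I2 := \int[mu]_(x in _) z x => h.
(* The left side is the larger of [|I1 + I2|] and [|I1 - I2|]; the hypothesis [h] bounds the
   difference. *)
have h2 : `|I1| + `|I2| <= `|I1 + I2| + `|I1 - I2|.
  have := ler_norm (I1 + I2); have := ler_norm (I1 - I2).
  have := ler_norm (- (I1 + I2)); have := ler_norm (- (I1 - I2)).
  rewrite !normrN; move: `|I1 + I2| `|I1 - I2| => s t.
  by case: (ger0P I1) => _; case: (ger0P I2) => _; lra.
have -> : var [::] a b = var [:: i] a b + (b i - a i) * \int[mu]_(x in box a b) `|g i x|.
  rewrite /var (bigD1 i)//= [in RHS](bigD1 i)//= eqxx.
  rewrite [X in _ + X](eq_bigr (fun j => 2 * ((b j - a j) / 2 ^+ ((i == j) + 0)) *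
     \int[mu]_(x in box a b) `|g j x|)); last first.
    by move=> j ji; rewrite eq_sym (negbTE ji).
  by rewrite expr0 expr1; lra.
by rewrite addrA; lra.
Qed.

Lemma poincare_box a b : P a b ->
  \int[mu]_(x in box a b) `|z x| <= `|\int[mu]_(x in box a b) z x| +
    \sum_i 2 * (b i - a i) * \int[mu]_(x in box a b) `|g i x|.
Proof.
move=> ab; apply/ler_addgt0Pr => e e0.
have [n /le_trans] := bisection_dense iz (P_lt ab) e0; apply.
rewrite lerD2r; apply: le_trans (leaves_le _ ab) _.
by rewrite /var; under eq_bigr do rewrite expr0 divr1.
Qed.

(** The Poincare bound is applied on every leaf, where the sides are already small; the gradient
    term thereby gains a factor as small as desired. *)
Lemma poincare_leaves l a b : P a b ->
  \int[mu]_(x in box a b) `|z x| <=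
  leaves (fun a b => `|\int[mu]_(x in box a b) z x|) l a b +
  \sum_i 2 * ((b i - a i) / 2 ^+ count_mem i l) *
    \int[mu]_(x in box a b) `|g i x|.
Proof.
rewrite -/(var l a b); elim: l a b => [|i l ih] a b ab.
  apply: le_trans (poincare_box ab) _.
  by rewrite /var; under [in leRHS]eq_bigr do rewrite expr0 divr1.
have [P1 P2] := P_half i ab; have lab := P_lt ab.
rewrite (Rintegral_box_split i (integrable_norm iz) lab) -var_split//=.
by rewrite addrACA lerD// ih.
Qed.

End poincare.

(** * From box integrals to almost everywhere statements *)

Section almost_everywhere.
Context {R : realType} {d : nat} {Omega : set 'rV[R]_d} (oOmega : open Omega).
Local Notation E := 'rV[R]_d.
Local Notation mu := (lebesgue_on oOmega).

Lemma ae_mem_Omega : {ae mu, forall x, Omega x}.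
Proof.
have mO := measurable_open_rV oOmega.
exists (~` Omega); split; first exact: measurableC.
  by rewrite /= /mrestr setICl measure0.
by [].
Qed.

Lemma ae_eq0_of_Rintegral (f : E -> R) A : measurable A ->
  mu.-integrable setT (EFin \o f) -> (forall x, 0 <= f x) ->
  \int[mu]_(x in A) f x = 0 -> {ae mu, forall x, A x -> f x = 0}.
Proof.
move=> mA if_ f0 h.
have ifA : mu.-integrable A (EFin \o f) by exact: integrableS if_.
have : (\int[mu]_(x in A) `|(EFin \o f) x| = 0)%E.
  rewrite -[RHS]/(0%:E) -h /Rintegral fineK; last exact: integrable_fin_num.
  by apply: eq_integral => x _; rewrite /= ger0_norm.
have /integrableP[mf _] := ifA.
move=> /(ae_eq_integral_abs mu mA mf).1; apply: filterS => x fx Ax.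
by have /(_ Ax) [] := fx.
Qed.

Lemma good_box_cover (x : E) : Omega x -> exists q : 'rV[rat]_d, exists k : nat,
  let a i := ratr (q ord0 i) - k.+1%:R^-1 : R in
  let b i := ratr (q ord0 i) + k.+1%:R^-1 : R in
  [/\ good_box Omega a b, lt_box a b & box a b x].
Proof.
move=> Ox; have /nbhs_ballP[e /= e0 eO] := open_nbhs_nbhs (conj oOmega Ox).
have e40 : 0 < e / 4 by rewrite divr_gt0.
(* A point of the box enlarged by the margin [r] is within [3 * r] of [x], so [r < e / 4] keeps it
   in the ball. *)
have [k _ kP] := near_inv_lt e40.
have {kP} := kP k (leqnn k); set r := k.+1%:R^-1 => re.
have r0 : 0 < r by rewrite invr_gt0 ltr0n.
have hq i : exists q : rat, `|x ord0 i - ratr q| < r.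
  have := @dense_rat R (ball (x ord0 i) r).
  case; [by exists (x ord0 i); exact: ballxx|exact: ball_open|].
  by move=> y [bx [q _ qx]]; exists q; rewrite qx; exact: bx.
have [q qP] := choice hq.
exists (\row_i q i), k; rewrite /= -/r; split.
- exists r => // y yab; apply: eO; split => // i j.
  rewrite (ord1 i) /ball/=; have := yab j; have := qP j; rewrite !mxE.
  by rewrite ltr_norml => /andP[h1 h2] /andP[h3 h4]; rewrite ltr_norml; lra.
- by move=> i; lra.
- move=> i; rewrite mxE; have := qP i; rewrite ltr_norml; lra.
Qed.

(** Boxes with rational centre and half-side [k.+1%:R^-1] already cover the open set, so only
    countably many null sets are involved. *)
Lemma ae_good_boxes (Q : E -> Prop) :
  (forall a b, good_box Omega a b -> lt_box a b ->
     {ae mu, forall x, box a b x -> Q x}) -> {ae mu, forall x, Q x}.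
Proof.
move=> h.
pose lo (p : 'rV[rat]_d * nat) i : R := ratr (p.1 ord0 i) - p.2.+1%:R^-1.
pose hi (p : 'rV[rat]_d * nat) i : R := ratr (p.1 ord0 i) + p.2.+1%:R^-1.
pose S n x := forall p, unpickle n = Some p -> good_box Omega (lo p) (hi p) ->
  lt_box (lo p) (hi p) -> box (lo p) (hi p) x -> Q x.
have : {ae mu, forall x n, S n x}.
  apply/ae_foralln => n; rewrite /S.
  case: (unpickle n) => [p|]; last by apply: aeW.
  have [gp|ngp] := pselect (good_box Omega (lo p) (hi p)); last first.
    by apply: aeW => x _ [<-] /ngp.
  have [lp|nlp] := pselect (lt_box (lo p) (hi p)); last first.
    by apply: aeW => x _ [<-] _ /nlp.
  by apply: filterS (h _ _ gp lp) => x bx _ [<-].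
apply: filterS2 ae_mem_Omega => x /good_box_cover[q [k [gb lb bx]]] Sx.
by apply: (Sx (pickle (q, k)) (q, k)) => //; rewrite pickleK.
Qed.

Lemma ae_eq0_good_boxes (f : E -> R) :
  mu.-integrable setT (EFin \o f) -> (forall x, 0 <= f x) ->
  (forall a b, good_box Omega a b -> lt_box a b -> \int[mu]_(x in box a b) f x = 0) ->
  {ae mu, forall x, f x = 0}.
Proof.
move=> if_ f0 h; apply: ae_good_boxes => a b gab ab.
by apply: ae_eq0_of_Rintegral => //; [exact: measurable_box|exact: h].
Qed.

Lemma good_box_lo a b i : good_box Omega a b -> lt_box a b ->
  good_box Omega a (upd b i (mid a b i)).
Proof.
move=> gab ab; apply: good_box_sub gab => // j.
by rewrite /upd; case: eqP => // ->; have /andP[_ /ltW] := mid_itv (ab i).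
Qed.

Lemma good_box_hi a b i : good_box Omega a b -> lt_box a b ->
  good_box Omega (upd a i (mid a b i)) b.
Proof.
move=> gab ab; apply: good_box_sub gab => // j.
by rewrite /upd; case: eqP => // ->; have /andP[/ltW] := mid_itv (ab i).
Qed.

Lemma good_lt_box_half a b i : good_box Omega a b /\ lt_box a b ->
  (good_box Omega a (upd b i (mid a b i)) /\ lt_box a (upd b i (mid a b i))) /\
  (good_box Omega (upd a i (mid a b i)) b /\ lt_box (upd a i (mid a b i)) b).
Proof.
move=> [gab ab]; split; split; [exact: good_box_lo|exact: lt_box_lo|
  exact: good_box_hi|exact: lt_box_hi].
Qed.

Lemma ae_eq0_of_box_integrals (z : E -> R) : mu.-integrable setT (EFin \o z) ->
  (forall a b, good_box Omega a b -> lt_box a b -> \int[mu]_(x in box a b) z x = 0) ->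
  {ae mu, forall x, z x = 0}.
Proof.
move=> iz z0.
have : {ae mu, forall x, `|z x| = 0}.
  apply: ae_eq0_good_boxes => // [|a b gab ab]; first exact: (integrable_norm iz).
  apply/eqP; rewrite eq_le Rintegral_ge0// andbT.
  apply/ler_addgt0Pr => e e0.
  have [n] := bisection_dense iz ab e0; move/le_trans; apply.
  rewrite lerD2r.
  elim: (rounds n) a b gab ab => [|i l ih] a b gab ab /=; first by rewrite z0// normr0.
  rewrite -[leRHS](addr0 0); apply: lerD; apply: ih.
  - exact: good_box_lo.
  - exact: lt_box_lo.
  - exact: good_box_hi.
  - exact: lt_box_hi.
by apply: filterS => x /eqP; rewrite normr_eq0 => /eqP.
Qed.

End almost_everywhere.

(** * The Hilbert space H^1 *)

Section sobolev_space.
Context {R : realType} {d : nat} {Omega : set 'rV[R]_d} (oOmega : open Omega).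
Hypothesis Omega_bounded : bounded_set Omega.
Local Notation mu := (lebesgue_on oOmega).
Local Notation L2 := (L2space mu).
Local Notation H := (H1 oOmega).
Let mu_fin := lebesgue_on_finite oOmega Omega_bounded.
Let dotP := L2dot_form mu.

Lemma test_function_L2dot phi : test_function Omega phi ->
  exists p : L2, forall u : L2, \int[mu]_x (u x * phi x) = L2dot u p.
Proof.
move=> tphi.
have phi2 := test_function_L2 oOmega tphi.
have mphi : measurable_fun setT phi.
  by case: tphi => s _ _; apply: measurable_continuous_rV; exact: (s 0%N).
have [p pE] : exists p : L2, {ae mu, forall x, p x = phi x}.
  apply: L2_of_fun => //.
  by apply/Lfun1_integrable/(@Lfun2_mul_Lfun1 _ _ _ _ phi phi).
exists p => u; have mu' := L2_measurable u; have mp := L2_measurable p.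
apply: ae_Rintegral => //; [exact: measurable_funM|exact: measurable_funM|].
by apply: filterS pE => x ->.
Qed.

(** Representing the test integrals by inner products turns the relation into one that is visibly
    linear and closed under [L^2] limits; linearity and the completeness of [H^1] rest on this
    form. *)
Lemma weak_partial_dot i (u g : L2) : weak_partial i u g <->
  forall phi, test_function Omega phi -> forall p q : L2,
    (forall u : L2, \int[mu]_x (u x * phi x) = L2dot u p) ->
    (forall u : L2, \int[mu]_x (u x * 'D_(basis_rv i) phi x) = L2dot u q) ->
    L2dot u q = - L2dot g p.
Proof.
split=> [ug phi tphi p q pE qE|h phi tphi].
  by rewrite -pE -qE; exact: ug.
have [p pE] := test_function_L2dot tphi.
have [q qE] := test_function_L2dot (test_function_partial i tphi).
by rewrite pE qE; exact: (h phi tphi p q pE qE).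
Qed.

Lemma weak_partial_linear i a (u g v h : L2) : weak_partial i u g ->
  weak_partial i v h -> weak_partial i (a *: u + v) (a *: g + h).
Proof.
move=> /weak_partial_dot ug /weak_partial_dot vh; apply/weak_partial_dot.
move=> phi tphi p q pE qE; have [_ lin _] := dotP.
by rewrite !lin (ug _ tphi p q)// (vh _ tphi p q)//; ring.
Qed.

(** The difference is a weak derivative of 0, so it is orthogonal to all test functions and its box
    integrals vanish. *)
Lemma weak_partial_unique i (u g h : L2) : weak_partial i u g ->
  weak_partial i u h -> g = h.
Proof.
move=> ug uh; apply/eqP; rewrite -subr_eq0; apply/eqP.
have := weak_partial_linear (-1) uh ug; rewrite !scaleN1r !addNr addrC => w0.
have z0 : {ae mu, forall x, (g - h : L2) x = 0}.
  apply: ae_eq0_of_box_integrals; first exact: (L2_integrable mu_fin).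
  move=> a b gab _; apply: (Rintegral_box0 Omega_bounded) gab => phi tphi.
  have := w0 _ tphi.
  have [q qE] := test_function_L2dot (test_function_partial i tphi).
  by rewrite qE form0l// => /eqP; rewrite eq_sym oppr_eq0 => /eqP.
by apply: L2_ext; apply: filterS2 z0 (L2_zeroE mu) => x -> ->.
Qed.

Lemma weak_derivP i (u : H) : weak_partial i u (weak_deriv i u).
Proof.
have /asboolP /(_ i) [g ug] := H1valP u.
exact: (@xgetPex _ 0 [set g | weak_partial i u g] (ex_intro _ g ug)).
Qed.

Lemma weak_derivE i (u : H) g : weak_partial i u g -> weak_deriv i u = g.
Proof. by move=> ug; exact: weak_partial_unique (weak_derivP i u) ug. Qed.

Lemma H1val_linear : linear (@H1val R d Omega oOmega).
Proof. by move=> a u v. Qed.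

Lemma weak_deriv_linear i : linear (@weak_deriv R d Omega oOmega i).
Proof.
move=> a u v; apply: weak_derivE; rewrite H1val_linear.
by apply: weak_partial_linear; exact: weak_derivP.
Qed.

Definition H1dot (u v : H) : R :=
  L2dot (H1val u) (H1val v) + \sum_(i < d) L2dot (weak_deriv i u) (weak_deriv i v).

Lemma H1dot_form : psd_form H1dot.
Proof.
apply: psd_form_add; first exact: (psd_form_comp H1val_linear dotP).
by apply: psd_form_sum => i; exact: (psd_form_comp (weak_deriv_linear i) dotP).
Qed.

Lemma H1norm_sqr (u : H) : H1norm u ^+ 2 = H1dot u u.
Proof.
rewrite /H1norm sqr_sqrtr; last first.
  by rewrite addr_ge0 ?sqr_ge0// sumr_ge0// => i _; rewrite sqr_ge0.
by rewrite L2norm_sqr; congr (_ + _); apply: eq_bigr => i _; rewrite L2norm_sqr.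
Qed.

Lemma L2dot_le_H1dot (u : H) : L2dot (H1val u) (H1val u) <= H1dot u u.
Proof.
by rewrite lerDl sumr_ge0// => i _; case: dotP.
Qed.

Lemma weak_deriv_le_H1dot i (u : H) :
  L2dot (weak_deriv i u) (weak_deriv i u) <= H1dot u u.
Proof.
have [_ _ d0] := dotP.
rewrite /H1dot (bigD1 i)//= addrCA lerDl; apply: addr_ge0 => //.
by apply: sumr_ge0 => j _; exact: d0.
Qed.

Let L2dot_cvg (u : nat -> L2) l p :
  (forall e, 0 < e -> exists N, forall n, (N <= n)%N ->
     L2dot (u n - l) (u n - l) <= e) ->
  L2dot (u n) p @[n --> \oo] --> L2dot l p.
Proof.
move=> ul; apply/cvgrPdist_le => e e0.
have pp : 0 <= L2dot p p by case: dotP.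
have e1 : 0 < e ^+ 2 / (L2dot p p + 1) by rewrite divr_gt0 ?exprn_gt0// ltr_pwDr.
have [N NP] := ul _ e1; exists N => // n /= /NP.
rewrite ler_pdivlMr ?ltr_pwDr// => h.
rewrite distrC -(formBl dotP) -(@ler_pXn2r _ 2)// ?nnegrE ?(ltW e0)//.
rewrite real_normK ?num_real//.
apply: le_trans (form_cauchy_schwarz dotP _ _) _.
apply: le_trans h; apply: ler_wpM2l; first by case: dotP.
by rewrite lerDl.
Qed.

Lemma H1_eq_box (u v : H) :
  (forall a b, good_box Omega a b -> lt_box a b ->
     \int[mu]_(x in box a b) u x = \int[mu]_(x in box a b) v x) -> u = v.
Proof.
move=> uv; apply: val_inj; apply: L2_ext => /=.
have iu := L2_integrable mu_fin (H1val u); have iv := L2_integrable mu_fin (H1val v).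
have : {ae mu, forall x, H1val u x - H1val v x = 0}.
  apply: ae_eq0_of_box_integrals.
    rewrite (_ : _ \o _ = (fun x => (u x)%:E - (v x)%:E)%E)//.
    exact: integrableB.
  move=> a b gab ab; have mb := measurable_box a b.
  rewrite RintegralB//; [|exact: integrableS iu|exact: integrableS iv].
  by rewrite uv// subrr.
by apply: filterS => x /eqP; rewrite subr_eq0 => /eqP.
Qed.

(** The function and its derivatives converge separately in [L^2], and the weak derivative relation
    passes to the limit. *)
Lemma H1_complete : complete_form H1dot.
Proof.
move=> u uC.
have [|l lP] := L2_complete mu_fin (u := fun n => H1val (u n)).
  move=> e /uC[N NP]; exists N => m n Nm Nn.
  by apply: le_trans (NP m n Nm Nn); exact: (L2dot_le_H1dot (u m - u n)).
have wsub i m n : weak_deriv i (u m - u n) = weak_deriv i (u m) - weak_deriv i (u n).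
  have := weak_deriv_linear i (-1) (u n) (u m).
  by rewrite !scaleN1r ![- _ + _]addrC.
have gex i : exists g : L2, forall e, 0 < e -> exists N, forall n, (N <= n)%N ->
    L2dot (weak_deriv i (u n) - g) (weak_deriv i (u n) - g) <= e.
  apply: (L2_complete mu_fin (u := fun n => weak_deriv i (u n))).
  move=> e /uC[N NP]; exists N => m n Nm Nn.
  by apply: le_trans (NP m n Nm Nn); rewrite -wsub; exact: weak_deriv_le_H1dot.
have [g gP] := choice gex.
have wg i : weak_partial i l (g i).
  apply/weak_partial_dot => phi tphi p q pE qE.
  apply: cvg_unique (L2dot_cvg lP) _ => //.
  have -> : (fun n => L2dot (H1val (u n)) q) = (fun n => - L2dot (weak_deriv i (u n)) p).
    apply/funext => n; have /weak_partial_dot h := weak_derivP i (u n).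
    exact: (h phi).
  by apply: cvgN; exact: L2dot_cvg (gP i).
have lW : l \in weakly_differentiable (oOmega := oOmega).
  by apply/asboolP => i; exists (g i); exact: wg.
pose L : H := MkH1 lW.
have gL i : weak_deriv i L = g i by apply: weak_derivE; exact: wg.
have LE n : H1dot (u n - L) (u n - L) = L2dot (H1val (u n) - l) (H1val (u n) - l) +
    \sum_(i < d) L2dot (weak_deriv i (u n) - g i) (weak_deriv i (u n) - g i).
  congr (_ + _); apply: eq_bigr => i _.
  have := weak_deriv_linear i (-1) L (u n).
  by rewrite !scaleN1r ![- _ + _]addrC gL => ->.
exists L => e e0.
(* One equal share for the function and one for each of the [d] derivatives. *)
have e1 : 0 < e / (d.+1)%:R by rewrite divr_gt0// ltr0n.
have [N NP] := lP _ e1.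
have Nex i := gP i _ e1; have [N' N'P] := choice Nex.
exists (maxn N (\max_i N' i)) => n nN; rewrite LE.
have -> : e = e / d.+1%:R + \sum_(i < d) e / d.+1%:R.
  by rewrite sumr_const card_ord -mulrS -[RHS]mulr_natr divfK// pnatr_eq0.
apply: lerD; first by apply: NP; rewrite (leq_trans _ nN)// leq_maxl.
apply: ler_sum => i _; apply: N'P; rewrite (leq_trans _ nN)// leq_max.
by apply/orP; right; exact: leq_bigmax.
Qed.

Definition Hdot (w w' : H * H) : R := H1dot w.1 w'.1 + H1dot w.2 w'.2.

Lemma Hdot_form : psd_form Hdot.
Proof.
by apply: psd_form_add; apply: psd_form_comp H1dot_form => a x y.
Qed.

Lemma L2dot_le_Hdot1 (x : H * H) : L2dot (H1val x.1) (H1val x.1) <= Hdot x x.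
Proof.
apply: le_trans (L2dot_le_H1dot x.1) _; rewrite /Hdot lerDl.
by case: H1dot_form.
Qed.

Lemma L2dot_le_Hdot2 (x : H * H) : L2dot (H1val x.2) (H1val x.2) <= Hdot x x.
Proof.
apply: le_trans (L2dot_le_H1dot x.2) _; rewrite /Hdot lerDr.
by case: H1dot_form.
Qed.

Lemma H1pair_norm_sqr (w : H * H) : H1pair_norm w ^+ 2 = Hdot w w.
Proof.
rewrite /H1pair_norm sqr_sqrtr; last by rewrite addr_ge0 ?sqr_ge0.
by congr (_ + _); exact: H1norm_sqr.
Qed.

Lemma Hdot_complete : complete_form Hdot.
Proof.
have [_ _ d0] := H1dot_form.
move=> w wC.
have [u uP] : exists u : H, forall e, 0 < e -> exists N, forall n, (N <= n)%N ->
    H1dot ((w n).1 - u) ((w n).1 - u) <= e.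
  apply: (H1_complete (u := fun n => (w n).1)); move=> e /wC[N NP]; exists N => m n Nm Nn.
  by apply: le_trans (NP m n Nm Nn); rewrite /Hdot/= lerDl.
have [v vP] : exists v : H, forall e, 0 < e -> exists N, forall n, (N <= n)%N ->
    H1dot ((w n).2 - v) ((w n).2 - v) <= e.
  apply: (H1_complete (u := fun n => (w n).2)); move=> e /wC[N NP]; exists N => m n Nm Nn.
  by apply: le_trans (NP m n Nm Nn); rewrite /Hdot/= lerDr.
exists (u, v) => e e0; have e20 : 0 < e / 2 by rewrite divr_gt0.
have [[N NP] [M MP]] := (uP _ e20, vP _ e20).
exists (maxn N M) => n; rewrite geq_max => /andP[/NP h1 /MP h2].
rewrite /Hdot [leRHS]splitr; exact: (lerD h1 h2).
Qed.

End sobolev_space.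

(** * Weak limits along a filter *)

Section weak_limit.
Context {R : realType} (X : lmodType R).
Variables (b : X -> X -> R) (f : X -> R) (c : R) (w : nat -> X) (M : R).
Variable U : set_system nat.
Context {UP : ProperFilter U}.
Hypothesis bP : psd_form b.
Hypothesis b_complete : complete_form b.
Hypothesis c_gt0 : 0 < c.
Hypothesis f_ge0 : forall x, 0 <= f x.
Hypothesis f_midpoint : forall x y,
  f (2^-1 *: (x + y)) <= 2^-1 * f x + 2^-1 * f y - c * b (x - y) (x - y).
Hypothesis f_lsc : forall x e, 0 < e -> exists2 r, 0 < r &
  forall y, b (y - x) (y - x) <= r -> f x <= f y + e.
Hypothesis f_bounded : forall k, f (w k) <= M.

(** Replaces the convex hull: the arguments below need stability under midpoints only. *)
Inductive midpoint_hull (S : set nat) : X -> Prop :=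
| hull_in k : S k -> midpoint_hull S (w k)
| hull_mid x y : midpoint_hull S x -> midpoint_hull S y ->
    midpoint_hull S (2^-1 *: (x + y)).

Lemma sub_midpoint_hull S S' x : S `<=` S' -> midpoint_hull S x -> midpoint_hull S' x.
Proof.
move=> SS'; elim=> [k /SS'|y z _ hy _ hz]; first exact: hull_in.
exact: hull_mid.
Qed.

Let bounds : set R := [set r | exists2 S, U S & forall p, midpoint_hull S p -> r <= f p].
Let m := sup bounds.

Let bounds_ub r : (forall k, f (w k) <= r) -> ubound bounds r.
Proof.
move=> fr s [S US Ss]; have [k Sk] := filter_ex US.
by apply: le_trans (fr k); apply: Ss; exact: hull_in.
Qed.

Let has_sup_bounds : has_sup bounds.
Proof.
split; last by exists M; exact: bounds_ub.
by exists 0, setT => //; exact: filterT.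
Qed.

Let m_le r : (forall k, f (w k) <= r) -> m <= r.
Proof.
move=> fr; apply: ge_sup; first by case: has_sup_bounds.
exact: bounds_ub.
Qed.

Let m_lower e : 0 < e -> exists2 S, U S & forall p, midpoint_hull S p -> m - e <= f p.
Proof.
move=> e0; have [r [S US Sr] mr] := sup_adherent e0 has_sup_bounds.
by exists S => // p /Sr; apply: le_trans; exact: ltW.
Qed.

Let m_upper S e : U S -> 0 < e -> exists2 p, midpoint_hull S p & f p <= m + e.
Proof.
move=> US e0; apply: contrapT => h.
suff : m + e <= m by rewrite gerDl leNgt e0.
apply: ub_le_sup; first by case: has_sup_bounds.
exists S => // p Sp; rewrite leNgt; apply/negP => fp; apply: h.
by exists p => //; exact: ltW.
Qed.

Let eps n : R := n.+1%:R^-1.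
Let eps_gt0 n : 0 < eps n. Proof. by rewrite invr_gt0 ltr0n. Qed.
Let le_eps p n : (n <= p)%N -> eps p <= eps n.
Proof. by move=> np; rewrite /eps lef_pV2 ?posrE ?ltr0n// ler_nat. Qed.
Let eps_small e : 0 < e -> exists n, eps n <= e.
Proof.
by move=> e0; have [n _ /(_ n (leqnn n)) /ltW] := near_inv_lt e0; exists n.
Qed.

(** Stands in for weak compactness together with weak lower semicontinuity: [x] is built as a strong
    limit of almost minimizers, and it is a weak limit only against the functionals whose values
    along [U] are known to converge. *)
Lemma exists_weak_limit : exists x,
  [/\ forall r, (forall k, f (w k) <= r) -> f x <= r,
      forall (L : X -> R) (l : R), (forall a x y, L (a *: x + y) = a * L x + L y) ->
        (exists K, forall y, L y ^+ 2 <= K * b y y) ->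
        L (w k) @[k --> U] --> l -> L x = l &
      (forall k, f (w k) <= f x) -> forall e, 0 < e ->
        U [set k | b (w k - x) (w k - x) <= e]].
Proof.
have Tex n : exists S, U S /\ forall p, midpoint_hull S p -> m - eps n <= f p.
  by have [S US Sm] := m_lower (eps_gt0 n); exists S.
have [T TP] := choice Tex.
(* Intersecting makes the sets decrease, so almost minimizers of later index still lie in the
   earlier hulls. *)
pose S n : set nat := [set k | forall j, (j <= n)%N -> T j k].
have US n : U (S n).
  elim: n => [|n ih].
    by apply: filterS (TP 0%N).1 => k Tk j; rewrite leqn0 => /eqP ->.
  apply: filterS2 ih (TP n.+1).1 => k Sk Tk j.
  by rewrite leq_eqVlt ltnS => /predU1P[->//|]; exact: Sk.
have SS p n : (n <= p)%N -> S p `<=` S n.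
  by move=> np k Sk j jn; apply: Sk; exact: leq_trans np.
have Sm n p : midpoint_hull (S n) p -> m - eps n <= f p.
  by move=> Sp; apply: (TP n).2; apply: sub_midpoint_hull Sp => k; exact.
(* The midpoint stays in the hull, where [f] is at least [m - eps n]; strong convexity leaves at
   most [2 * eps n] for [c] times the squared distance. *)
have close n x y : midpoint_hull (S n) x -> midpoint_hull (S n) y ->
    f x <= m + eps n -> f y <= m + eps n -> b (x - y) (x - y) <= 2 * eps n / c.
  move=> Sx Sy fx fy; rewrite ler_pdivlMr// mulrC.
  have := Sm n _ (hull_mid Sx Sy); have := f_midpoint x y.
  by move: (c * _) (f _) => s t; lra.
have pex n : exists p, midpoint_hull (S n) p /\ f p <= m + eps n.
  by have [x Sx fx] := m_upper (US n) (eps_gt0 n); exists x.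
have [p pP] := choice pex.
have small e : 0 < e -> exists n, 2 * eps n / c <= e.
  move=> e0; have e1 : 0 < e * c / 2 by rewrite divr_gt0// mulr_gt0.
  have [n h] := eps_small e1; exists n; rewrite ler_pdivrMr//.
  by move: h; move: (eps n) => t; lra.
have [x xP] : exists x, forall e, 0 < e -> exists N, forall n, (N <= n)%N ->
    b (p n - x) (p n - x) <= e.
  apply: b_complete => e /small[N NP]; exists N => k n Nk Nn.
  have hp j : (N <= j)%N -> midpoint_hull (S N) (p j) /\ f (p j) <= m + eps N.
    move=> Nj; have [Sp fp] := pP j; split.
      by apply: sub_midpoint_hull Sp; exact: SS.
    by apply: le_trans fp _; rewrite lerD2l le_eps.
  have [[h1 h2] [h3 h4]] := (hp _ Nk, hp _ Nn).
  by apply: le_trans NP; exact: close.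
have fxm : f x <= m.
  apply/ler_addgt0Pr => e e0; have e20 : 0 < e / 2 by rewrite divr_gt0.
  have [r r0 rP] := f_lsc x e20; have [N NP] := xP _ r0.
  have [K KP] := eps_small e20.
  have := rP _ (NP (maxn N K) (leq_maxl _ _)).
  have := (pP (maxn N K)).2; have := le_eps (leq_maxr N K).
  by move: (eps (maxn N K)) (f (p _)) (eps K) KP => s1 s2 s3 *; lra.
have tri y z v : b (y - z) (y - z) <= 2 * b (y - v) (y - v) + 2 * b (v - z) (v - z).
  by have := form_triangle bP (y - v) (v - z); rewrite addrA subrK.
exists x; split.
- by move=> r fr; apply: le_trans fxm _; exact: m_le.
- move=> L l Llin [K LK] Ll.
  have LD y z : L (y + z) = L y + L z by have := Llin 1 y z; rewrite scale1r mul1r.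
  have L0 : L 0 = 0.
    by apply: (addrI (L 0)); rewrite -LD !addr0.
  have LZ a y : L (a *: y) = a * L y.
    by have := Llin a y 0; rewrite L0 !addr0.
  have LB y z : L (y - z) = L y - L z by rewrite LD -scaleN1r LZ mulN1r.
  have key e : 0 < e -> (L x - l) ^+ 2 <= 2 * (`|K| + 1) * e + 2 * e ^+ 2.
    move=> e0; have e40 : 0 < e / 4 by rewrite divr_gt0.
    have [n nP] := small _ e40; have [N NP] := xP _ e40.
    pose k := maxn n N.
    (* On the hull of this smaller set [L] stays within [e] of [l], while its infimum is still at
       most [m]. An almost minimizer [q] there is therefore close to [p k], hence to [x]. *)
    have UV : U (S k `&` [set j | `|l - L (w j)| <= e]).
      by apply: filterI => //; move/cvgrPdist_le : Ll; apply.
    have [q Sq fq] := m_upper UV (eps_gt0 k).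
    have lq : `|l - L q| <= e.
      elim: Sq {fq} => [j [_ //]|y z _ hy _ hz].
      rewrite LZ LD; move: hy hz; rewrite !ler_norml => /andP[h1 h2] /andP[h3 h4].
      by apply/andP; split; lra.
    have Sq' : midpoint_hull (S k) q by apply: sub_midpoint_hull Sq => j [].
    have [Sp fp] := pP k.
    have bqx : b (q - x) (q - x) <= e.
      apply: le_trans (tri _ _ (p k)) _.
      have h1 := close _ _ _ Sq' Sp fq fp.
      have h2 := NP k (leq_maxr _ _).
      have h3 : 2 * eps k / c <= 2 * eps n / c.
        by rewrite ler_pM2r ?invr_gt0// ler_pM2l// le_eps// leq_maxl.
      by move: h1 h2 h3 nP; move: (_ / c) (2 * eps n / c) (b (q - p k) _) (b (p k - x) _) => *; lra.
    have h1 : (L q - L x) ^+ 2 <= (`|K| + 1) * e.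
      rewrite -LB; apply: le_trans (LK _) _.
      apply: (@le_trans _ _ ((`|K| + 1) * b (q - x) (q - x))).
        rewrite ler_wpM2r//; first by case: bP.
        by rewrite (le_trans (ler_norm _))// lerDl.
      by rewrite ler_wpM2l// addr_ge0.
    have h2 : (l - L q) ^+ 2 <= e ^+ 2.
      by rewrite -[leLHS]real_normK ?num_real// lerXn2r// ?nnegrE// ltW.
    have := sqr_ge0 ((L x - L q) - (L q - l)).
    by move: h1 h2; move: (L x) (L q) => s t; nra.
  apply/eqP; rewrite -subr_eq0 -sqrf_eq0 eq_le sqr_ge0 andbT.
  apply/ler_addgt0Pr => e e0; rewrite add0r.
  pose K' := 2 * (`|K| + 1) + 2.
  have K'0 : 0 < K' by rewrite /K' addr_gt0// mulr_gt0// ltr_pwDr.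
  (* With [t <= 1] one has [t ^+ 2 <= t], so the bound [key] becomes linear in [t] with coefficient
     [K']. *)
  pose t := Num.min 1 (e / K').
  have t0 : 0 < t by rewrite lt_min ltr01 divr_gt0.
  have t1 : t <= 1 by rewrite ge_min lexx.
  have te : K' * t <= e by rewrite mulrC -ler_pdivlMr// ge_min lexx orbT.
  apply: le_trans (key _ t0) _; apply: le_trans te.
  have tt : t ^+ 2 <= t by rewrite expr2 ler_piMr// ltW.
  by rewrite /K' [leRHS]mulrDl lerD2l ler_pM2l.
- move=> fw e e0; have e40 : 0 < e / 4 by rewrite divr_gt0.
  have [n nP] := small _ e40; have [N NP] := xP _ e40.
  pose k := maxn n N.
  apply: filterS (US k) => j Sj /=.
  have [Sp fp] := pP k.
  apply: le_trans (tri _ _ (p k)) _.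
  (* Since [f (w j) <= f x <= m], the points [w j] are themselves almost minimizers on the hull and
     obey [close]. *)
  have fj : f (w j) <= m + eps k.
    by apply: le_trans (fw j) _; apply: le_trans fxm _; rewrite lerDl ltW.
  have h1 := close _ _ _ (hull_in Sj) Sp fj fp.
  have h2 := NP k (leq_maxr _ _).
  have h3 : 2 * eps k / c <= 2 * eps n / c.
    by rewrite ler_pM2r ?invr_gt0// ler_pM2l// le_eps// leq_maxl.
  by move: h1 h2 h3 nP; move: (_ / c) (2 * eps n / c) (b (w j - p k) _) (b (p k - x) _) => *; lra.
Qed.

End weak_limit.

(** * The Fischer-Burmeister penalty *)

Section fischer_burmeister.
Context {R : realType}.
Implicit Types a b : R.

Lemma sqrt_sum_sqr_lipschitz a b a' b' :
  Num.sqrt (a ^+ 2 + b ^+ 2) <=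
  Num.sqrt (a' ^+ 2 + b' ^+ 2) + (`|a - a'| + `|b - b'|).
Proof.
set s := Num.sqrt (a' ^+ 2 + b' ^+ 2).
have s0 : 0 <= s by exact: sqrtr_ge0.
have sE : s ^+ 2 = a' ^+ 2 + b' ^+ 2 by rewrite sqr_sqrtr// addr_ge0 ?sqr_ge0.
have as_ : `|a'| <= s by rewrite -sqrtr_sqr ler_sqrt ?addr_ge0 ?sqr_ge0// lerDl sqr_ge0.
have bs : `|b'| <= s by rewrite -sqrtr_sqr ler_sqrt ?addr_ge0 ?sqr_ge0// lerDr sqr_ge0.
have e0 : 0 <= `|a - a'| + `|b - b'| by rewrite addr_ge0.
rewrite -(@ler_pXn2r _ 2)// ?nnegrE ?sqrtr_ge0 ?addr_ge0//.
rewrite sqr_sqrtr ?addr_ge0 ?sqr_ge0// sqrrD sE.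
have h (p q t : R) : `|q| <= t -> p ^+ 2 <= q ^+ 2 + 2 * t * `|p - q| + `|p - q| ^+ 2.
  move=> qt; have -> : p ^+ 2 = q ^+ 2 + 2 * (q * (p - q)) + (p - q) ^+ 2 by ring.
  rewrite real_normK ?num_real// lerD2r lerD2l -mulrA ler_pM2l//.
  by rewrite (le_trans (ler_norm _))// normrM ler_wpM2r.
have := h a a' s as_; have := h b b' s bs.
have := mulr_ge0 (normr_ge0 (a - a')) (normr_ge0 (b - b')).
rewrite sqrrD -[s * _ *+ 2]mulr_natl -[_ *+ 2]mulr_natl.
by move: (`|a - a'|) (`|b - b'|) => x y; lra.
Qed.

(** The constant 2 collects one contribution from the Euclidean norm and one from the linear
    terms. *)
Lemma fischer_burmeister_lipschitz a b a' b' :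
  `|fischer_burmeister a b| <=
  `|fischer_burmeister a' b'| + 2 * (`|a - a'| + `|b - b'|).
Proof.
have h1 := sqrt_sum_sqr_lipschitz a b a' b'.
have h2 := sqrt_sum_sqr_lipschitz a' b' a b.
rewrite (distrC a' a) (distrC b' b) in h2.
have h3 := ler_norm (a - a'); have h4 := ler_norm (b - b').
have h5 := ler_norm (- (a - a')); have h6 := ler_norm (- (b - b')).
rewrite !normrN in h5 h6.
have : `|fischer_burmeister a b - fischer_burmeister a' b'| <=
    2 * (`|a - a'| + `|b - b'|).
  rewrite /fischer_burmeister ler_norml; apply/andP; split;
  by move: h1 h2 h3 h4 h5 h6; move: (Num.sqrt _) (Num.sqrt _) (`|a - a'|) (`|b - b'|) => *; lra.
have := ler_normD (fischer_burmeister a' b') (fischer_burmeister a b - fischer_burmeister a' b').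
by rewrite addrC subrK => h7 h8; apply: le_trans h7 _; rewrite lerD2l.
Qed.

(** A zero means that the square root equals [a + b], which is thus nonnegative; squaring leaves
    [2 * a * b = 0]. *)
Lemma fischer_burmeister_eq0 a b : fischer_burmeister a b = 0 <->
  [/\ 0 <= a, 0 <= b & a * b = 0].
Proof.
rewrite /fischer_burmeister; split.
  move/eqP; rewrite -addrA -opprD subr_eq0 => /eqP e.
  have ab0 : 0 <= a + b by rewrite -e sqrtr_ge0.
  have : a ^+ 2 + b ^+ 2 = (a + b) ^+ 2.
    by rewrite -e sqr_sqrtr// addr_ge0// sqr_ge0.
  rewrite sqrrD => e2.
  have m0 : a * b = 0.
    have : a * b *+ 2 = 0 by move: e2; lra.
    by move/eqP; rewrite mulrn_eq0/= => /eqP.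
  have /eqP := m0; rewrite mulf_eq0 => /orP[] /eqP z0; 
    by move: ab0; rewrite z0 ?add0r ?addr0 ?mul0r ?mulr0 => h; split.
move=> [a0 b0 ab0]; have -> : a ^+ 2 + b ^+ 2 = (a + b) ^+ 2.
  by rewrite sqrrD ab0 mul0rn addr0.
by rewrite sqrtr_sqr ger0_norm ?addr_ge0//; ring.
Qed.

Lemma fischer_burmeister_sqr_le a b :
  fischer_burmeister a b ^+ 2 <= 8 * (a ^+ 2 + b ^+ 2).
Proof.
have := fischer_burmeister_lipschitz a b 0 0.
have -> : fischer_burmeister 0 0 = 0 :> R.
  by apply/fischer_burmeister_eq0; split; rewrite ?mulr0.
rewrite normr0 add0r !subr0 => h.
rewrite -real_normK ?num_real//.
apply: (@le_trans _ _ ((2 * (`|a| + `|b|)) ^+ 2)).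
  by rewrite lerXn2r ?nnegrE// mulr_ge0// addr_ge0.
rewrite -[a ^+ 2]real_normK ?num_real// -[b ^+ 2]real_normK ?num_real//.
by have := sqr_ge0 (`|a| - `|b|); move: (`|a|) (`|b|) => s t; nra.
Qed.

End fischer_burmeister.

(** * Local compactness and the limit of the penalty *)

Section local_compactness.
Context {R : realType} {d : nat} {Omega : set 'rV[R]_d} (oOmega : open Omega).
Hypothesis Omega_bounded : bounded_set Omega.
Local Notation mu := (lebesgue_on oOmega).
Local Notation L2 := (L2space mu).
Local Notation H := (H1 oOmega).
Let mu_fin := lebesgue_on_finite oOmega Omega_bounded.
Let dotP := L2dot_form mu.

Lemma Rintegral_L2dot (S : set 'rV[R]_d) : measurable S ->
  exists p : L2, forall u : L2, \int[mu]_(x in S) u x = L2dot u p.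
Proof.
move=> mS.
have [p pE] : exists p : L2, {ae mu, forall x, p x = \1_S x}.
  apply: L2_of_fun; first exact: measurable_indic.
  apply: (integrable_mul_bounded (K := 1)).
  - apply: le_integrable (integrable_cst_finite mu_fin (1 : R)) => //.
      by apply/measurable_EFinP; exact: measurable_indic.
    by move=> x _ /=; rewrite lee_fin indicE; case: (_ \in _); rewrite ?normr1 ?normr0.
  - exact: measurable_indic.
  - by move=> x; rewrite indicE; case: (_ \in _); rewrite ?normr1 ?normr0.
exists p => u; rewrite -Rintegral_indicM//.
have mu' := L2_measurable u; have mp := L2_measurable p.
apply: ae_Rintegral => //; [|exact: measurable_funM|].
  by apply: measurable_funM => //; exact: measurable_indic.
by apply: filterS pE => x ->.
Qed.

Lemma box_functional a b : exists2 K, 0 <= K & forall x : H * H,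
  `|\int[mu]_(t in box a b) x.1 t| <= K * H1pair_norm x /\
  `|\int[mu]_(t in box a b) x.2 t| <= K * H1pair_norm x.
Proof.
have [p pE] := Rintegral_L2dot (measurable_box a b).
have [_ _ d0] := dotP.
exists (Num.sqrt (L2dot p p)) => // x.
have h (u : L2) : L2dot u u <= Hdot x x ->
    `|\int[mu]_(t in box a b) u t| <= Num.sqrt (L2dot p p) * H1pair_norm x.
  move=> ux; have n0 : 0 <= H1pair_norm x by exact: sqrtr_ge0.
  rewrite pE -(@ler_pXn2r _ 2)// ?nnegrE ?mulr_ge0// real_normK ?num_real//.
  rewrite exprMn sqr_sqrtr// H1pair_norm_sqr mulrC.
  apply: le_trans (form_cauchy_schwarz dotP _ _) _.
  by rewrite ler_wpM2r.
by split; apply: h; [exact: L2dot_le_Hdot1|exact: L2dot_le_Hdot2].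
Qed.

(** Weak convergence quantifies over bundled linear functionals, so the box integrals have to be
    packed as such. *)
Lemma box_scalar a b : exists F G : {scalar (H * H)%type},
  (forall x, F x = \int[mu]_(t in box a b) x.1 t) /\
  (forall x, G x = \int[mu]_(t in box a b) x.2 t).
Proof.
have [p pE] := Rintegral_L2dot (measurable_box a b).
have [_ lin _] := dotP.
have lin1 : linear_for *%R (fun x : H * H => \int[mu]_(t in box a b) x.1 t).
  by move=> c x y; rewrite !pE -lin.
have lin2 : linear_for *%R (fun x : H * H => \int[mu]_(t in box a b) x.2 t).
  by move=> c x y; rewrite !pE -lin.
pose F : {scalar (H * H)%type} := HB.pack (fun x : H * H => \int[mu]_(t in box a b) x.1 t)
  (GRing.isLinear.Build _ _ _ _ _ lin1).
pose G : {scalar (H * H)%type} := HB.pack (fun x : H * H => \int[mu]_(t in box a b) x.2 t)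
  (GRing.isLinear.Build _ _ _ _ _ lin2).
by exists F, G.
Qed.

Let L1_bound (u : L2) S : measurable S ->
  \int[mu]_(x in S) `|u x| <= fine (mu setT) + L2dot u u.
Proof.
move=> mS; have := L2_young mu_fin u ltr01; rewrite mul1r invr1 mul1r.
have iu : mu.-integrable setT (EFin \o (fun x => `|u x|)).
  exact: (integrable_norm (L2_integrable mu_fin u)).
apply: le_trans; rewrite Rintegral_mkcond; apply: le_Rintegral => //.
- rewrite -restrict_EFin; apply: (integrable_mkcond _ mS).1.
  exact: integrableS iu.
- move=> x _; rewrite patchE; case: ifP => _ //; exact: normr_ge0.
Qed.

(* Local Rellich theorem: on boxes well inside the open set, bounded families
   whose integrals over boxes tend to 0 are strongly null in L^1. *)
Lemma box_L1_cvg0 (F : set_system nat) (FF : Filter F) (u : nat -> H) (M : R) :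
  (forall k, H1dot (u k) (u k) <= M) ->
  (forall a b, good_box Omega a b -> lt_box a b ->
     \int[mu]_(x in box a b) u k x @[k --> F] --> (0 : R)) ->
  forall a b, good_box Omega a b -> lt_box a b ->
     \int[mu]_(x in box a b) `|u k x| @[k --> F] --> (0 : R).
Proof.
move=> uM u0 a b gab ab; apply/cvgrPdist_le => e e0.
pose P a' b' := good_box Omega a' b' /\ lt_box a' b'.
pose C := \sum_i 2 * (b i - a i) * (fine (mu setT) + M).
have M0 : 0 <= fine (mu setT) + M.
  rewrite addr_ge0 ?fine_ge0// (le_trans _ (uM 0%N))//.
  by case: (H1dot_form oOmega Omega_bounded).
have C0 : 0 <= C.
  apply: sumr_ge0 => i _; rewrite !mulr_ge0// subr_ge0 ltW//.
(* The number of rounds is fixed first, uniformly in [k], to make the gradient term small; only then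
   does [k] move along the filter, with finitely many leaf integrals to control. *)
have [n nP] : exists n, C / 2 ^+ n <= e / 2.
  have : C / 2 ^+ n @[n --> \oo] --> (0 : R).
    rewrite -[X in _ --> X](mulr0 C); apply: cvgM; first exact: cvg_cst.
    under eq_fun do rewrite -exprVn.
    by apply: cvg_expr; rewrite gtr0_norm// invf_lt1// ltr1n.
  have e20 : 0 < e / 2 by rewrite divr_gt0.
  by move=> /cvgr_le /(_ _ e20) [n _ /(_ n (leqnn n)) h]; exists n.
have lv : leaves (fun a b => `|\int[mu]_(x in box a b) u k x|) (rounds n) a b
    @[k --> F] --> leaves (fun _ _ => 0) (rounds n) a b.
  apply: (@cvg_leaves _ _ _ F _ P) => //.
  - by move=> a' b' i; exact: good_lt_box_half.
  - move=> a' b' [gab' ab']; rewrite -(normr0 R); apply: cvg_norm; exact: u0.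
have l0 : leaves (fun _ _ => 0) (rounds n) a b = 0 :> R.
  by elim: (rounds n) a b {gab ab C C0 nP lv} => //= i l ih a b; rewrite !ih addr0.
rewrite l0 in lv.
have e20 : 0 < e / 2 by rewrite divr_gt0.
move/cvgr_le : lv => /(_ _ e20); apply: filterS => k hk.
rewrite sub0r normrN ger0_norm ?Rintegral_ge0//.
have P_lt a' b' : P a' b' -> lt_box a' b' by case.
have P_half a' b' i : P a' b' ->
  P a' (upd b' i (mid a' b' i)) /\ P (upd a' i (mid a' b' i)) b'.
  exact: good_lt_box_half.
have u_split a' b' i : P a' b' ->
  `|\int[mu]_(x in box a' (upd b' i (mid a' b' i))) u k x -
    \int[mu]_(x in box (upd a' i (mid a' b' i)) b') u k x| <=
  (b' i - a' i) * \int[mu]_(x in box a' b') `|weak_deriv i (u k) x|.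
  move=> [gab' ab'].
  exact: (weak_partial_box Omega_bounded (weak_derivP i (u k)) gab' (ab' i)).
apply: le_trans (poincare_leaves (L2_integrable mu_fin (u k))
  (fun i => L2_integrable mu_fin (weak_deriv i (u k))) P_lt P_half u_split
  (rounds n) (conj gab ab)) _.
rewrite [leRHS]splitr; apply: lerD => //; apply: le_trans nP.
rewrite /C mulr_suml; apply: ler_sum => i _; rewrite count_rounds.
rewrite mulrA mulrAC ler_wpM2r ?invr_ge0 ?exprn_ge0//.
rewrite ler_wpM2l ?mulr_ge0 ?subr_ge0 ?(ltW (ab i))//.
apply: le_trans (L1_bound _ (measurable_box a b)) _.
rewrite lerD2l; apply: le_trans (uM k).
exact: weak_deriv_le_H1dot.
Qed.

Let fbM (u v : L2) : measurable_fun setT (fun x => fischer_burmeister (u x) (v x)).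
Proof.
have mU := L2_measurable u; have mV := L2_measurable v.
apply: measurable_funB => //; apply: measurable_funB => //.
apply: (@measurableT_comp _ _ _ _ _ _ (@Num.sqrt R)).
  by apply: continuous_measurable_fun; exact: sqrt_continuous.
by apply: measurable_funD; exact: measurable_funX.
Qed.

Let fbI2 (u v : L2) : mu.-integrable setT (EFin \o (fun x =>
    fischer_burmeister (u x) (v x) * fischer_burmeister (u x) (v x))).
Proof.
have mF := fbM u v.
apply: (@le_integrable _ _ _ _ _ measurableT _
  (EFin \o (fun x => 8 * (u x * u x) + 8 * (v x * v x)))).
- by apply/measurable_EFinP/measurable_funM.
- move=> x _ /=; rewrite lee_fin -!expr2 -mulrDr !ger0_norm ?sqr_ge0//.
    exact: fischer_burmeister_sqr_le.
  by rewrite mulr_ge0// addr_ge0 ?sqr_ge0.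
rewrite (_ : _ \o _ = (fun x => 8%:E * (u x * u x)%:E + 8%:E * (v x * v x)%:E)%E)//.
by apply: integrableD => //; apply: integrableZl => //; exact: integrable_L2_mul.
Qed.

Lemma fischer_burmeister_L2 (u v : L2) : exists q : L2,
  {ae mu, forall x, q x = fischer_burmeister (u x) (v x)} /\
  L2dot q q = \int[mu]_x fischer_burmeister (u x) (v x) ^+ 2.
Proof.
have mF := fbM u v.
have [q qE] := L2_of_fun mF (fbI2 u v); exists q; split => //.
have mq := L2_measurable q.
apply: ae_Rintegral => //; [exact: measurable_funM|exact: measurable_funX|].
by apply: filterS qE => x ->.
Qed.

Lemma penalty_ge0 (w : H * H) : 0 <= penalty w.
Proof. by rewrite mulr_ge0// Rintegral_ge0// => x _; rewrite sqr_ge0. Qed.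

Lemma penalty_complementarity (w : H * H) : complementarity_set w -> penalty w = 0.
Proof.
move=> wC; rewrite /penalty.
have [q [qE <-]] := fischer_burmeister_L2 (H1val w.1) (H1val w.2).
have -> : q = 0.
  apply: L2_ext; apply: filterS3 qE wC (L2_zeroE mu) => x -> /fischer_burmeister_eq0 h ->.
  exact: h.
by rewrite (form0l dotP) mulr0.
Qed.

(** On a good box the Lipschitz bound compares the value at [x] with that at [w k]: the difference
    terms vanish in [L^1], and the penalty controls the rest. *)
Lemma complementarity_limit (F : set_system nat) (FF : ProperFilter F)
  (w : nat -> H * H) (x : H * H) (M : R) :
  (forall k, Hdot (w k - x) (w k - x) <= M) ->
  (forall a b, good_box Omega a b -> lt_box a b ->
     \int[mu]_(t in box a b) (w k - x).1 t @[k --> F] --> (0 : R)) ->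
  (forall a b, good_box Omega a b -> lt_box a b ->
     \int[mu]_(t in box a b) (w k - x).2 t @[k --> F] --> (0 : R)) ->
  penalty (w k) @[k --> F] --> (0 : R) ->
  complementarity_set x.
Proof.
move=> wM w1 w2 pw.
have [_ _ h0] := H1dot_form oOmega Omega_bounded.
have M1 k : H1dot (w k - x).1 (w k - x).1 <= M.
  by apply: le_trans (wM k); rewrite /Hdot lerDl.
have M2 k : H1dot (w k - x).2 (w k - x).2 <= M.
  by apply: le_trans (wM k); rewrite /Hdot lerDr.
have c1 := box_L1_cvg0 _ M1 w1.
have c2 := box_L1_cvg0 _ M2 w2.
pose fb k t := fischer_burmeister ((w k).1 t) ((w k).2 t).
pose fbx t := fischer_burmeister (x.1 t) (x.2 t).
have ifbx : mu.-integrable setT (EFin \o (fun t => `|fbx t|)).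
  apply: (integrable_norm (integrable_of_sqr mu_fin (fbM _ _) (fbI2 _ _))).
have ifb k : mu.-integrable setT (EFin \o (fun t => `|fb k t|)).
  apply: (integrable_norm (integrable_of_sqr mu_fin (fbM _ _) (fbI2 _ _))).
have fbx0 : {ae mu, forall t, `|fbx t| = 0}.
  apply: ae_eq0_good_boxes => // a b gab ab.
  have mb := measurable_box a b.
  apply/eqP; rewrite eq_le Rintegral_ge0// andbT.
  (* For fixed [t] the penalty term of [L2_young] vanishes along the filter and leaves [t] times the
     total mass; then [t] is made small. *)
  have key t : 0 < t -> \int[mu]_(s in box a b) `|fbx s| <= t * fine (mu setT).
    move=> t0.
    have lim : t * fine (mu setT) + (t^-1 * (2 * penalty (w k)) +
        2 * (\int[mu]_(s in box a b) `|(w k - x).1 s| +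
             \int[mu]_(s in box a b) `|(w k - x).2 s|)) @[k --> F]
        --> t * fine (mu setT) + (t^-1 * (2 * 0) + 2 * (0 + 0)).
      apply: cvgD; first exact: cvg_cst.
      apply: cvgD; first by apply: cvgM; [exact: cvg_cst|apply: cvgM => //; exact: cvg_cst].
      apply: cvgM; first exact: cvg_cst.
      by apply: cvgD; [exact: c1|exact: c2].
    rewrite !(addr0, mulr0) in lim.
    apply: (cvgr_to_ge lim); apply: nearW => k.
    have [q [qE qq]] := fischer_burmeister_L2 (H1val (w k).1) (H1val (w k).2).
    have mq := L2_measurable q.
    have b1 : \int[mu]_(s in box a b) `|fb k s| <= t * fine (mu setT) + t^-1 * (2 * penalty (w k)).
      have -> : 2 * penalty (w k) = L2dot q q by rewrite qq /penalty mulrA divff// mul1r.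
      apply: le_trans (L2_young mu_fin q t0).
      have -> : \int[mu]_s `|q s| = \int[mu]_s `|fb k s|.
        apply: ae_Rintegral => //; [exact: measurableT_comp| |].
          by apply: measurableT_comp => //; exact: fbM.
        by apply: filterS qE => s ->.
      rewrite Rintegral_mkcond; apply: le_Rintegral => //.
      - rewrite -restrict_EFin; apply: (integrable_mkcond _ mb).1.
        exact: integrableS (ifb k).
      - by move=> s _; rewrite patchE; case: ifP => _ //; exact: normr_ge0.
    have sub1 (u v : H) : \int[mu]_(s in box a b) `|(u - v) s| =
        \int[mu]_(s in box a b) `|u s - v s|.
      have mU := L2_measurable (H1val u); have mV := L2_measurable (H1val v).
      apply: ae_Rintegral => //.
      - apply: measurable_funTS; apply: measurableT_comp => //; exact: L2_measurable.
      - apply: measurable_funTS; apply: measurableT_comp => //; exact: measurable_funB.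
      - by apply: filterS (L2_subE (H1val u) (H1val v)) => s ->.
    have isub (u v : H) : mu.-integrable (box a b) (EFin \o (fun s => `|u s - v s|)).
      apply: (@integrableS _ _ _ _ setT) => //.
      apply: (@integrable_norm _ _ _ _ _ (fun s => u s - v s)).
      rewrite (_ : _ \o _ = (fun s => (u s)%:E - (v s)%:E)%E)//.
      by apply: integrableB => //; exact: (L2_integrable mu_fin).
    have ifbk : mu.-integrable (box a b) (EFin \o (fun t => `|fb k t|)).
      by apply: integrableS (ifb k).
    have i12 : mu.-integrable (box a b) (EFin \o (fun s =>
        `|(w k).1 s - x.1 s| + `|(w k).2 s - x.2 s|)).
      rewrite (_ : _ \o _ = (fun s => (`|(w k).1 s - x.1 s|)%:E + (`|(w k).2 s - x.2 s|)%:E)%E)//.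
      by apply: integrableD => //; exact: isub.
    rewrite addrA; apply: (@le_trans _ _ (\int[mu]_(s in box a b) `|fb k s| +
      2 * (\int[mu]_(s in box a b) `|(w k - x).1 s| +
             \int[mu]_(s in box a b) `|(w k - x).2 s|))); last by rewrite lerD2r.
    rewrite (sub1 (w k).1 x.1) (sub1 (w k).2 x.2) -RintegralD//.
    rewrite -RintegralZl// -RintegralD//; last first.
      rewrite (_ : _ \o _ = (fun s => 2%:E *
        (`|(w k).1 s - x.1 s| + `|(w k).2 s - x.2 s|)%:E)%E)//.
      exact: integrableZl.
    apply: le_Rintegral => //.
    - exact: integrableS ifbx.
    - rewrite (_ : _ \o _ = (fun s => (`|fb k s|)%:E + 2%:E *
        (`|(w k).1 s - x.1 s| + `|(w k).2 s - x.2 s|)%:E)%E)//.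
      by apply: integrableD => //; exact: integrableZl.
    - move=> s _; rewrite /fbx (distrC ((w k).1 s)) (distrC ((w k).2 s)).
      exact: fischer_burmeister_lipschitz.
  apply/ler_addgt0Pr => e e0; rewrite add0r.
  have m0 : 0 <= fine (mu setT) by exact: fine_ge0.
  have e1 : 0 < e / (fine (mu setT) + 1) by rewrite divr_gt0// ltr_pwDr.
  apply: le_trans (key _ e1) _.
  by rewrite mulrAC ler_pdivrMr ?ltr_pwDr// ler_wpM2l ?ltW// ltrDl.
apply: filterS fbx0 => t /eqP; rewrite normr_eq0 => /eqP.
by move/fischer_burmeister_eq0.
Qed.

End local_compactness.

(** * The reduced problem *)

Section quadratic_objective.
Context {R : realType} (X Z : lmodType R).
Variables (b g : X -> X -> R) (q : Z -> Z -> R) (S : X -> Z) (z0 : Z) (c K : R).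
Hypotheses (bP : psd_form b) (gP : psd_form g) (qP : psd_form q).
Hypothesis S_linear : linear S.
Hypothesis g_coercive : forall x, c * b x x <= g x x.
Hypothesis g_le : forall x, g x x <= K * b x x.
Hypothesis S_le : forall x, q (S x) (S x) <= K * b x x.

Definition quadratic_objective x := 2^-1 * q (S x - z0) (S x - z0) + g x x.
Local Notation f := quadratic_objective.

Lemma quadratic_objective_ge0 x : 0 <= f x.
Proof.
by case: gP qP => _ _ g0 [_ _ q0]; rewrite addr_ge0// mulr_ge0.
Qed.

Let SB x y : S (x - y) = S x - S y.
Proof. by have := S_linear (-1) y x; rewrite !scaleN1r ![- _ + _]addrC. Qed.

(** The data term is convex and its defect is dropped; coercivity of [g] times the 1/4 of the
    parallelogram identity gives the modulus [c / 4]. *)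
Lemma quadratic_objective_midpoint x y :
  f (2^-1 *: (x + y)) <= 2^-1 * f x + 2^-1 * f y - (c / 4) * b (x - y) (x - y).
Proof.
rewrite /f.
have -> : S (2^-1 *: (x + y)) - z0 = 2^-1 *: ((S x - z0) + (S y - z0)).
  have := S_linear 2^-1 (x + y) 0; have := S_linear 1 x y.
  have := SB 0 0; rewrite !subr0 subrr => S0.
  rewrite !scale1r S0 !addr0 => -> ->.
  have z2 : 2^-1 *: (z0 + z0) = z0.
    by rewrite -mulr2n -[z0 *+ 2]scaler_nat scalerA mulVf ?scale1r// pnatr_eq0.
  by rewrite addrACA -opprD scalerBr z2.
have q0 : 0 <= q (S x - z0 - (S y - z0)) (S x - z0 - (S y - z0)) by case: qP.
rewrite (form_midpoint qP) (form_midpoint gP).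
have := g_coercive (x - y).
by move: q0; move: (q _ _) (q _ _) (q _ _) (g _ _) (g _ _) (g _ _) (b _ _) => *; lra.
Qed.

Lemma quadratic_objective_lsc x e : 0 < e -> exists2 r, 0 < r &
  forall y, b (y - x) (y - x) <= r -> f x <= f y + e.
Proof.
move=> e0; have fx0 := quadratic_objective_ge0 x.
(* Chosen so that [t * f x <= e / 2]. With [C * b (y - x) (y - x) <= e / 4], a drop of [f] by more
   than [e] would contradict [h3]. *)
pose t := e / (2 * (f x + 1)).
have fx1 : 0 < f x + 1 by rewrite ltr_pwDr.
have t0 : 0 < t by rewrite divr_gt0// mulr_gt0.
have tf : t * f x <= e / 2.
  rewrite /t mulrAC ler_pdivrMr ?mulr_gt0//.
  by rewrite mulrA divfK// ler_pM2l// lerDl.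
pose C := (1 + t^-1) * (2 * (`|K| + 1)).
have C0 : 0 < C.
  apply: mulr_gt0; first by rewrite addr_gt0 ?invr_gt0.
  by apply: mulr_gt0 => //; rewrite ltr_pwDr.
exists (e / (4 * C)); first by rewrite divr_gt0// mulr_gt0.
have C40 : 0 < 4 * C by exact: mulr_gt0.
move=> y; rewrite (ler_pdivlMr _ _ C40) => h.
have b0 : 0 <= b (y - x) (y - x) by case: bP.
have ti : 0 <= 1 + t^-1 by rewrite addr_ge0// invr_ge0 ltW.
have h1 : q (S x - z0) (S x - z0) <= (1 + t) * q (S y - z0) (S y - z0) +
    (1 + t^-1) * (`|K| * b (y - x) (y - x)).
  have := form_triangle2 qP (S y - z0) (S x - S y) t0.
  rewrite addrC addrA subrK => /le_trans; apply.
  rewrite lerD2l; apply: ler_wpM2l => //.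
  rewrite (form_subC qP) -SB; apply: le_trans (S_le _) _.
  by rewrite ler_wpM2r// ler_norm.
have h2 : g x x <= (1 + t) * g y y + (1 + t^-1) * (`|K| * b (y - x) (y - x)).
  have := form_triangle2 gP y (x - y) t0.
  rewrite addrC subrK => /le_trans; apply.
  rewrite lerD2l; apply: ler_wpM2l => //.
  rewrite (form_subC gP); apply: le_trans (g_le _) _.
  by rewrite ler_wpM2r// ler_norm.
have h3 : f x <= (1 + t) * f y + C * b (y - x) (y - x).
  have p0 : 0 <= (1 + t^-1) * b (y - x) (y - x).
    exact: mulr_ge0.
  have p1 : 0 <= (1 + t^-1) * (`|K| * b (y - x) (y - x)).
    by apply: mulr_ge0 => //; exact: mulr_ge0.
  have -> : C * b (y - x) (y - x) = 2 * ((1 + t^-1) * (`|K| * b (y - x) (y - x))) +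
      2 * ((1 + t^-1) * b (y - x) (y - x)) by rewrite /C; ring.
  have -> : (1 + t) * f y = 2^-1 * ((1 + t) * q (S y - z0) (S y - z0)) +
      (1 + t) * g y y by rewrite /f; ring.
  have aux (s1 s2 s3 s4 s5 s6 : R) : s5 <= s4 + s2 -> s6 <= s3 + s2 -> 0 <= s1 ->
      0 <= s2 -> 2^-1 * s5 + s6 <= 2^-1 * s4 + s3 + (2 * s2 + 2 * s1).
    by move=> *; lra.
  exact: aux h1 h2 p0 p1.
rewrite leNgt; apply/negP => fy.
have : (1 + t) * f y <= (1 + t) * (f x - e).
  by rewrite ler_pM2l ?addr_gt0//; move: fy; lra.
have : 0 <= t * e by rewrite mulr_ge0// ltW.
clearbody C t; move: (b (y - x) (y - x)) (f x) (f y) h h3 tf => s fx' fy' h h3 tf h4 h5.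
lra.
Qed.

End quadratic_objective.

(** * The dual norm *)

Section topological_dual_norm.
Context {R : realType} (Y : normedModType R).

Let ball_values (h : topdual Y) := [set `|h y| | y in [set y : Y | `|y| <= 1]].

(** A real supremum is meaningful only for bounded sets, so the norm inequalities need this.
    Continuity at 0 gives values below 1 on a ball of radius [r], and scaling by [r / 2] bounds the
    unit ball by [2 / r]. *)
Lemma topdual_ball_has_sup (h : topdual Y) : has_sup (ball_values h).
Proof.
have /asboolP[lh ch] := topdualP h.
have h0 : h 0 = 0.
  have := lh (-1) 0 0; rewrite scaler0 addr0 => e.
  by have := e; rewrite scaleN1r addNr.
have hZ a y : h (a *: y) = a * h y.
  by have := lh a y 0; rewrite !addr0 h0 addr0.
split; first by exists `|h 0|, 0 => //=; rewrite normr0.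
have := ch 0; rewrite /continuous_at h0 => /cvgrPdist_lt /(_ 1 ltr01).
move=> /nbhs_ballP[r /= r0 rh].
exists (2 / r) => _ [y /= y1 <-].
have hr : `|h ((r / 2) *: y)| < 1.
  have := rh ((r / 2) *: y); rewrite sub0r normrN; apply.
  rewrite -ball_normE /= sub0r normrN normrZ gtr0_norm ?divr_gt0//.
  rewrite (le_lt_trans (y := r / 2))//.
    by rewrite ler_piMr// ltW// divr_gt0.
  by rewrite ltr_pdivrMr// ltr_pMr// ltr1n.
move: hr; rewrite hZ normrM gtr0_norm ?divr_gt0// => hr.
rewrite -(ler_pM2l (_ : 0 < r / 2)) ?divr_gt0//.
have -> : r / 2 * (2 / r) = 1 by field; rewrite gt_eqF.
exact: ltW.
Qed.

Lemma topdual_norm_ge0 (h : topdual Y) : 0 <= topdual_norm h.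
Proof.
apply: le_trans (normr_ge0 (h 0)) _; apply: ub_le_sup.
  by case: (topdual_ball_has_sup h).
by exists 0 => //=; rewrite normr0.
Qed.

Lemma topdual_norm_triangle (h k : topdual Y) :
  topdual_norm (h + k) <= topdual_norm h + topdual_norm k.
Proof.
apply: ge_sup; first by case: (topdual_ball_has_sup (h + k)).
move=> _ [y y1 <-]; apply: le_trans (ler_normD (h y) (k y)) _.
apply: lerD; apply: ub_le_sup.
- by case: (topdual_ball_has_sup h).
- by exists y.
- by case: (topdual_ball_has_sup k).
- by exists y.
Qed.

End topological_dual_norm.

Lemma bounded_op_ge0 (R : realType) (X Z : Type) (nX : X -> R) (nZ : Z -> R)
    (T : X -> Z) : (forall x, 0 <= nX x) -> bounded_op nX nZ T ->
  exists2 M, 0 <= M & forall x, nZ (T x) <= M * nX x.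
Proof.
move=> n0 [M TM]; exists `|M| => // x.
by apply: le_trans (TM x) _; rewrite ler_wpM2r// ler_norm.
Qed.

Lemma sqr_combination_le (R : realFieldType) (p a b s t : R) :
  (p * (a * s + b * t)) ^+ 2 <=
  2 * p ^+ 2 * (a ^+ 2 + b ^+ 2) * (s ^+ 2 + t ^+ 2).
Proof.
rewrite [leRHS](_ : _ = p ^+ 2 * (2 * (a ^+ 2 + b ^+ 2) * (s ^+ 2 + t ^+ 2)));
  last by ring.
rewrite exprMn ler_wpM2l ?sqr_ge0//.
have := sqr_ge0 (a * s - b * t).
by have := sqr_ge0 (a * t); have := sqr_ge0 (b * s); lra.
Qed.

(** * The control-to-observation operator *)

Section state_operator.
Context {R : realType} {d : nat} {Omega : set 'rV[R]_d} (oOmega : open Omega).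
Local Notation H := (H1 oOmega).
Context {Y D : hilbertType R}.
Variables (A : {linear Y -> topdual Y}) (B C : {linear H -> topdual Y})
  (Dop : {linear Y -> D}).
Hypothesis A_iso : bounded_isomorphism (fun y : Y => `|y|) (@topdual_norm R Y) A.
Hypothesis B_bounded : bounded_op (@H1norm R d Omega oOmega) (@topdual_norm R Y) B.
Hypothesis C_bounded : bounded_op (@H1norm R d Omega oOmega) (@topdual_norm R Y) C.
Hypothesis D_bounded : bounded_op (fun y : Y => `|y|) (fun z : D => `|z|) Dop.

Lemma state_equationE y (w : H * H) : state_equation A B C y w <-> A y = B w.1 + C w.2.
Proof.
rewrite /state_equation -addrA -opprD; split => [/eqP|->]; last by rewrite subrr.
by rewrite subr_eq0 => /eqP.
Qed.

Lemma stateP (w : H * H) : A (state A B C w) = B w.1 + C w.2.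
Proof.
have [_ [Tinv [TK KT _]]] := A_iso.
apply/state_equationE.
apply: (@xgetPex _ 0 [set y | state_equation A B C y w]).
by exists (Tinv (B w.1 + C w.2)); apply/state_equationE; rewrite KT.
Qed.

Lemma state_unique y (w : H * H) : A y = B w.1 + C w.2 -> y = state A B C w.
Proof.
have [_ [Tinv [TK _ _]]] := A_iso.
by rewrite -stateP => /(congr1 Tinv); rewrite !TK.
Qed.

Lemma state_linear : linear (state A B C).
Proof.
move=> a u v; apply/esym/state_unique.
by rewrite linearP !stateP /= !linearP scalerDr addrACA.
Qed.

Lemma control_to_observation_linear : linear (control_to_observation A B C Dop).
Proof. by move=> a u v; rewrite /control_to_observation state_linear linearP. Qed.

Lemma control_to_observation_bounded : exists2 K, 0 <= K & forall w : H * H,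
  `|control_to_observation A B C Dop w| ^+ 2 <= K * Hdot w w.
Proof.
have H1n0 (u : H) : 0 <= H1norm u by exact: sqrtr_ge0.
have [_ [Tinv [TK KT Tb]]] := A_iso.
have [MA MA0 hA] := bounded_op_ge0 (@topdual_norm_ge0 R Y) Tb.
have [MB MB0 hB] := bounded_op_ge0 H1n0 B_bounded.
have [MC MC0 hC] := bounded_op_ge0 H1n0 C_bounded.
have [MD MD0 hD] := bounded_op_ge0 (@normr_ge0 R Y) D_bounded.
exists (2 * (MD * MA) ^+ 2 * (MB ^+ 2 + MC ^+ 2)).
  by rewrite mulr_ge0 ?addr_ge0 ?sqr_ge0// mulr_ge0 ?sqr_ge0.
move=> w.
have h : `|control_to_observation A B C Dop w| <=
    MD * MA * (MB * H1norm w.1 + MC * H1norm w.2).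
  apply: le_trans (hD _) _; rewrite -mulrA ler_wpM2l//.
  have -> : state A B C w = Tinv (B w.1 + C w.2) by rewrite -stateP TK.
  apply: le_trans (hA _) _; rewrite ler_wpM2l//.
  by apply: le_trans (topdual_norm_triangle _ _) _; rewrite lerD.
apply: (@le_trans _ _ ((MD * MA * (MB * H1norm w.1 + MC * H1norm w.2)) ^+ 2)).
  rewrite lerXn2r ?nnegrE//; apply: mulr_ge0; first exact: mulr_ge0.
  by apply: addr_ge0; apply: mulr_ge0.
rewrite /Hdot -2!H1norm_sqr.
exact: sqr_combination_le.
Qed.

End state_operator.

(** * Limits of the penalized minimizers *)

Section penalty_method.
Context {R : realType} {d : nat} {Omega : set 'rV[R]_d} (oOmega : open Omega).
Hypothesis Omega_bounded : bounded_set Omega.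
Local Notation mu := (lebesgue_on oOmega).
Local Notation H := (H1 oOmega).
Context {Y D : hilbertType R}.
Variables (yd : D) (A : {linear Y -> topdual Y}) (B C : {linear H -> topdual Y})
  (Dop : {linear Y -> D}).
Hypothesis A_iso : bounded_isomorphism (fun y : Y => `|y|) (@topdual_norm R Y) A.
Hypothesis B_bounded : bounded_op (@H1norm R d Omega oOmega) (@topdual_norm R Y) B.
Hypothesis C_bounded : bounded_op (@H1norm R d Omega oOmega) (@topdual_norm R Y) C.
Hypothesis D_bounded : bounded_op (fun y : Y => `|y|) (fun z : D => `|z|) Dop.
Variables (alpha1 alpha2 eps : R).
Hypotheses (alpha1_ge0 : 0 <= alpha1) (alpha2_ge0 : 0 <= alpha2) (eps_gt0 : 0 < eps).
Variable sigma : nat -> R.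
Hypothesis sigma_gt0 : forall k, 0 < sigma k.
Hypothesis sigma_cvg : sigma k @[k --> \oo] --> +oo.
Variable w : nat -> H * H.
Hypothesis w_min : forall k, global_minimizer setT
  (penalized_objective A B C Dop yd alpha1 alpha2 eps (sigma k)) (w k).

Let dotP := L2dot_form mu.
Let HP := Hdot_form oOmega Omega_bounded.

Definition cost_form (x y : H * H) : R :=
  alpha1 / 2 * L2dot (H1val x.1) (H1val y.1) +
  alpha2 / 2 * L2dot (H1val x.2) (H1val y.2) + eps / 2 * Hdot x y.

Lemma cost_form_psd : psd_form cost_form.
Proof.
apply: psd_form_add; last by apply: psd_form_scale => //; rewrite divr_ge0// ltW.
have lin1 : linear (fun x : H * H => H1val x.1) by [].
have lin2 : linear (fun x : H * H => H1val x.2) by [].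
apply: psd_form_add; apply: psd_form_scale; rewrite ?divr_ge0//.
  exact: (psd_form_comp lin1 dotP).
exact: (psd_form_comp lin2 dotP).
Qed.

Lemma control_costE x : control_cost alpha1 alpha2 eps x = cost_form x x.
Proof.
congr (_ * _ + _ * _ + _ * (_ + _)).
- exact: L2norm_sqr.
- exact: L2norm_sqr.
- exact: H1norm_sqr.
- exact: H1norm_sqr.
Qed.

Lemma inner_form (V : hilbertType R) : psd_form (inner : V -> V -> R).
Proof.
split; [exact: innerC|exact: inner_linearl|].
by move=> x; rewrite inner_norm sqr_ge0.
Qed.

Let obs := control_to_observation A B C Dop.
Let obj := quadratic_objective cost_form (inner : D -> D -> R) obs yd.

Let objE x : obj x = 2^-1 * `|obs x - yd| ^+ 2 + control_cost alpha1 alpha2 eps x.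
Proof. by rewrite /obj /quadratic_objective inner_norm control_costE. Qed.

Let obs_linear : linear obs.
Proof. exact: control_to_observation_linear. Qed.

Let cost_coercive x : eps / 2 * Hdot x x <= cost_form x x.
Proof.
rewrite /cost_form lerDr addr_ge0// mulr_ge0 ?divr_ge0//; by case: dotP.
Qed.

Let constants : exists K, (forall x, cost_form x x <= K * Hdot x x) /\
  (forall x, inner (obs x) (obs x) <= K * Hdot x x).
Proof.
have [K K0 hK] := control_to_observation_bounded A_iso B_bounded C_bounded D_bounded.
have [_ _ H0] := HP.
exists (alpha1 / 2 + alpha2 / 2 + eps / 2 + K); split => x.
  apply: (@le_trans _ _ ((alpha1 / 2 + alpha2 / 2 + eps / 2) * Hdot x x)).
    rewrite 2!mulrDl /cost_form lerD2r.
    apply: lerD; apply: ler_wpM2l; rewrite ?divr_ge0//.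
      exact: L2dot_le_Hdot1.
    exact: L2dot_le_Hdot2.
  by rewrite ler_wpM2r// lerDl.
rewrite inner_norm [leRHS]mulrDl; apply: le_trans (hK x) _.
by rewrite lerDr mulr_ge0// !addr_ge0 ?divr_ge0// ltW.
Qed.

Let obj_le k x : obj (w k) + sigma k * penalty (w k) <= obj x + sigma k * penalty x.
Proof. by rewrite !objE; have [_] := w_min k; exact. Qed.

Let obj_penalty_le k x : complementarity_set x ->
  obj (w k) + sigma k * penalty (w k) <= obj x.
Proof.
move=> xC; apply: le_trans (obj_le k x) _; rewrite gerDl.
by rewrite (penalty_complementarity xC) mulr0.
Qed.

Let obj_le_complementarity k x : complementarity_set x -> obj (w k) <= obj x.
Proof.
move=> xC; apply: le_trans (obj_penalty_le k xC); rewrite lerDl.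
by apply: mulr_ge0; [exact: ltW|exact: penalty_ge0].
Qed.

Let complementarity0 : complementarity_set (0 : H * H).
Proof.
by apply: filterS (L2_zeroE mu) => x h; rewrite /= h mulr0.
Qed.

Let obj_ge0 x : 0 <= obj x.
Proof. by apply: quadratic_objective_ge0; [exact: cost_form_psd|exact: inner_form]. Qed.

(** Comparison with 0 bounds [sigma k] times the penalty by [obj 0], while [sigma k] tends to
    infinity. *)
Lemma penalty_cvg0 : penalty (w k) @[k --> \oo] --> (0 : R).
Proof.
apply/cvgrPdist_le => e e0.
have [N _ NP] := (cvgryPge _).1 sigma_cvg (obj 0 / e).
exists N => // k /= /NP h; rewrite sub0r normrN ger0_norm ?penalty_ge0//.
have h3 : sigma k * penalty (w k) <= obj 0.
  by apply: le_trans (obj_penalty_le k complementarity0); rewrite lerDr.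
rewrite -(ler_pM2l (sigma_gt0 k)); apply: le_trans h3 _.
by move: h; rewrite ler_pdivrMr.
Qed.

Lemma mpcc_minimizer x : complementarity_set x ->
  (forall x', complementarity_set x' -> obj x <= obj x') ->
  global_minimizer (mpcc_feasible A B C) (mpcc_objective Dop yd alpha1 alpha2 eps)
    (state A B C x, x).
Proof.
move=> xC xmin; split.
  by split => //=; apply/state_equationE; exact: stateP.
move=> [y x'] [/= /state_equationE yx' xC'].
rewrite (state_unique A_iso yx').
by have := xmin x' xC'; rewrite !objE.
Qed.

Definition box_integrals_cvg (U : set_system nat) (x : H * H) :=
  forall a b, good_box Omega a b -> lt_box a b ->
    \int[mu]_(t in box a b) (w k).1 t @[k --> U] --> \int[mu]_(t in box a b) x.1 t /\
    \int[mu]_(t in box a b) (w k).2 t @[k --> U] --> \int[mu]_(t in box a b) x.2 t.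

Lemma minimizers_bounded k : Hdot (w k) (w k) <= obj 0 / (eps / 2).
Proof.
rewrite ler_pdivlMr ?divr_gt0// mulrC; apply: le_trans (cost_coercive _) _.
apply: le_trans (obj_le_complementarity k complementarity0).
by rewrite objE control_costE lerDr mulr_ge0// sqr_ge0.
Qed.

(** An arbitrary filter finer than [\oo] is allowed, so that the ultrafilter and the image filter of
    a weakly convergent subsequence are treated alike. *)
Lemma penalty_limit (U : set_system nat) (UP : ProperFilter U) :
  (forall S, (\oo : set_system nat) S -> U S) ->
  (forall a b, good_box Omega a b -> lt_box a b ->
    cvg (\int[mu]_(t in box a b) (w k).1 t @[k --> U]) /\
    cvg (\int[mu]_(t in box a b) (w k).2 t @[k --> U])) ->
  exists x, [/\ complementarity_set x, box_integrals_cvg U x,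
    forall x', complementarity_set x' -> obj x <= obj x' &
    forall e, 0 < e -> U [set k | Hdot (w k - x) (w k - x) <= e]].
Proof.
move=> Uoo Ucvg.
have [K [cK oK]] := constants.
have wM k : obj (w k) <= obj 0 by exact: obj_le_complementarity.
have c40 : 0 < eps / 2 / 4 by rewrite !divr_gt0.
have [x [x1 x2 x3]] := exists_weak_limit (UP := UP) HP
  (Hdot_complete Omega_bounded) c40 obj_ge0
  (quadratic_objective_midpoint yd cost_form_psd (inner_form D) obs_linear cost_coercive)
  (quadratic_objective_lsc yd HP cost_form_psd (inner_form D) obs_linear cK oK) wM.
have xI : box_integrals_cvg U x.
  move=> a b gab ab; have [/cvg_ex[/= l1 h1] /cvg_ex[/= l2 h2]] := Ucvg a b gab ab.
  have [p pE] := Rintegral_L2dot oOmega Omega_bounded (measurable_box a b).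
  have [_ lin d0] := dotP.
  have bnd (u : L2space mu) : L2dot u p ^+ 2 <= L2dot p p * L2dot u u.
    by rewrite mulrC; exact: form_cauchy_schwarz.
  split.
    rewrite (x2 (fun y => \int[mu]_(t in box a b) y.1 t) l1)//.
      by move=> c y z; rewrite !pE -lin.
    exists (L2dot p p) => y; rewrite pE; apply: le_trans (bnd _) _.
    by apply: ler_wpM2l => //; exact: L2dot_le_Hdot1.
  rewrite (x2 (fun y => \int[mu]_(t in box a b) y.2 t) l2)//.
    by move=> c y z; rewrite !pE -lin.
  exists (L2dot p p) => y; rewrite pE; apply: le_trans (bnd _) _.
  by apply: ler_wpM2l => //; exact: L2dot_le_Hdot2.
have xC : complementarity_set x.
  (* The limit of the penalty requires a uniform [H^1] bound on the differences, obtained from the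
     bound on the minimizers. *)
  have hM k : Hdot (w k - x) (w k - x) <= 2 * (obj 0 / (eps / 2)) + 2 * Hdot x x.
    have := form_triangle HP (w k) (- x).
    have -> : Hdot (- x) (- x) = Hdot x x.
      by have := form_subC HP x 0; rewrite subr0 sub0r => ->.
    move/le_trans; apply; rewrite lerD2r ler_pM2l//; exact: minimizers_bounded.
  have sub (u v : H) a b : \int[mu]_(t in box a b) (u - v) t =
      \int[mu]_(t in box a b) u t - \int[mu]_(t in box a b) v t.
    have [p pE] := Rintegral_L2dot oOmega Omega_bounded (measurable_box a b).
    by rewrite !pE -(formBl dotP).
  apply: (complementarity_limit Omega_bounded UP hM).
  - move=> a b gab ab; have [h _] := xI a b gab ab.
    under eq_fun do rewrite sub.
    by apply/subr_cvg0.
  - move=> a b gab ab; have [_ h] := xI a b gab ab.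
    under eq_fun do rewrite sub.
    by apply/subr_cvg0.
  - by move=> S /penalty_cvg0 h; exact: Uoo.
exists x; split; [exact: xC|exact: xI| |].
- by move=> x' xC'; apply: x1 => k; exact: obj_le_complementarity.
- by apply: x3 => k; exact: obj_le_complementarity.
Qed.

End penalty_method.

(** * Ultrafilters, subsequences and the conclusion *)

Lemma le_half_sqr (R : realFieldType) (n c : R) : n ^+ 2 <= c -> n <= (c + 1) / 2.
Proof. by move=> nc; have := sqr_ge0 (n - 1); lra. Qed.

(** Compactness of a segment yields a cluster point. An ultrafilter contains the preimage of each
    neighbourhood or its complement, and clustering excludes the complement. *)
Lemma ultrafilter_bounded_cvg (R : realType) (T : Type) (U : set_system T)
    (s : T -> R) (M : R) :
  UltraFilter U -> (forall k, `|s k| <= M) -> cvg (s k @[k --> U]).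
Proof.
move=> UU sM.
have [|p [_ pc]] := @segment_compact R (- M) M (s k @[k --> U]) _ _.
  by apply: nearW => k; rewrite /= in_itv/= -ler_norml.
apply/cvg_ex; exists p => A pA.
have [//|nA] := in_ultra_setVsetC (s @^-1` A) UU.
by have [x []] := pc (~` A) A nA pA.
Qed.

Lemma exists_subsequence (P : nat -> nat -> Prop) :
  (forall n m, exists2 k, (m < k)%N & P n k) ->
  exists f : nat -> nat, {homo f : m n / (m < n)%N} /\ forall n, P n (f n).
Proof.
move=> h.
have hg (p : nat * nat) : exists k, (p.2 < k)%N /\ P p.1 k.
  by have [k mk Pk] := h p.1 p.2; exists k.
have [g gP] := choice hg.
pose f := fix f n := if n is n'.+1 then g (n, f n') else g (0%N, 0%N).
exists f; split; last by case=> [|n]; exact: (gP (_, _)).2.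
apply: homo_ltn; first by move=> ? ? ?; exact: ltn_trans.
by move=> n; exact: (gP (n.+1, f n)).1.
Qed.

Theorem proposition4p4 (R : realType) (d : nat) (d_gt0 : (0 < d)%N)
    (Omega : set 'rV[R]_d) (oOmega : open Omega)
    (Omega_neq0 : Omega !=set0) (Omega_connected : connected Omega)
    (Omega_bounded : bounded_set Omega) (Omega_cone : cone_condition Omega)
    (Y D : hilbertType R) (yd : D)
    (A : {linear Y -> topdual Y}) (B C : {linear H1 oOmega -> topdual Y})
    (Dop : {linear Y -> D})
    (A_iso : bounded_isomorphism (fun y : Y => `|y|) (@topdual_norm R Y) A)
    (B_bounded : bounded_op (@H1norm R d Omega oOmega) (@topdual_norm R Y) B)
    (C_bounded : bounded_op (@H1norm R d Omega oOmega) (@topdual_norm R Y) C)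
    (D_bounded : bounded_op (fun y : Y => `|y|) (fun z : D => `|z|) Dop)
    (alpha1 alpha2 eps : R)
    (alpha1_ge0 : 0 <= alpha1) (alpha2_ge0 : 0 <= alpha2) (eps_gt0 : 0 < eps)
    (sigma : nat -> R) (sigma_gt0 : forall k, 0 < sigma k)
    (sigma_cvg : sigma k @[k --> \oo] --> +oo)
    (w : nat -> H1 oOmega * H1 oOmega)
    (w_min : forall k, global_minimizer setT
       (penalized_objective A B C Dop yd alpha1 alpha2 eps (sigma k)) (w k)) :
  (exists (f : nat -> nat) (wbar : H1 oOmega * H1 oOmega),
    [/\ {homo f : m n / (m < n)%N},
        strong_cvg (@H1pair_norm R d Omega oOmega) (w \o f) wbar,
        complementarity_set wbar &
        global_minimizer (mpcc_feasible A B C)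
          (mpcc_objective Dop yd alpha1 alpha2 eps)
          (state A B C wbar, wbar)])
  /\
  (forall (f : nat -> nat) (wbar : H1 oOmega * H1 oOmega),
    {homo f : m n / (m < n)%N} ->
    weak_cvg (@H1pair_norm R d Omega oOmega) (w \o f) wbar ->
    complementarity_set wbar /\
    global_minimizer (mpcc_feasible A B C)
      (mpcc_objective Dop yd alpha1 alpha2 eps)
      (state A B C wbar, wbar)).
Proof.
pose H := H1 oOmega.
have limit := @penalty_limit R d Omega oOmega Omega_bounded Y D yd A B C Dop
  A_iso B_bounded C_bounded D_bounded alpha1 alpha2 eps alpha1_ge0 alpha2_ge0
  eps_gt0 sigma sigma_gt0 sigma_cvg w w_min.
have minimizer := @mpcc_minimizer R d Omega oOmega Y D yd A B C Dop A_iso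
  alpha1 alpha2 eps.
have [M wM] : exists M, forall k, H1pair_norm (w k) <= M.
  have h := @minimizers_bounded R d Omega oOmega Y D yd A B C Dop
    alpha1 alpha2 eps alpha1_ge0 alpha2_ge0 eps_gt0 sigma sigma_gt0 w w_min.
  by eexists => k; apply: le_half_sqr; rewrite H1pair_norm_sqr; exact: h.
split.
- have [U [UU Uoo]] := ultraFilterLemma (F := \oo) _.
  have [a b gab ab|x [xC _ xmin xU]] := limit U _ Uoo.
    have [K K0 hK] := box_functional oOmega Omega_bounded a b.
    split; apply: (@ultrafilter_bounded_cvg _ _ _ _ (K * M)) => k.
      by apply: le_trans (hK (w k)).1 _; rewrite ler_wpM2l.
    by apply: le_trans (hK (w k)).2 _; rewrite ler_wpM2l.
  (* Sets of [U] meet every tail because [U] refines [\oo]; this turns convergence along [U] into a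
     genuine subsequence. The precision is squared because [Hdot] is a squared norm. *)
  have [n m|f [fmono fx]] := @exists_subsequence (fun n k =>
      Hdot (w k - x) (w k - x) <= n.+1%:R^-1 ^+ 2).
    have e0 : (0 : R) < n.+1%:R^-1 ^+ 2 by rewrite exprn_gt0// invr_gt0 ltr0n.
    have Um : U [set k | (m < k)%N] by apply: Uoo; exists m.+1.
    by have [k [? ?]] := filter_ex (filterI (xU _ e0) Um); exists k.
  exists f, x; split; [exact: fmono| |exact: xC|exact: minimizer xC xmin].
  apply/cvgrPdist_le => e e0; have := near_inv_lt e0.
  apply: filterS => n ne; rewrite sub0r normrN ger0_norm ?sqrtr_ge0//.
  apply: le_trans (ltW ne).
  rewrite -(@ler_pXn2r _ 2)// ?nnegrE ?sqrtr_ge0// ?invr_ge0//.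
  by rewrite H1pair_norm_sqr; exact: fx.
- move=> f wbar fmono fweak.
  have fge n : (n <= f n)%N.
    elim: n => // n ih; exact: leq_ltn_trans ih (fmono _ _ (ltnSn n)).
  have bcvg a b : \int[lebesgue_on oOmega]_(t in box a b) (w k).1 t @[k --> f @ \oo]
        --> \int[lebesgue_on oOmega]_(t in box a b) wbar.1 t /\
      \int[lebesgue_on oOmega]_(t in box a b) (w k).2 t @[k --> f @ \oo]
        --> \int[lebesgue_on oOmega]_(t in box a b) wbar.2 t.
    have [F [G [FE GE]]] := box_scalar oOmega Omega_bounded a b.
    have [K K0 hK] := box_functional oOmega Omega_bounded a b.
    have Fb : bounded_op (@H1pair_norm R d Omega oOmega) (fun r : R => `|r|) F.
      by exists K => x; rewrite FE; exact: (hK x).1.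
    have Gb : bounded_op (@H1pair_norm R d Omega oOmega) (fun r : R => `|r|) G.
      by exists K => x; rewrite GE; exact: (hK x).2.
    have hF := fweak F Fb; have hG := fweak G Gb.
    rewrite FE (_ : (fun k => F _) = (fun k =>
      \int[lebesgue_on oOmega]_(t in box a b) (w (f k)).1 t)) in hF; last first.
      by apply/funext => k; exact: FE.
    rewrite GE (_ : (fun k => G _) = (fun k =>
      \int[lebesgue_on oOmega]_(t in box a b) (w (f k)).2 t)) in hG; last first.
      by apply/funext => k; exact: GE.
    by split; [exact: hF|exact: hG].
  have [S [N _ NS]|a b _ _|x [xC xI xmin _]] := limit (f @ \oo) _.
  + by exists N => // n /= Nn; apply: NS; exact: leq_trans (fge n).
  + by have [h1 h2] := bcvg a b; split; [exact: cvgP h1|exact: cvgP h2].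
  (* Both have the limits of the box integrals along [f @ \oo] as their own box integrals, and these
     determine an element of [H^1]. *)
  have -> : wbar = x.
    rewrite [wbar]surjective_pairing [x]surjective_pairing; congr pair.
      apply: (H1_eq_box Omega_bounded) => a b gab ab.
      exact: cvg_unique (bcvg a b).1 (xI a b gab ab).1.
    apply: (H1_eq_box Omega_bounded) => a b gab ab.
    exact: cvg_unique (bcvg a b).2 (xI a b gab ab).2.
  by split; [exact: xC|exact: minimizer xC xmin].
Qed.
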